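(* There exists a universal constant $c>0$ such that the following holds for all integers $d\ge1$, $k\ge1$. Let $C\subseteq\mathbb{R}^{1+d}$ be a convex body with $\mathrm{proj}_{\mathbb{R}}(C)=[0,k]$, and let $S=C\cap(\mathbb{Z}\times\mathbb{R}^d)$. Then there exists a point $\bar{\mathbf{x}}=(\bar z,\bar x)\in S$ such that every halfspace $H\subset\mathbb{R}^{1+d}$ containing $\bar{\mathbf{x}}$ satisfies $$\mathcal{H}_d(S\cap H)\ \ge\ \left(\frac1e-c\,\frac dk\right)\mathcal{H}_d(S).$$ In particular, there exists a universal constant $\alpha>0$ (independent of $d,k,C$) such that if $k\ge\alpha d$, then $$\mathcal{F}(S)\ \ge\ \frac12\left(\frac d{d+1}\right)^d.$$
   Context: A convex body is a compact convex set with nonempty interior. $\mathbb{R}^{1+d}$ is identified with $\mathbb{R}\times\mathbb{R}^d$ and $\mathrm{proj}_{\mathbb{R}}$ is the projection onto the first coordinate. $\mathcal{H}_r$ is the $r$-dimensional Hausdorff measure, normalized so that for integer $r$ it coincides with $r$-dimensional Lebesgue measure on $r$-dimensional affine subspaces; so for $A\subseteq S$, $\mathcal{H}_d(A)=\sum_{z\in\mathbb{Z}}\mathrm{vol}_d(A\cap(\{z\}\times\mathbb{R}^d))$. Halfspaces are closed: $H(u,x)=\{y: u^\top(y-x)\ge 0\}$ with $u\neq 0$. For $K\subseteq\mathbb{R}^p$ with Hausdorff dimension $q=\dim K$, the Oertel radius of $K$ is $$\mathcal{F}(K)=\sup_{x\in K}\ \inf_{u\in\mathbb{R}^p\setminus\{0\}}\frac{\mathcal{H}_q(H(u,x)\cap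 K)}{\mathcal{H}_q(K)}.$$ *)

(* Defs.v *)
From HB Require Import structures.
From mathcomp Require Import all_boot all_order all_algebra.
From mathcomp Require Import all_classical all_reals all_analysis.
Set Implicit Arguments.
Unset Strict Implicit.
Unset Printing Implicit Defensive.
Import Order.TTheory GRing.Theory Num.Theory.
Import numFieldNormedType.Exports.
Local Open Scope classical_set_scope.
Local Open Scope ring_scope.

Section definitions.
Context {R : realType}.

(* The norm that the library puts on ['rV[R]_p] is the sup norm, so the
   Euclidean distance is introduced explicitly. *)
Definition dotp p (u v : 'rV[R]_p) : R := (u *m v^T) ord0 ord0.

Definition eucl_dist p (x y : 'rV[R]_p) : R := Num.sqrt (dotp (x - y) (x - y)).

(* [diam set0 = -oo] *)
Definition diam p (E : set 'rV[R]_p) : \bar R :=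
  ereal_sup [set (eucl_dist x y)%:E | x in E & y in E].

Definition Gamma (s : R) : R :=
  \int[lebesgue_measure]_(t in `]0, +oo[) (t `^ (s - 1) * expR (- t)).

(* For integer [r] this is the volume of the unit ball of R^r; with this
   constant H_r agrees with Lebesgue measure on r-dimensional affine
   subspaces. *)
Definition ball_volume (r : R) : R := pi `^ (r / 2) / Gamma (r / 2 + 1).

(* The empty set is singled out because of r = 0, where x `^ 0 = 1. *)
Definition hausdorff_gauge p (r : R) (E : set 'rV[R]_p) : \bar R :=
  if E == set0 then 0%E
  else ((ball_volume r / 2 `^ r)%:E * poweR (diam E) r)%E.

Definition hausdorff_content p (r delta : R) (A : set 'rV[R]_p) : \bar R :=
  ereal_inf [set (\sum_(0 <= i <oo) hausdorff_gauge r (F i))%E | F in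
    [set F : (set 'rV[R]_p)^nat |
      A `<=` \bigcup_i F i /\ forall i, (diam (F i) <= delta%:E)%E]].

(* The supremum is the limit as delta decreases to 0. *)
Definition hausdorff_measure p (r : R) (A : set 'rV[R]_p) : \bar R :=
  ereal_sup [set hausdorff_content r delta A | delta in [set delta | 0 < delta]].

Definition hausdorff_dim p (A : set 'rV[R]_p) : R :=
  inf [set r | 0 <= r /\ hausdorff_measure r A = 0%E].

Definition halfspace p (u x : 'rV[R]_p) : set 'rV[R]_p :=
  [set y | 0 <= dotp u (y - x)].

Definition oertel_radius p (K : set 'rV[R]_p) : \bar R :=
  let q := hausdorff_dim K in
  ereal_sup [set
    ereal_inf [set
      (hausdorff_measure q (halfspace u x `&` K) / hausdorff_measure q K)%E
      | u in [set u : 'rV[R]_p | u != 0]]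
    | x in K].

Definition convex_body p (C : set 'rV[R]_p) : Prop :=
  [/\ compact C, convex_set (C : set (convex_lmodType 'rV[R]_p))
    & interior C !=set0].

(* R^(1+d) is ['rV[R]_d.+1]; the distinguished first coordinate has index
   [ord0]. *)
Definition proj_first d (C : set 'rV[R]_d.+1) : set R :=
  [set x ord0 ord0 | x in C].

Definition integer_slices d (C : set 'rV[R]_d.+1) : set 'rV[R]_d.+1 :=
  C `&` [set x | x ord0 ord0 \is a Num.int].

End definitions.

(* Main.v *)
(** Only ratios of H_d matter, so it is enough to know that on R^d the measure
    H_d is a constant multiple kappa of Lebesgue measure on compact sets (by
    translation invariance and scaling on dyadic cubes), with 0 < kappa < oo;
    the value of kappa, hence the isodiametric inequality, plays no role.

    Let V be the volume of C and f(z) that of the slice C_z.  The body C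
    contains the convex hull of C_z and of points of both end slices, which
    gives f <= (4 d / k) V.  For a halfspace H the function
    g(z) = vol (C_z cap H) is quasi-concave by Brunn-Minkowski, so the sum of
    g over the integers differs from vol (C cap H) by O(max f) = O(d / k) V.

    Let p be the centroid of C.  Gruenbaum's bound vol (C cap H) >= V / e for
    the halfspaces H through p follows from the log-concavity of
    G(s) = vol (C cap {W > s}), W an affine function with mean w: the integral
    of G is w V, and comparison with an exponential touching G at s < w gives
    G(s) >= V / e.  Now choose q in C in the end slice farther from p and move
    p to xbar = (1 - t) p + t q with integral first coordinate, t <= 2 / k.
    The homothety x |-> (1 - t) x + t q maps C cap H_p into C cap H_xbar, so
    only a factor (1 - t)^(d+1) >= 1 - 4 d / k is lost.  *)

Require Import Defs.
From HB Require Import structures.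
From mathcomp Require Import all_boot all_order all_algebra.
From mathcomp Require Import all_classical all_reals all_analysis.
From mathcomp Require Import measurable_realfun.
From mathcomp Require Import ring lra.
Set Implicit Arguments.
Unset Strict Implicit.
Unset Printing Implicit Defensive.
Import Order.TTheory GRing.Theory Num.Theory.
Import numFieldNormedType.Exports.
Local Open Scope classical_set_scope.
Local Open Scope ring_scope.

(** * Lebesgue measure on the line *)

Section OneDim.
Context {R : realType}.
Local Notation mu := (@lebesgue_measure R).
Local Notation GR := (measurableTypeR R).

(** Volume on R^n is built one coordinate at a time, as a product of the line with R^(n-1), so
    slicing along the first coordinate is its very definition. Brunn-Minkowski is proved by
    induction on the dimension in its multiplicative, dimension-free form: for slices it is exactly
    the hypothesis of Prekopa-Leindler on the line. That form gives both the log-concavity of the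
    tail and the quasi-concavity of slice volumes, since a geometric mean dominates the minimum. The
    constant 24 collects three losses in units of d/k: 4 from the homothety, 8 from passing from vol
    (C cap H) to the sum over its slices, 12 from passing from V to the sum over the slices of C.
    The Oertel radius refers to the Hausdorff dimension of S, which has to be shown equal to d. Here
    the exact value of Gamma is irrelevant but its positivity is not: a vanishing gauge constant
    would make the measure of that exponent vanish. For the second claim (d/(d+1))^d is at most 1/2,
    so that a fraction 1/4, strictly below 1/e, suffices. *)

Lemma measurable_affine (a b : R) :
  measurable_fun [set: GR] (fun x : GR => a * x + b : GR).
Proof. by apply: measurable_funD => //; apply: measurable_funM. Qed.

(** Uniqueness of Lebesgue measure: the pushforward under the affine map, rescaled by [a], has the
    right value on half-open intervals. *)
Lemma lebesgue_measure_affine (a b : R) (A : set GR) : 0 < a -> measurable A ->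
  (mu ((fun x => (a * x + b)%R) @^-1` A) = (a^-1)%:E * mu A)%E.
Proof.
move=> a0 mA; have a0' : 0 <= a by exact: ltW.
have mf : measurable_fun [set: GR] (fun x : GR => a * x + b : GR) by exact: measurable_affine.

pose m0 : {measure set GR -> \bar R} := pushforward mu (fun x : GR => (a * x + b)%R : GR).
pose m1 := m0 mf.
pose m2 : {measure set GR -> \bar R} := mscale (NngNum a0') m1.
have : mu A = m2 A.
  apply: (@lebesgue_measure_unique R m2) => // _ [[x y] _ <-] /=.
  rewrite /mscale /= /m1 /= /pushforward.
  have -> : (fun x0 : R => a * x0 + b) @^-1` `]x, y] = `](x - b) / a, (y - b) / a]%classic.
    apply/seteqP; split => z /=; rewrite !in_itv/= ltr_pdivrMr// ler_pdivlMr//;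
      by rewrite ltrBlDr lerBrDr mulrC.
  rewrite !lebesgue_measure_itv/= !lte_fin ltr_pM2r ?invr_gt0// ltrD2r.
  case: ifP => _; last by rewrite mule0.
  rewrite -!EFinB -EFinM; congr EFin; field; lra.
move=> ->; rewrite /m2 /mscale /= /m1 /pushforward muleA -EFinM mulVf ?mul1e//; lra.
Qed.

Lemma ge0_integral_affine (a b : R) (f : GR -> \bar R) : 0 < a ->
  measurable_fun [set: GR] f -> (forall x, 0 <= f x)%E ->
  (\int[mu]_x f (a * x + b)%R = (a^-1)%:E * \int[mu]_x f x)%E.
Proof.
move=> a0 mf f0; have a0' : 0 <= a^-1 by rewrite invr_ge0 ltW.
have mg : measurable_fun [set: GR] (fun x : GR => a * x + b : GR) by exact: measurable_affine.
pose m0 : {measure set GR -> \bar R} := pushforward mu (fun x : GR => (a * x + b)%R : GR).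
pose m1 := m0 mg.
have := @ge0_integral_pushforward _ _ GR GR R _ mg mu setT f measurableT mf (fun x _ => f0 x).
rewrite preimage_setT => <-.
have -> : (\int[m1]_x f x = \int[mscale (NngNum a0') mu]_x f x)%E.
  apply: eq_measure_integral => A mA _.
  by rewrite /m1 /= /pushforward lebesgue_measure_affine.
by rewrite ge0_integral_mscale.
Qed.

(* The point sup A + inf B is approximated by a' + b'; up to an interval of
   length 2e around it the two translates A + b' and a' + B are disjoint. *)
Lemma lebesgue_measure_sumset (A B C : set GR) (r : R) :
  measurable A -> measurable B -> measurable C -> A !=set0 -> B !=set0 ->
  (forall x, A x -> `|x| <= r) -> (forall x, B x -> `|x| <= r) ->
  (forall x y, A x -> B y -> C (x + y)) -> (mu A + mu B <= mu C)%E.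
Proof.
move=> mA mB mC A0 B0 Ar Br ABC.
have supA : has_sup A.
  by split => //; exists r => x /Ar; rewrite ler_norml => /andP[].
have infB : has_inf B.
  by split => //; exists (- r) => x /Br; rewrite ler_norml => /andP[].
apply/lee_addgt0Pr => e e0.
have e20 : 0 < e / 2 by rewrite divr_gt0.
have [a' Aa' sa'] := sup_adherent e20 supA.
have [b' Bb' sb'] := inf_adherent e20 infB.
pose TA := (fun x : R => 1 * x + (- b')) @^-1` A.
pose TB := (fun x : R => 1 * x + (- a')) @^-1` B.
have mT (X : set GR) c : measurable X -> measurable ((fun x : R => 1 * x + c) @^-1` X).
  by move=> mX; rewrite -[X in measurable X]setTI; exact: measurable_affine.
have TAE : mu TA = mu A by rewrite lebesgue_measure_affine// invr1 mul1e.
have TBE : mu TB = mu B by rewrite lebesgue_measure_affine// invr1 mul1e.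
pose p := sup A + b'.
pose I := `[a' + inf B, p]%classic.
have TB_sub : TB `<=` (TB `&` `]p, +oo[) `|` I.
  move=> x TBx; have [px|px] := ltP p x; [left|right].
    by split => //=; rewrite in_itv/= px.
  rewrite /I /= in_itv/= px andbT -lerBrDl.
  have := ge_inf infB.2 TBx; lra.
rewrite -TAE -TBE.
have mTA : measurable TA by exact: mT.
have mTB : measurable TB by exact: mT.
have mTBp : measurable (TB `&` `]p, +oo[) by exact: measurableI.
have mI : measurable I by exact: measurable_itv.
have H1 : (mu TB <= mu (TB `&` `]p, +oo[%classic) + mu I)%E.
  apply: (@le_trans _ _ (mu ((TB `&` `]p, +oo[) `|` I))).
    by apply: le_measure; rewrite ?inE//; apply: measurableU.
  exact: measureU2.
have H2 : (mu I <= e%:E)%E.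
  rewrite /I lebesgue_measure_itv/= lte_fin; case: ifP => _; last by rewrite lee_fin ltW.
  rewrite -EFinB lee_fin /p; lra.
have H3 : (mu TA + mu (TB `&` `]p, +oo[%classic) <= mu C)%E.
  rewrite -measureU//.
    apply: le_measure; rewrite ?inE//; first exact: measurableU.
    move=> x [TAx|[TBx _]].
      by have := ABC _ _ TAx Bb'; rewrite mul1r subrK.
    by have := ABC _ _ Aa' TBx; rewrite mul1r addrC subrK.
  apply/seteqP; split => // x [TAx [_]] /=; rewrite in_itv/= andbT => px.
  have := ub_le_sup supA.2 TAx; rewrite /p in px; lra.
apply: (le_trans (leeD (lexx _) (le_trans H1 (leeD (lexx _) H2)))).
by rewrite addeA leeD2r.
Qed.

(** Tonelli for the indicator of the region [0 <= s < f x] under the graph, integrated in both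
    orders. *)
Lemma layer_cake d (T : measurableType d) (m : {sigma_finite_measure set T -> \bar R})
    (f : T -> R) : measurable_fun setT f -> (forall x, 0 <= f x) ->
  (\int[m]_x (f x)%:E = \int[mu]_(s in `[0%R, +oo[) m [set x | (s < f x)%R])%E.
Proof.
move=> mf f0.
pose GT (p : T * GR) := (\1_`[0, f p.1[ p.2)%:E : \bar R.
transitivity (\int[m]_x \int[mu]_s GT (x, s))%E.
  apply: eq_integral => x _; rewrite /GT /= integral_indic// setIT.
  rewrite -[RHS]/(mu (`[0, f x[%classic : set R)) lebesgue_measure_itv/= lte_fin.
  case: ltP => [_|]; first by rewrite sube0.
  by move=> fx; have /eqP -> : f x == 0 by rewrite eq_le fx f0.
rewrite (fubini_tonelli GT)//=.
- rewrite [RHS]integral_mkcond; apply: eq_integral => s _; rewrite patchE /GT /=.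
  case: ifPn => s0.
    have s0' : 0 <= s by move: s0; rewrite inE/= in_itv/= andbT.
    transitivity (\int[m]_x (\1_[set x | s < f x] x)%:E)%E.
      by apply: eq_integral => x _; rewrite !indicE !mem_setE in_itv/= s0'.
    rewrite integral_indic ?setIT//.
    rewrite -[X in measurable X]setTI.
    have := measurable_fun_ltr (measurable_cst s : measurable_fun setT _) mf.
    by move=> /(_ measurableT [set true]); exact.
  apply: integral0_eq => x _; rewrite indicE mem_setE in_itv/=.
  move: s0; rewrite notin_setE/= in_itv/= andbT => /negP.
  by rewrite -ltNge ltNge => /negbTE ->.
- apply/measurable_EFinP.
  pose fsnd (p : T * GR) := (0 <= p.2)%R.
  pose f21 (p : T * GR) := (p.2 < f p.1)%R.
  have mS : measurable (fsnd @^-1` [set true] `&` f21 @^-1` [set true]).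
    apply: measurableI.
    - have : measurable_fun setT fsnd by exact: measurable_fun_ler.
      by move=> /(_ measurableT [set true]); rewrite setTI; exact.
    - have : measurable_fun setT f21.
        by apply: measurable_fun_ltr => //; exact: measurableT_comp.
      by move=> /(_ measurableT [set true]); rewrite setTI; exact.
  rewrite [X in measurable_fun _ X](_ : _ = \1_(fsnd @^-1` [set true] `&` f21 @^-1` [set true])).
    exact: measurable_indic.
  apply/funext => -[x s] /=; rewrite !indicE.
  suff -> : (s \in `[0, f x[%classic) =
      ((x, s) \in fsnd @^-1` [set true] `&` f21 @^-1` [set true]) by [].
  by apply/idP/idP; rewrite !inE/= in_itv/= => /andP.
- by move=> p; rewrite lee_fin.
Qed.
End OneDim.

(** * The Prekopa-Leindler inequality on the line *)

Section PrekopaLeindler.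
Context {R : realType}.
Local Notation mu := (@lebesgue_measure R).
Local Notation GR := (measurableTypeR R).

Lemma measurable_superlevel d (T : measurableType d) (f : T -> R) (s : R) :
  measurable_fun setT f -> measurable [set x | s < f x].
Proof.
move=> mf; rewrite -[X in measurable X]setTI.
have := measurable_fun_ltr (measurable_cst s : measurable_fun setT _) mf.
by move=> /(_ measurableT [set true]); exact.
Qed.

Lemma measurable_fun_superlevel d (T : measurableType d)
    (m : {sigma_finite_measure set T -> \bar R}) (f : T -> R) :
  measurable_fun setT f ->
  measurable_fun [set: GR] (fun s : GR => m [set x | s < f x]).
Proof.
move=> mf; pose E := [set p : T * GR | (p.2 : R) < f p.1].
have mE : measurable E.
  rewrite -[X in measurable X]setTI.
  have : measurable_fun setT (fun p : T * GR => (p.2 : R) < f p.1).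
    by apply: measurable_fun_ltr => //; exact: measurableT_comp.
  by move=> /(_ measurableT [set true]); exact.
rewrite (_ : (fun s => _) = m \o ysection E); first exact: measurable_fun_ysection.
apply/funext => s /=; congr (m _); apply/seteqP.
by split => x; rewrite /ysection/= inE.
Qed.

(** Young's inequality with the conjugate exponents 1/(1-t) and 1/t. *)
Lemma weighted_am_gm (a b t : R) : 0 <= a -> 0 <= b -> 0 < t < 1 ->
  a `^ (1 - t) * b `^ t <= (1 - t) * a + t * b.
Proof.
move=> a0 b0 /andP[t0 t1].
have t1' : 0 < 1 - t by rewrite subr_gt0.
have := @conjugate_powR R (a `^ (1 - t)) (b `^ t) (1 - t)^-1 t^-1 (powR_ge0 _ _)
  (powR_ge0 _ _).
rewrite !invr_gt0 => /(_ t1' t0); rewrite !invrK => /(_ (subrK _ _)).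
by rewrite -!powRrM !divff ?gt_eqF// !powRr1// [a * _]mulrC [b * t]mulrC.
Qed.

(** When [f] and [g] both have supremum 1, their superlevel sets are nonempty for the same levels
    [s < 1], so the sumset inequality applies level by level; integrating over [s] gives even the
    arithmetic mean of the integrals. *)
Lemma prekopa_leindler_normalized (f g h : GR -> R) (t r : R) :
  0 < t < 1 -> 0 <= r ->
  measurable_fun setT f -> measurable_fun setT g -> measurable_fun setT h ->
  (forall x, 0 <= f x <= 1) -> (forall x, 0 <= g x <= 1) -> (forall x, 0 <= h x) ->
  (forall x, 0 < f x -> `|x| <= r) -> (forall x, 0 < g x -> `|x| <= r) ->
  (forall s, s < 1 -> exists x, s < f x) -> (forall s, s < 1 -> exists x, s < g x) ->
  (forall s x y, 0 <= s -> s < f x -> s < g y -> s < h ((1 - t) * x + t * y)) ->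
  ((1 - t)%:E * \int[mu]_x (f x)%:E + t%:E * \int[mu]_x (g x)%:E
    <= \int[mu]_x (h x)%:E)%E.
Proof.
move=> /andP[t0 t1] r0 mf mg mh f01 g01 h0 fr gr fs gs H.
have t1' : 0 < 1 - t by rewrite subr_gt0.
have f0 x : 0 <= f x by case/andP: (f01 x).
have g0 x : 0 <= g x by case/andP: (g01 x).
rewrite !layer_cake//.
have mfs := measurable_fun_superlevel mu mf.
have mgs := measurable_fun_superlevel mu mg.
have mhs := measurable_fun_superlevel mu mh.
have intZ (u : R) (v : GR -> R) : 0 < u -> measurable_fun setT v ->
    (u%:E * \int[mu]_(s in `[0%R, +oo[) mu [set x | (s < v x)%R] =
     \int[mu]_(s in `[0%R, +oo[) (u%:E * mu [set x | (s < v x)%R]))%E.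
  move=> u0 mv; rewrite ge0_integralZl//; last by rewrite lee_fin ltW.
  by apply: measurable_funTS; exact: measurable_fun_superlevel.
rewrite !intZ//.
rewrite -ge0_integralD//; last first.
- by apply: measurable_funTS; apply: emeasurable_funM.
- by move=> x _; rewrite mule_ge0// lee_fin ltW.
- by apply: measurable_funTS; apply: emeasurable_funM.
- by move=> x _; rewrite mule_ge0// lee_fin ltW.
apply: ge0_le_integral => //.
- by move=> x _; rewrite adde_ge0// mule_ge0// lee_fin ltW.
- apply: measurable_funTS; apply: emeasurable_funD.
  + exact: emeasurable_funM.
  + exact: emeasurable_funM.
- exact: measurable_funTS.
move=> s /=; rewrite in_itv/= andbT => s0.
have [s1|s1] := ltP s 1; last first.
  rewrite (_ : [set x | s < f x] = set0); last first.
    apply/seteqP; split => // x /=; case/andP: (f01 x) => _; lra.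
  rewrite (_ : [set x | s < g x] = set0); last first.
    apply/seteqP; split => // x /=; case/andP: (g01 x) => _; lra.
  by rewrite measure0 !mule0 adde0.
(* The dilate of a superlevel set by [u] is written as a preimage under [x |-> u^-1 * x], the form
   in which its measure is known. *)
have E (u : R) (v : GR -> R) : 0 < u -> measurable_fun setT v ->
    (u%:E * mu [set x | (s < v x)%R] =
     mu ((fun x : GR => (u^-1 * x + 0)%R : GR) @^-1` [set x | (s < v x)%R]))%E.
  move=> u0 mv; rewrite lebesgue_measure_affine ?invr_gt0//; last exact: measurable_superlevel.
  by rewrite invrK.
have mE (u : R) (v : GR -> R) : measurable_fun setT v ->
    measurable ((fun x : GR => (u^-1 * x + 0)%R : GR) @^-1` [set x | (s < v x)%R]).
  move=> mv; rewrite -[X in measurable X]setTI; apply: measurable_affine => //.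
  exact: measurable_superlevel.
rewrite !E//; apply: (@lebesgue_measure_sumset _ _ _ _ r).
- exact: mE.
- exact: mE.
- exact: measurable_superlevel.
- have [x xs] := fs _ s1; exists ((1 - t) * x) => /=.
  by rewrite addr0 mulKf// gt_eqF.
- have [x xs] := gs _ s1; exists (t * x) => /=.
  by rewrite addr0 mulKf// gt_eqF.
- move=> x /= xs; have := fr _ (le_lt_trans s0 xs).
  rewrite addr0 normrM gtr0_norm ?invr_gt0// mulrC ler_pdivrMr// => /le_trans; apply.
  by rewrite ler_piMr// lerBlDr lerDl ltW.
- move=> x /= xs; have := gr _ (le_lt_trans s0 xs).
  rewrite addr0 normrM gtr0_norm ?invr_gt0// mulrC ler_pdivrMr// => /le_trans; apply.
  by rewrite ler_piMr// ltW.
- move=> x y /= xs ys; have := H _ _ _ s0 xs ys.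
  by rewrite !addr0 !mulVKf// gt_eqF.
Qed.

Lemma bounded_integral_lty (f : GR -> R) (r M : R) :
  measurable_fun setT f -> (forall x, 0 <= f x <= M) ->
  (forall x, 0 < f x -> `|x| <= r) -> (\int[mu]_x (f x)%:E < +oo)%E.
Proof.
move=> mf fM fr; have f0 x : 0 <= f x by case/andP: (fM x).
have M0 : 0 <= M by case/andP: (fM 0); exact: le_trans.
apply: (@le_lt_trans _ _ (\int[mu]_x (M%:E * (\1_(`[-r, r]%classic : set R) x)%:E))%E).
  apply: ge0_le_integral => //.
  - by move=> x _; rewrite lee_fin.
  - exact/measurable_EFinP.
  - apply: emeasurable_funM => //; apply/measurable_EFinP.
    exact: measurable_indic.
  - move=> x _; rewrite -EFinM lee_fin.
    have [fx|] := ltP 0 (f x); last by move=> /le_trans; apply; rewrite mulr_ge0.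
    rewrite indicE mem_set ?mulr1; last by have := fr _ fx; rewrite ler_norml/= in_itv/=.
    by case/andP: (fM x).
rewrite ge0_integralZl//; last first.
  by apply/measurable_EFinP; exact: measurable_indic.
rewrite integral_indic// setIT lte_mul_pinfty// ?lee_fin//.
rewrite -[X in (X < _)%E]/(mu (`[-r, r]%classic : set R)).
by rewrite lebesgue_measure_itv/=; case: ifP => //; rewrite -EFinB ltry.
Qed.

(** Dividing [f], [g] by their suprema a, b and [h] by a^(1-t) b^t reduces to the normalized case;
    the arithmetic mean obtained there is then weakened to the geometric one, which is homogeneous
    and lets the suprema cancel. *)
Lemma prekopa_leindler (f g h : GR -> R) (t r M : R) :
  0 < t < 1 -> 0 <= r ->
  measurable_fun setT f -> measurable_fun setT g -> measurable_fun setT h ->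
  (forall x, 0 <= f x <= M) -> (forall x, 0 <= g x <= M) -> (forall x, 0 <= h x) ->
  (forall x, 0 < f x -> `|x| <= r) -> (forall x, 0 < g x -> `|x| <= r) ->
  (forall x y, f x `^ (1 - t) * g y `^ t <= h ((1 - t) * x + t * y)) ->
  (((fine (\int[mu]_x (f x)%:E)) `^ (1 - t) * (fine (\int[mu]_x (g x)%:E)) `^ t)%:E
    <= \int[mu]_x (h x)%:E)%E.
Proof.
move=> t01 r0 mf mg mh fM gM h0 fr gr H.
have /andP[t0 t1] := t01; have t1' : 0 < 1 - t by rewrite subr_gt0.
have f0 x : 0 <= f x by case/andP: (fM x).
have g0 x : 0 <= g x by case/andP: (gM x).
have sup_rng (v : GR -> R) : (forall x, 0 <= v x <= M) -> has_sup (range v).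
  move=> vM; split; first by exists (v 0); exists 0.
  by exists M => _ [x _ <-]; case/andP: (vM x).
have sup_ub (v : GR -> R) x : (forall x, 0 <= v x <= M) -> v x <= sup (range v).
  by move=> /sup_rng [_ ?]; apply: ub_le_sup => //; exists x.
have int0 (v : GR -> R) : (forall x, 0 <= v x <= M) -> ~ 0 < sup (range v) ->
    (\int[mu]_x (v x)%:E = 0)%E.
  move=> vM /negP; rewrite -leNgt => s0; apply: integral0_eq => x _.
  congr EFin; apply/eqP; rewrite eq_le; case/andP: (vM x) => -> _; rewrite andbT.
  exact: le_trans (sup_ub _ _ vM) s0.
have hI0 : (0 <= \int[mu]_x (h x)%:E)%E by apply: integral_ge0 => x _; rewrite lee_fin.
(* A zero supremum makes the integral zero, and 0 to a positive power is 0, so the left-hand side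
   vanishes. *)
have [a0|/int0 ->//] := pselect (0 < sup (range f)); last first.
  by rewrite /= powR0 ?mul0r// gt_eqF.
have [b0|/int0 ->//] := pselect (0 < sup (range g)); last first.
  by rewrite /= powR0 ?mulr0// gt_eqF.
set a := sup (range f) in a0; set b := sup (range g) in b0.
pose c := a `^ (1 - t) * b `^ t.
have c0 : 0 < c by rewrite mulr_gt0// powR_gt0.
have mV (v : GR -> R) u : measurable_fun setT v -> measurable_fun setT (fun x => u^-1 * v x).
  by move=> mv; apply: measurable_funM.
have V01 (v : GR -> R) : (forall x, 0 <= v x <= M) -> 0 < sup (range v) ->
   forall x, 0 <= (sup (range v))^-1 * v x <= 1.
  move=> vM s0 x; have [v0 _] := andP (vM x).
  by rewrite mulrC ler_pdivrMr// mul1r sup_ub// andbT divr_ge0// ltW.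
have lev (v : GR -> R) : (forall x, 0 <= v x <= M) -> 0 < sup (range v) ->
   forall s, s < 1 -> exists x, s < (sup (range v))^-1 * v x.
  move=> vM s0 s s1.
  have e0 : 0 < sup (range v) * (1 - s) by rewrite mulr_gt0// subr_gt0.
  have [_ [x _ <-] xs] := sup_adherent e0 (sup_rng _ vM).
  exists x; rewrite mulrC ltr_pdivlMr//; move: xs; lra.
have sV (v : GR -> R) u : 0 < u -> (forall x, 0 < v x -> `|x| <= r) ->
    (forall x, 0 < u^-1 * v x -> `|x| <= r).
  by move=> u0 vr x; rewrite pmulr_rgt0 ?invr_gt0//; exact: vr.
have := @prekopa_leindler_normalized (fun x => a^-1 * f x) (fun x => b^-1 * g x)
  (fun x => c^-1 * h x) t r t01 r0 (mV _ _ mf) (mV _ _ mg) (mV _ _ mh) (V01 _ fM a0)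
  (V01 _ gM b0) _ (sV _ _ a0 fr) (sV _ _ b0 gr) (lev _ fM a0) (lev _ gM b0).
have c0' : 0 <= c^-1 by rewrite invr_ge0 ltW.
move=> /(_ (fun x => mulr_ge0 c0' (h0 x))).
have Hs s x y : 0 <= s -> s < a^-1 * f x -> s < b^-1 * g y ->
    s < c^-1 * h ((1 - t) * x + t * y).
  move=> s0; rewrite ![_^-1 * _]mulrC !ltr_pdivlMr// => sf sg.
  apply: lt_le_trans (H x y).
  have -> : s * c = (s * a) `^ (1 - t) * (s * b) `^ t.
    rewrite !powRM ?(ltW a0) ?(ltW b0)// mulrACA -powRD ?subrK ?oner_eq0//.
    by rewrite powRr1.
  have [s00|s00] := eqVneq s 0.
    by rewrite s00 !mul0r in sf sg *; rewrite powR0 ?gt_eqF// mul0r mulr_gt0// powR_gt0.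
  have s0' : 0 < s by rewrite lt_neqAle eq_sym s00.
  apply: ltr_pM; rewrite ?powR_ge0// gt0_ltr_powR ?nnegrE//.
  - by rewrite mulr_ge0// ltW.
  - by rewrite mulr_ge0// ltW.
move=> /(_ Hs).
have intV (v : GR -> R) u : 0 < u -> measurable_fun setT v -> (forall x, 0 <= v x) ->
    (\int[mu]_x (u^-1 * v x)%:E = (u^-1)%:E * \int[mu]_x (v x)%:E)%E.
  move=> u0 mv v0; under eq_integral do rewrite EFinM.
  rewrite ge0_integralZl ?lee_fin ?invr_ge0 ?ltW//; first exact/measurable_EFinP.
  by move=> x _; rewrite lee_fin.
rewrite !intV//.
have If := bounded_integral_lty mf fM fr; have Ig := bounded_integral_lty mg gM gr.
have If0 : (0 <= \int[mu]_x (f x)%:E)%E by apply: integral_ge0 => x _; rewrite lee_fin.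
have Ig0 : (0 <= \int[mu]_x (g x)%:E)%E by apply: integral_ge0 => x _; rewrite lee_fin.
have Ff : (\int[mu]_x (f x)%:E)%E \is a fin_num by rewrite ge0_fin_numE.
have Fg : (\int[mu]_x (g x)%:E)%E \is a fin_num by rewrite ge0_fin_numE.
rewrite -(fineK Ff) -(fineK Fg) /=.
set If' := fine _; set Ig' := fine _.
have If'0 : 0 <= If' by exact: fine_ge0.
have Ig'0 : 0 <= Ig' by exact: fine_ge0.
rewrite -!EFinM -EFinD => HH.
have : (c%:E * (((1 - t) * (a^-1 * If') + t * (b^-1 * Ig'))%:E) <= \int[mu]_x (h x)%:E)%E.
  have c0e : (0 <= c%:E)%E by rewrite lee_fin ltW.
  have := lee_wpmul2l c0e HH.
  suff -> : (c%:E * ((c^-1)%:E * \int[mu]_x (h x)%:E) = \int[mu]_x (h x)%:E)%E by [].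
  by rewrite muleA -EFinM divff ?gt_eqF// mul1e.
apply: le_trans; rewrite lee_fin.
have -> : If' `^ (1 - t) * Ig' `^ t = c * ((a^-1 * If') `^ (1 - t) * (b^-1 * Ig') `^ t).
  rewrite /c mulrACA -!powRM ?invr_ge0 ?mulr_ge0 ?invr_ge0 ?(ltW a0) ?(ltW b0)//.
  by rewrite !mulVKf ?gt_eqF.
rewrite ler_pM2l//; apply: weighted_am_gm => //; rewrite mulr_ge0// invr_ge0 ltW//.
Qed.
End PrekopaLeindler.

(** * Lebesgue measure on R^n *)

Section Volume.
Context {R : realType}.
Local Notation mu := (@lebesgue_measure R).
Local Notation GR := (measurableTypeR R).

(** Alias carrying the Borel sigma-algebra, while topology and algebra stay on ['rV[R]_n]; hence the
    casts between the two below. *)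
Definition borelV n := g_sigma_algebraType (@open ('rV[R]_n : topologicalType)).

Lemma open_measurableV n (A : set (borelV n)) : @open 'rV[R]_n A -> measurable A.
Proof. by move=> oA; exact: sub_sigma_algebra. Qed.

Lemma closed_measurableV n (A : set (borelV n)) : @closed 'rV[R]_n A -> measurable A.
Proof. by move/closed_openC/open_measurableV/measurableC; rewrite setCK. Qed.

Lemma compact_measurableV n (A : set (borelV n)) : @compact 'rV[R]_n A -> measurable A.
Proof.
by move/compact_closed => /(_ (@norm_hausdorff _ _)); exact: closed_measurableV.
Qed.

Lemma continuous_measurable_funV n (f : borelV n -> GR) :
  continuous (f : 'rV[R]_n -> R) -> measurable_fun setT f.
Proof.
move=> /continuousP cf; apply: (measurability _ (RGenOpens.measurableE R)).
move=> _ [_ [a [b ->] <-]]; rewrite setTI; apply: open_measurableV.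
exact/cf/interval_open.
Qed.

Lemma continuous_measurable_mapV n m (f : borelV n -> borelV m) :
  continuous (f : 'rV[R]_n -> 'rV[R]_m) -> measurable_fun setT f.
Proof.
move=> /continuousP cf; apply: (@measurability _ _ (borelV n) (borelV m) setT f
  (@open 'rV[R]_m) (erefl _)).
by move=> _ [A oA <-]; rewrite setTI; apply: open_measurableV; exact: cf.
Qed.

Definition consv n (p : GR * borelV n) : borelV n.+1 :=
  \row_i oapp (p.2 ord0) p.1 (unlift ord0 i).

Definition tailv n (x : 'rV[R]_n.+1) : borelV n := \row_j x ord0 (lift ord0 j).

Lemma consv0 n (p : GR * borelV n) : consv p ord0 ord0 = p.1.
Proof. by rewrite mxE unlift_none. Qed.

Lemma consvS n (p : GR * borelV n) j : consv p ord0 (lift ord0 j) = p.2 ord0 j.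
Proof. by rewrite mxE liftK. Qed.

Lemma consvK n (x : 'rV[R]_n.+1) : consv (x ord0 ord0, tailv x) = x.
Proof.
apply/rowP => i; case: (unliftP ord0 i) => [j ->|->].
  by rewrite consvS mxE.
by rewrite consv0.
Qed.

Lemma tailvK n (x : GR) (v : borelV n) : tailv (consv (x, v)) = v.
Proof. by apply/rowP => j; rewrite mxE consvS. Qed.

Lemma consvD n x y (v w : 'rV[R]_n) :
  consv (x, v) + consv (y, w) = consv (x + y, v + w).
Proof.
apply/rowP => i; case: (unliftP ord0 i) => [j ->|->]; rewrite mxE.
  by rewrite !consvS mxE.
by rewrite !consv0.
Qed.

Lemma consvZ n a x (v : 'rV[R]_n) : a *: consv (x, v) = consv (a * x, a *: v).
Proof.
apply/rowP => i; case: (unliftP ord0 i) => [j ->|->]; rewrite mxE.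
  by rewrite !consvS mxE.
by rewrite !consv0.
Qed.

Lemma forall_ordS n (P : 'I_n.+1 -> Prop) :
  (forall i, P i) <-> P ord0 /\ forall j, P (lift ord0 j).
Proof.
split=> [H|[H0 HS] i]; first by split.
by case: (unliftP ord0 i) => [j ->|->].
Qed.

Lemma ballVP n (x y : 'rV[R]_n) e :
  0 < e -> ball x e y <-> forall i, `|x ord0 i - y ord0 i| < e.
Proof.
move=> e0; split=> [[_ H] i|H]; first exact: H.
by split=> // i j; rewrite ord1; exact: H.
Qed.

Lemma rational_approx n (x : 'rV[R]_n) (e : R) : 0 < e ->
  exists q : 'rV[rat]_n, forall i, `|ratr (q ord0 i) - x ord0 i| < e.
Proof.
move=> e0.
have H i : {q : rat | `|ratr q - x ord0 i| < e}.
  apply: cid; have : x ord0 i - e < x ord0 i + e by lra.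
  by move=> /rat_in_itvoo[q]; rewrite in_itv/= -ltr_distl; exists q.
by exists (\row_i sval (H i)) => i; rewrite mxE; case: (H i).
Qed.

Definition ballq n (q : 'rV[rat]_n) (m : nat) : set (borelV n) :=
  ball (map_mx ratr q : 'rV[R]_n) m.+1%:R^-1.

(** The source carries the product sigma-algebra, generated by rectangles. Second countability
    bridges the gap: the preimage of an open set is a countable union of products of balls with
    rational centres and radii 1/(m+1). *)
Lemma measurable_consv n : measurable_fun setT (@consv n).
Proof.
apply: (@measurability _ _ _ (borelV n.+1) setT (@consv n)
  (@open 'rV[R]_n.+1) (erefl _)) => _ [A oA <-]; rewrite setTI.
pose I := (rat * 'rV[rat]_n * nat)%type.
pose B (i : I) : set (GR * borelV n) :=
  (ball (ratr i.1.1 : R) i.2.+1%:R^-1) `*` ballq i.1.2 i.2.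
pose B' i := if `[< B i `<=` @consv n @^-1` A >] then B i else set0.
rewrite (_ : _ @^-1` _ = \bigcup_(i in [set: I]) B' i).
  apply: countable_bigcupT_measurable; first exact: countableP.
  move=> i; rewrite /B'; case: ifP => _ //; apply: measurableX.
    exact: measurable_ball.
  by apply: open_measurableV; exact: ball_open.
apply/seteqP; split => [[x v] /= Axv|p [i _]]; last first.
  by rewrite /B'; case: ifPn => // /asboolP; apply.
have : nbhs (consv (x, v) : 'rV[R]_n.+1) A by exact: open_nbhs_nbhs.
move=> /nbhs_ballP[e /= e0 eA].
(* Half of [e], because two points of such a product are compared through its rational centre. *)
have /ltr_add_invr[m] : 0 < e / 2 by rewrite divr_gt0.
rewrite add0r => me.
have m0 : 0 < (m.+1%:R^-1 : R) by rewrite invr_gt0.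
have [w Hw] := rational_approx v m0.
have [q Hq] := rational_approx (\row_(i < 1) x) m0.
exists (q ord0 ord0, w, m) => //; rewrite /B' asboolT.
  split => /=.
    by have := Hq ord0; rewrite mxE.
  by apply/ballVP => // i; rewrite mxE; exact: Hw.
move=> [y u] [/= Hy /ballVP -/(_ m0) Hu]; apply: eA.
apply/ballVP => //; apply/forall_ordS; split=> [|j].
  rewrite !consv0 /=.
  have := Hq ord0; rewrite mxE => Hx.
  apply: (le_lt_trans (ler_distD (ratr (q ord0 ord0)) _ _)).
  have H1 : `|x - ratr (q ord0 ord0)| < m.+1%:R^-1 by rewrite distrC.
  have H2 : `|ratr (q ord0 ord0) - y| < m.+1%:R^-1 by exact: Hy.
  apply: (le_lt_trans (lerD (ltW H1) (ltW H2))).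
  by rewrite (splitr e) ltrD.
rewrite !consvS /=.
apply: (le_lt_trans (ler_distD (ratr (w ord0 j)) _ _)).
have H1 : `|v ord0 j - ratr (w ord0 j)| < m.+1%:R^-1 by rewrite distrC.
have H2 : `|ratr (w ord0 j) - u ord0 j| < m.+1%:R^-1 by have := Hu j; rewrite mxE.
apply: (le_lt_trans (lerD (ltW H1) (ltW H2))).
  by rewrite (splitr e) ltrD.
Qed.

Definition box n (r : R) : set (borelV n) := [set x | forall i, `|x ord0 i| <= r].
Arguments box n r _ : clear implicits.

Lemma box_consv n r : @consv n @^-1` (box n.+1 r) = `[-r, r]%classic `*` box n r.
Proof.
apply/seteqP; split => [[x v] /= /forall_ordS|[x v] /= [xr vr]].
  by rewrite consv0 => -[xr vr]; split => [|j]; rewrite /= ?in_itv -?ler_norml//;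
    have := vr j; rewrite consvS.
apply/forall_ordS; rewrite consv0 /=; split.
  by move: xr; rewrite in_itv/= -ler_norml.
by move=> j; rewrite consvS; exact: vr.
Qed.

Lemma coordV_continuous n (i : 'I_n) : continuous (fun x : 'rV[R]_n => x ord0 i).
Proof. exact: coord_continuous. Qed.

Lemma box_closed n r : @closed 'rV[R]_n (box n r).
Proof.
rewrite (_ : box n r = \bigcap_(i in [set: 'I_n]) ((fun x : 'rV[R]_n => x ord0 i) @^-1` `[-r, r])).
  apply: closed_bigI => i _; apply: closed_comp => [x _|].
    exact: coordV_continuous.
  exact: interval_closed.
apply/seteqP; split=> [x xr i _|x xr i].
  by rewrite /= in_itv/= -ler_norml; exact: xr.
by have := xr i I; rewrite /= in_itv/= -ler_norml.
Qed.

Lemma measurable_box n r : measurable (box n r).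
Proof. by apply: closed_measurableV; exact: box_closed. Qed.

Definition boundedV n (A : set (borelV n)) := exists r, A `<=` box n r.

Lemma compact_boundedV n (A : set 'rV[R]_n) : compact A -> boundedV A.
Proof.
move=> /compact_bounded [M [_ MA]]; exists (M + 1) => x Ax i.
have /MA : M < M + 1 by rewrite ltrDl.
move=> /(_ _ Ax); apply: le_trans.
rewrite [leRHS]/Num.norm /= mx_normrE; apply/bigmax_geP; right => /=.
by exists (ord0, i).
Qed.

Definition volS n (m : {sigma_finite_measure set (borelV n) -> \bar R}) :
  {measure set (borelV n.+1) -> \bar R}.
Proof.
pose m0 : {measure set (borelV n.+1) -> \bar R} := pushforward (mu \x m)%E (@consv n).
exact: (m0 (@measurable_consv n)).
Defined.

Lemma volS_box n (m : {sigma_finite_measure set (borelV n) -> \bar R}) r :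
  volS m (box n.+1 r) = (mu `[(-r)%R, r] * m (box n r))%E.
Proof.
rewrite /= /pushforward box_consv product_measure1E//; exact: measurable_box.
Qed.

(** The invariant of the recursion defining volume: it gives sigma-finiteness, without which the
    next product measure cannot be formed. *)
Definition finite_on_boxes n (m : set (borelV n) -> \bar R) :=
  forall N : nat, (m (box n N%:R) < +oo)%E.

Lemma volS_finite_on_boxes n (m : {sigma_finite_measure set (borelV n) -> \bar R}) :
  finite_on_boxes m -> finite_on_boxes (volS m).
Proof.
move=> mN N; rewrite volS_box lte_mul_pinfty//.
suff : mu (`[- N%:R, N%:R]%classic : set R) \is a fin_num by [].
by rewrite lebesgue_measure_itv; case: ifP.
Qed.

Lemma finite_on_boxes_sigma_finite n (m : {measure set (borelV n) -> \bar R}) :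
  finite_on_boxes m -> sigma_finite setT m.
Proof.
move=> mN; exists (fun N => box n N%:R).
  apply/esym/seteqP; split => // x _.
  have [r xr] := @compact_boundedV n [set x] (@compact_set1 _ _).
  exists (Num.truncn r).+1 => // i; rewrite (le_trans (xr x (erefl _) i))//.
  by rewrite ltW// truncnS_gt.
by move=> N; split; [exact: measurable_box|exact: mN].
Qed.

Section volS_sigma_finite.
Context n (m : {sigma_finite_measure set (borelV n) -> \bar R})
  (mfin : finite_on_boxes m).

(** The proof argument gives the sigma-finite structure a term to be attached to. *)
Definition volS_of (_ : finite_on_boxes m) : set (borelV n.+1) -> \bar R := volS m.

HB.instance Definition _ := Measure.copy (volS_of mfin) (volS m).

HB.instance Definition _ := Measure_isSigmaFinite.Build _ _ _ (volS_of mfin)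
  (finite_on_boxes_sigma_finite (volS_finite_on_boxes mfin)).
End volS_sigma_finite.

(** Measure and invariant are built together; dimension 0 is the unit mass at the only point. The
    transparent ending lets [vol] compute by recursion. *)
Definition vol_sig n : {m : {sigma_finite_measure set (borelV n) -> \bar R} | finite_on_boxes m}.
Proof.
elim: n => [|n [m mfin]].
  by exists (dirac (0 : borelV 0)) => N; rewrite /= /dirac /= indicE ltry.
exists (volS_of mfin); exact: volS_finite_on_boxes.
Defined.

Definition vol n : {sigma_finite_measure set (borelV n) -> \bar R} := sval (vol_sig n).

Lemma vol0 : vol 0 [set: borelV 0] = 1%E.
Proof. by rewrite /vol /= /dirac indicT. Qed.

Lemma volE n (A : set (borelV n.+1)) :
  vol n.+1 A = (\int[mu]_x vol n [set v | A (consv (x, v))])%E.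
Proof.
have -> : vol n.+1 A = (mu \x vol n)%E (@consv n @^-1` A).
  by rewrite /vol /=; case: (vol_sig n).
apply: eq_integral => x _ /=; congr (vol n _).
by apply/seteqP; split => v; rewrite /xsection/= inE.
Qed.
End Volume.
Arguments box {R} n r _.
Arguments consv {R n} p.

(** * The Brunn-Minkowski inequality *)

Section VolumeTheory.
Context {R : realType}.
Local Notation mu := (@lebesgue_measure R).
Local Notation GR := (measurableTypeR R).
Local Notation borelV := (@borelV R).

Definition slice n (A : set (borelV n.+1)) (x : GR) : set (borelV n) :=
  [set v | A (consv (x, v))].

Lemma vol_slice n (A : set (borelV n.+1)) :
  vol n.+1 A = (\int[mu]_x vol n (slice A x))%E.
Proof. exact: volE. Qed.

Lemma slice_xsection n (A : set (borelV n.+1)) x :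
  slice A x = xsection (@consv R n @^-1` A) x.
Proof. by apply/seteqP; split => v; rewrite /xsection/= inE. Qed.

Lemma measurable_consv_preimage n (A : set (borelV n.+1)) :
  measurable A -> measurable (@consv R n @^-1` A).
Proof. by move=> mA; rewrite -[X in measurable X]setTI; exact: measurable_consv. Qed.

Lemma measurable_slice n (A : set (borelV n.+1)) x :
  measurable A -> measurable (slice A x).
Proof.
move=> mA; rewrite slice_xsection.
by apply: measurable_xsection; exact: measurable_consv_preimage.
Qed.

Lemma measurable_fun_slice n (A : set (borelV n.+1)) : measurable A ->
  measurable_fun [set: GR] (fun x => vol n (slice A x)).
Proof.
move=> mA; rewrite (_ : (fun _ => _) = vol n \o xsection (@consv R n @^-1` A)).
  by apply: measurable_fun_xsection; exact: measurable_consv_preimage.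
by apply/funext => x /=; rewrite slice_xsection.
Qed.

Lemma subset_box n (r s : R) : r <= s -> (box n r : set (borelV n)) `<=` box n s.
Proof. by move=> rs x xr i; exact: le_trans (xr i) rs. Qed.

Lemma vol_box_lty n (r : R) : (vol n (box n r) < +oo)%E.
Proof.
apply: (@le_lt_trans _ _ (vol n (box n (Num.truncn r).+1%:R))).
  apply: le_measure; rewrite ?inE; [exact: measurable_box..|].
  by apply: subset_box; rewrite ltW// truncnS_gt.
exact: (svalP (vol_sig n)).
Qed.

Lemma vol_lty n (A : set (borelV n)) (r : R) : measurable A -> A `<=` box n r ->
  (vol n A < +oo)%E.
Proof.
move=> mA Ar; apply: le_lt_trans (vol_box_lty n r).
by apply: le_measure; rewrite ?inE//; exact: measurable_box.
Qed.

Lemma vol_fin n (A : set (borelV n)) (r : R) : measurable A -> A `<=` box n r ->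
  vol n A \is a fin_num.
Proof. by move=> mA Ar; rewrite ge0_fin_numE//; exact: vol_lty Ar. Qed.

Lemma slice_box n (A : set (borelV n.+1)) (r : R) (x : GR) : A `<=` box n.+1 r ->
  slice A x `<=` box n r.
Proof. by move=> Ar v /Ar /forall_ordS[_] H i; have := H i; rewrite consvS. Qed.

Lemma slice_box0 n (A : set (borelV n.+1)) (r : R) (x : GR) : A `<=` box n.+1 r ->
  r < `|x| -> slice A x = set0.
Proof.
move=> Ar rx; apply/seteqP; split => // v /Ar /forall_ordS[+ _].
by rewrite consv0 /= leNgt rx.
Qed.

Lemma borelV0_eq (x y : borelV 0) : x = y.
Proof. by apply/rowP => -[]. Qed.

Lemma borelV0_set (A : set (borelV 0)) : A = set0 \/ A = setT.
Proof.
have [->|/set0P[x Ax]] := eqVneq A set0; [by left|right].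
by apply/seteqP; split => // y _; rewrite (borelV0_eq y x).
Qed.

(** Induction on the dimension: the slice at [x] of the preimage is the preimage, under the map with
    translation [tailv b], of the slice of [A] at [a * x + b ord0 ord0]. *)
Lemma vol_affine n (a : R) (b : 'rV[R]_n) (A : set (borelV n)) :
  0 < a -> measurable A ->
  vol n ((fun x : 'rV[R]_n => a *: x + b) @^-1` A) = ((a^-1 ^+ n)%:E * vol n A)%E.
Proof.
move=> a0; elim: n b A => [|n IH] b A mA.
  rewrite expr0 mul1e; congr (vol 0 _); apply/seteqP.
  by split => x /=; rewrite (borelV0_eq (a *: x + b) x).
rewrite !vol_slice.
transitivity (\int[mu]_x ((a^-1 ^+ n)%:E * vol n (slice A (a * x + b ord0 ord0)%R)))%E.
  apply: eq_integral => x _; rewrite -(IH (tailv b)); last exact: measurable_slice.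
  congr (vol n _); apply/funext => v; rewrite /slice /=.
  by rewrite -consvD -consvZ consvK.
have mS := measurable_fun_slice mA.
rewrite ge0_integralZl//; first last.
- by rewrite lee_fin exprn_ge0// invr_ge0 ltW.
- exact: (measurableT_comp mS (measurable_affine a (b ord0 ord0))).
rewrite (ge0_integral_affine _ a0 mS)// muleA -EFinM.
by rewrite exprSr.
Qed.

Lemma affine_continuous (V : normedModType R) (a : R) (b : V) :
  continuous (fun x : V => a *: x + b).
Proof.
move=> x; apply: cvgD; last exact: cvg_cst.
by apply: cvgZl_tmp; exact: cvg_id.
Qed.

Lemma measurable_affineV n (a : R) (b : 'rV[R]_n) (A : set (borelV n)) :
  measurable A -> measurable ((fun x : 'rV[R]_n => a *: x + b) @^-1` A : set (borelV n)).
Proof.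
move=> mA; rewrite -[X in measurable X]setTI.
apply: (@continuous_measurable_mapV R n n (fun x => a *: x + b)) => //.
exact: (@affine_continuous ('rV[R]_n : normedModType R) a b).
Qed.

Lemma measurable_rect n (A : 'I_n -> set GR) : (forall i, measurable (A i)) ->
  measurable ([set v | forall i, A i (v ord0 i)] : set (borelV n)).
Proof.
move=> mA.
rewrite [X in measurable X](_ : _ = \bigcap_(i in [set: 'I_n])
  ((fun v : borelV n => v ord0 i : GR) @^-1` A i)).
  apply: fin_bigcap_measurable => // i _; rewrite -[X in measurable X]setTI.
  apply: (@continuous_measurable_funV R n) => //; exact: coordV_continuous.
by apply/seteqP; split => [v H i _|v H i]; exact: H.
Qed.

Lemma vol_rect n (A : 'I_n -> set GR) (s : R) : (forall i, measurable (A i)) ->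
  (forall i, mu (A i) = s%:E) ->
  vol n [set v | forall i, A i (v ord0 i)] = (s ^+ n)%:E.
Proof.
move=> + As; elim: n A As => [|n IH] A As mA.
  rewrite expr0 -(@vol0 R); congr (vol 0 _); apply/seteqP.
  by split => // x _ [].
rewrite vol_slice.
transitivity (\int[mu]_x ((s ^+ n)%:E * (\1_(A ord0) x)%:E))%E.
  apply: eq_integral => x _; rewrite indicE.
  have [/set_mem xA|/negP xA] := boolP (x \in A ord0).
    rewrite mule1 -(IH (fun i => A (lift ord0 i))) => [|i|i]; [|exact: As|exact: mA].
    congr (vol n _); apply/seteqP; split => [v /forall_ordS[_] H i|v H].
      by have := H i; rewrite consvS.
    by apply/forall_ordS; split => [|i]; rewrite ?consv0// consvS; exact: H.
  rewrite mule0 (_ : slice _ _ = set0) ?measure0//.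
  apply/seteqP; split => // v /forall_ordS[]; rewrite consv0 /= => xA' _.
  by apply: xA; rewrite inE.
have s0 : (0 <= s%:E)%E by rewrite -(As ord0).
rewrite ge0_integralZl//; first last.
- by rewrite lee_fin exprn_ge0.
- by apply/measurable_EFinP; exact: measurable_indic.
transitivity ((s ^+ n)%:E * mu (A ord0))%E; last by rewrite As -EFinM exprSr.
by rewrite integral_indic// setIT.
Qed.

(** Prekopa-Leindler for the slice volumes, whose hypothesis is the induction hypothesis. Letting
    [C] be any measurable set that contains the combinations avoids the question whether the
    Minkowski sum is measurable. *)
Theorem brunn_minkowski n (t r : R) (A B C : set (borelV n)) :
  0 < t < 1 -> 0 <= r -> measurable A -> measurable B -> measurable C ->
  A `<=` box n r -> B `<=` box n r -> C `<=` box n r ->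
  (forall x y : 'rV[R]_n, A x -> B y -> C ((1 - t) *: x + t *: y)) ->
  fine (vol n A) `^ (1 - t) * fine (vol n B) `^ t <= fine (vol n C).
Proof.
move=> t01 r0; have /andP[t0 t1] := t01.
have t1' : 1 - t != 0 by rewrite gt_eqF// subr_gt0.
elim: n A B C => [|n IH] A B C mA mB mC Ar Br Cr H.
  have C0 : 0 <= fine (vol 0 C) by exact: fine_ge0.
  have [->|EA] := borelV0_set A; first by rewrite measure0 /= powR0// mul0r.
  have [->|EB] := borelV0_set B; first by rewrite measure0 /= powR0 ?gt_eqF// mulr0.
  have [EC|->] := borelV0_set C; last by rewrite EA EB vol0 /= !powR1 mulr1.
  have : C ((1 - t) *: 0 + t *: 0) by apply: H; rewrite ?EA ?EB.
  by rewrite EC.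
have fE (X : set (borelV n.+1)) x : measurable X -> X `<=` box n.+1 r ->
    (fine (vol n (slice X x)))%:E = vol n (slice X x).
  move=> mX Xr; rewrite fineK//; apply: (@vol_fin _ _ r); first exact: measurable_slice.
  exact: slice_box.
have volE' (X : set (borelV n.+1)) : measurable X -> X `<=` box n.+1 r ->
    vol n.+1 X = (\int[mu]_x (fine (vol n (slice X x)))%:E)%E.
  by move=> mX Xr; rewrite vol_slice; apply: eq_integral => x _; rewrite fE.
have mf (X : set (borelV n.+1)) : measurable X -> X `<=` box n.+1 r ->
    measurable_fun [set: GR] (fun x => fine (vol n (slice X x))).
  move=> mX Xr; apply/measurable_EFinP.
  rewrite (_ : _ \o _ = fun x => vol n (slice X x)); first exact: measurable_fun_slice.
  by apply/funext => x /=; rewrite fE.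
have fM (X : set (borelV n.+1)) : measurable X -> X `<=` box n.+1 r ->
    forall x, 0 <= fine (vol n (slice X x)) <= fine (vol n (box n r)).
  move=> mX Xr x; rewrite fine_ge0//= fine_le//.
  - apply: (@vol_fin _ _ r); [exact: measurable_slice|exact: slice_box].
  - by apply: (@vol_fin _ _ r) => //; exact: measurable_box.
  - apply: le_measure; rewrite ?inE; [exact: measurable_slice|exact: measurable_box|].
    exact: slice_box.
have fr (X : set (borelV n.+1)) : X `<=` box n.+1 r ->
    forall x : GR, 0 < fine (vol n (slice X x)) -> `|x| <= r.
  move=> Xr x; rewrite leNgt; apply: contraTN => /(slice_box0 Xr) ->.
  by rewrite measure0 ltxx.
have H0 x : 0 <= fine (vol n (slice C x)) by rewrite fine_ge0.
have HS (x y : GR) : fine (vol n (slice A x)) `^ (1 - t) * fine (vol n (slice B y)) `^ t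
    <= fine (vol n (slice C ((1 - t) * x + t * y))).
  apply: IH; [exact: measurable_slice|exact: measurable_slice|exact: measurable_slice| | | |].
  - exact: slice_box.
  - exact: slice_box.
  - exact: slice_box.
  - by move=> v w Av Bw; rewrite /slice /= -consvD -!consvZ; exact: H.
have := @prekopa_leindler R _ _ _ t r (fine (vol n (box n r))) t01 r0
  (mf _ mA Ar) (mf _ mB Br) (mf _ mC Cr) (fM _ mA Ar) (fM _ mB Br) H0
  (fr _ Ar) (fr _ Br) HS.
rewrite -!volE'// -[X in (_ <= X)%E -> _]fineK ?lee_fin//; exact: vol_fin Cr.
Qed.
End VolumeTheory.

(** * Gruenbaum's inequality *)

Section LogConcaveTail.
Context {R : realType}.
Local Notation mu := (@lebesgue_measure R).
Local Notation GR := (measurableTypeR R).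

(** The integrand is the comparison function of the tail estimate: [V] up to [s], then V
    exp(-a(x-s)), the latter being V/a times a shifted exponential density. *)
Lemma integral_step_exp (V a s : R) : 0 <= V -> 0 < a -> 0 <= s ->
  (\int[mu]_x (V * \1_(`[0, s]%classic : set R) x + (V / a) * exponential_pdf a (1 * x + (- s)))%:E
   = (V * s + V / a)%:E)%E.
Proof.
move=> V0 a0 s0.
have m1 : measurable_fun [set: GR] (fun x : GR => (\1_(`[0, s]%classic : set R) x : R)%:E).
  by apply/measurable_EFinP; exact: measurable_indic.
have m2 : measurable_fun [set: GR] (fun x : GR => (exponential_pdf a (1 * x + (- s)))%:E).
  apply/measurable_EFinP; apply: (measurableT_comp (measurable_exponential_pdf a)).
  exact: measurable_affine.
have Va : 0 <= V / a by rewrite divr_ge0// ltW.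
under eq_integral do rewrite EFinD !EFinM.
rewrite ge0_integralD//; first last.
- exact: emeasurable_funM.
- by move=> x _; rewrite -EFinM lee_fin mulr_ge0// exponential_pdf_ge0// ltW.
- exact: emeasurable_funM.
- by move=> x _; rewrite -EFinM lee_fin mulr_ge0.
rewrite !ge0_integralZl//; first last.
- by move=> x _; rewrite lee_fin exponential_pdf_ge0// ltW.
rewrite (@ge0_integral_affine R 1 (- s) (fun x => (exponential_pdf a x)%:E))//; last 2 first.
- by apply/measurable_EFinP; exact: measurable_exponential_pdf.
- by move=> x; rewrite lee_fin exponential_pdf_ge0// ltW.
rewrite integral_exponential_pdf// invr1 !mule1 EFinD EFinM; congr (V%:E * _ + _)%E.
rewrite integral_indic// setIT -[LHS]/(mu (`[0, s]%classic : set R)) lebesgue_measure_itv/= lte_fin.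
case: ltP => [_|]; first by rewrite sube0.
by move=> s0'; congr EFin; apply/eqP; rewrite eq_le s0.
Qed.

(** Intended reading: [G s] is the volume of the part of a body of volume [V] where a nonnegative
    affine function exceeds [s], and [w] is the mean of that function; [Gint] is then the layer-cake
    formula. *)
Variables (G : R -> R) (V w : R).
Hypotheses (V0 : 0 < V) (G0 : forall s, 0 <= G s <= V)
  (Gneg : forall s : R, s < 0 -> G s = V)
  (Gdec : forall s s' : R, s <= s' -> G s' <= G s)
  (Glc : forall t s s' : R, 0 < t < 1 ->
    G s `^ (1 - t) * G s' `^ t <= G ((1 - t) * s + t * s'))
  (Gint : (\int[mu]_(s in `[0%R, +oo[) (G s)%:E = (w * V)%:E)%E).

Let mG : measurable_fun [set: GR] (G : GR -> R).
Proof. by apply: nonincreasing_measurable => // s s' ss'; exact: Gdec. Qed.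

Let G_ge0 s : 0 <= G s. Proof. by case/andP: (G0 s). Qed.
Let G_leV s : G s <= V. Proof. by case/andP: (G0 s). Qed.

(** If [G] vanished from [s] on, its integral would be at most [V * s], which is less than
    [w * V]. *)
Let G_pos s : s < w -> 0 < G s.
Proof.
move=> sw; rewrite lt_neqAle eq_sym G_ge0 andbT; apply/eqP => Gs0.
have s0 : 0 <= s.
  by rewrite leNgt; apply/negP => /Gneg GV; move: V0; rewrite -GV Gs0 ltxx.
suff : ((w * V)%:E <= (V * s)%:E)%E.
  by rewrite lee_fin mulrC ler_pM2l// leNgt sw.
rewrite -Gint.
have -> : ((V * s)%:E = \int[mu]_x (V%:E * (\1_(`[0, s]%classic : set R) x)%:E))%E.
  rewrite ge0_integralZl ?lee_fin ?ltW//; last first.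
    by apply/measurable_EFinP; exact: measurable_indic.
  rewrite integral_indic// setIT EFinM; congr (_ * _)%E.
  rewrite -[RHS]/(mu (`[0, s]%classic : set R)) lebesgue_measure_itv/= lte_fin.
  case: ltP => [_|]; first by rewrite sube0.
  by move=> s0'; congr EFin; apply/eqP; rewrite eq_le s0 s0'.
rewrite integral_mkcond; apply: ge0_le_integral => //.
- by move=> x _; rewrite patchE; case: ifP => //; rewrite lee_fin G_ge0.
- by apply/(measurable_restrictT _ _).1 => //; apply: measurable_funTS; exact/measurable_EFinP.
- by apply: emeasurable_funM => //; apply/measurable_EFinP; exact: measurable_indic.
move=> x _; rewrite patchE -EFinM; case: ifPn => [|_]; last by rewrite lee_fin mulr_ge0// ltW.
rewrite inE/= in_itv/= andbT lee_fin => x0.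
have [xs|sx] := leP x s.
  by rewrite indicE mem_set ?mulr1 ?G_leV//= in_itv/= x0.
by rewrite (le_trans (Gdec (ltW sx)))// Gs0 mulr_ge0// ltW.
Qed.

(** Decreasing slopes of the concave function ln G, with the denominators cleared. *)
Let ln_concave s s0 s' : s < s0 -> s0 < s' -> 0 < G s -> 0 < G s' ->
  (s' - s0) * (ln (G s) - ln (G s0)) <= (s0 - s) * (ln (G s0) - ln (G s')).
Proof.
move=> ss0 s0s' Gs Gs'.
have d0 : 0 < s' - s by lra.
pose t := (s0 - s) / (s' - s).
have t01 : 0 < t < 1.
  apply/andP; split; rewrite /t; first by rewrite divr_gt0//; lra.
  by rewrite ltr_pdivrMr// mul1r; lra.
have E : (1 - t) * s + t * s' = s0 by rewrite /t; field; lra.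
have := Glc s s' t01; rewrite E => H.
have Gs0 : 0 < G s0 by apply: lt_le_trans H; rewrite mulr_gt0// powR_gt0.
have := H; rewrite -ler_ln ?posrE ?mulr_gt0 ?powR_gt0//.
rewrite lnM ?posrE ?powR_gt0// !ln_powR => HL.
have : (s' - s) * ((1 - t) * ln (G s) + t * ln (G s')) <= (s' - s) * ln (G s0).
  by rewrite ler_pM2l.
have -> : (s' - s) * ((1 - t) * ln (G s) + t * ln (G s')) =
  (s' - s0) * ln (G s) + (s0 - s) * ln (G s') by rewrite /t; field; lra.
lra.
Qed.

(** A supporting line of ln G at [s0], of slope -a, bounds [G] by an exponential that takes the
    value [V] at some point [ss]. Comparing areas gives w <= ss + 1/a, while ln (G s0 / V) = a (ss -
    s0); together ln (G s0 / V) >= a (w - s0) - 1 > -1. *)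
Lemma logconcave_tail s0 : s0 < w -> V * expR (- 1) <= G s0.
Proof.
move=> s0w.
have [s00|s00] := ltP s0 0.
  by rewrite Gneg// ler_piMr ?ltW// -[leRHS]expR0 ltr_expR; lra.
have Gs0 := G_pos s0w.
have Ldec (s s' : R) : s <= s' -> 0 < G s' -> ln (G s') <= ln (G s).
  by move=> ss' Gs'; rewrite ler_ln ?posrE ?Gdec//; exact: lt_le_trans (Gdec ss').
pose sl s := (ln (G s) - ln (G s0)) / (s0 - s).
pose S := [set sl s | s in [set s | s < s0]].
pose s1 := (s0 + w) / 2.
have s01 : s0 < s1 by rewrite /s1; lra.
have Gs1 : 0 < G s1 by apply: G_pos; rewrite /s1; lra.
have slP s s' : s < s0 -> s0 < s' -> 0 < G s' ->
    sl s <= (ln (G s0) - ln (G s')) / (s' - s0).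
  move=> ss0 s0s' Gs'; rewrite /sl ler_pdivrMr ?subr_gt0// mulrAC ler_pdivlMr ?subr_gt0//.
  rewrite mulrC [leRHS]mulrC; apply: ln_concave => //.
  by apply: lt_le_trans (Gdec (ltW ss0)).
have supS : has_sup S.
  split; first by exists (sl (s0 - 1)), (s0 - 1) => //=; lra.
  by exists ((ln (G s0) - ln (G s1)) / (s1 - s0)) => _ [s ss0 <-]; exact: slP.
(* Minus the left derivative of ln G at [s0]: by concavity the quotients [sl s] increase as [s]
   approaches [s0], and they stay below every quotient taken on the right. *)
set a := sup S.
have a0 : 0 <= a.
  apply: le_trans (ub_le_sup supS.2 (_ : S (sl (s0 - 1)))); last by exists (s0 - 1) => //=; lra.
  rewrite /sl divr_ge0//; last by lra.
  by rewrite subr_ge0 Ldec//; lra.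
have Gle s : G s <= G s0 * expR (- a * (s - s0)).
  have [->|Gs] := eqVneq (G s) 0; first by rewrite mulr_ge0// expR_ge0.
  have {}Gs : 0 < G s by rewrite lt_neqAle eq_sym Gs G_ge0.
  rewrite -ler_ln ?posrE ?mulr_gt0 ?expR_gt0// lnM ?posrE ?expR_gt0// expRK.
  have [ss0|s0s|<-] := ltgtP s s0; last by rewrite subrr mulr0 addr0.
    have : sl s <= a by apply: ub_le_sup supS.2 _ _; exists s.
    rewrite /sl ler_pdivrMr ?subr_gt0//; lra.
  have : a <= (ln (G s0) - ln (G s)) / (s - s0).
    by apply: ge_sup; [exact: supS.1|move=> _ [x xs <-]; exact: slP].
  rewrite ler_pdivlMr ?subr_gt0//; lra.
(* A horizontal supporting line means that [G] is maximal at [s0], hence equal to [V] there. *)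
have [az|az] := eqVneq a 0.
  have := Gle (- 1); rewrite Gneg ?ltrN10// az oppr0 mul0r expR0 mulr1.
  apply: le_trans; rewrite ler_piMr ?ltW// -[leRHS]expR0 ltr_expR; lra.
have {}az : 0 < a by rewrite lt_neqAle eq_sym az a0.
pose ss := s0 + (ln (G s0) - ln V) / a.
have Gle' s : G s <= V * expR (- a * (s - ss)).
  apply: le_trans (Gle s) _; rewrite le_eqVlt; apply/orP; left; apply/eqP.
  transitivity (expR (ln (G s0) + - a * (s - s0))); first by rewrite expRD lnK.
  transitivity (expR (ln V + - a * (s - ss))); last by rewrite expRD lnK.
  by congr expR; rewrite /ss; field; lra.
(* Otherwise the dominating exponential would already be below [V] at the negative point [ss / 2],
   where [G] equals [V]. *)
have ss0 : 0 <= ss.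
  rewrite leNgt; apply/negP => ssn.
  have : V <= V * expR (- a * (ss / 2 - ss)) by rewrite -[leLHS](Gneg (_ : ss / 2 < 0))//; lra.
  rewrite ler_pMr// -[leLHS]expR0 ler_expR => H.
  have : 0 < a * (- ss / 2) by rewrite mulr_gt0//; lra.
  lra.
have : ((w * V)%:E <= (V * ss + V / a)%:E)%E.
  rewrite -Gint -integral_step_exp//; last exact: ltW.
  rewrite integral_mkcond.
  apply: ge0_le_integral => //.
  - by move=> x _; rewrite patchE; case: ifP => //; rewrite lee_fin G_ge0.
  - by apply/(measurable_restrictT _ _).1 => //; apply: measurable_funTS; exact/measurable_EFinP.
  - apply/measurable_EFinP; apply: measurable_funD; apply: measurable_funM => //.
    apply: (measurableT_comp (measurable_exponential_pdf a)); exact: measurable_affine.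
  move=> x _; rewrite patchE; case: ifPn => [|_]; last first.
    by rewrite lee_fin addr_ge0 ?mulr_ge0 ?exponential_pdf_ge0 ?invr_ge0 ?(ltW V0)//.
  rewrite inE/= in_itv/= andbT lee_fin => x0.
  have [xs|sx] := leP x ss.
    rewrite indicE mem_set/= ?in_itv/= ?x0// mulr1.
    by rewrite (le_trans (G_leV x))// lerDl ?mulr_ge0 ?exponential_pdf_ge0 ?invr_ge0 ?(ltW V0).
  rewrite (le_trans (Gle' x))// exponential_pdfE; last by lra.
  rewrite mul1r mulrA divfK ?gt_eqF// lerDr.
  by rewrite mulr_ge0// ltW.
rewrite lee_fin mulrC -mulrDr ler_pM2l// => H.
have H2 : a * w <= a * s0 + (ln (G s0) - ln V) + 1.
  have : a * w <= a * (ss + a^-1) by rewrite ler_pM2l.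
  have -> // : a * (ss + a^-1) = a * s0 + (ln (G s0) - ln V) + 1.
  by rewrite /ss; field; lra.
have H3 : 0 < a * (w - s0) by rewrite mulr_gt0// subr_gt0.
rewrite -ler_ln ?posrE ?mulr_gt0 ?expR_gt0// lnM ?posrE ?expR_gt0// expRK; lra.
Qed.
End LogConcaveTail.

(** * Scalar products and separation of a point from a compact convex set *)

Section LinearForms.
Context {R : realType}.
Implicit Types (n : nat).

Lemma dotpE n (u v : 'rV[R]_n) : dotp u v = \sum_i u ord0 i * v ord0 i.
Proof. by rewrite /dotp mxE; apply: eq_bigr => i _; rewrite mxE. Qed.

Lemma dotpDr n (u v w : 'rV[R]_n) : dotp u (v + w) = dotp u v + dotp u w.
Proof. by rewrite /dotp linearD mulmxDr mxE. Qed.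

Lemma dotpZr n (u v : 'rV[R]_n) a : dotp u (a *: v) = a * dotp u v.
Proof. by rewrite /dotp linearZ -scalemxAr mxE. Qed.

Lemma dotpBr n (u v w : 'rV[R]_n) : dotp u (v - w) = dotp u v - dotp u w.
Proof. by rewrite -scaleN1r dotpDr dotpZr mulN1r. Qed.

Lemma dotpC n (u v : 'rV[R]_n) : dotp u v = dotp v u.
Proof. by rewrite !dotpE; apply: eq_bigr => i _; rewrite mulrC. Qed.

Lemma dotpDl n (u v w : 'rV[R]_n) : dotp (u + v) w = dotp u w + dotp v w.
Proof. by rewrite !(dotpC _ w) dotpDr. Qed.

Lemma dotpZl n (u v : 'rV[R]_n) a : dotp (a *: u) v = a * dotp u v.
Proof. by rewrite !(dotpC _ v) dotpZr. Qed.

Lemma dotp_sqrDZ n (u v : 'rV[R]_n) t :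
  dotp (u + t *: v) (u + t *: v) = dotp u u + t * (2 * dotp u v + t * dotp v v).
Proof. by rewrite !(dotpDl, dotpDr, dotpZl, dotpZr) (dotpC v u); ring. Qed.

Lemma dotp_ge0 n (u : 'rV[R]_n) : 0 <= dotp u u.
Proof. by rewrite dotpE sumr_ge0// => i _; rewrite -expr2 sqr_ge0. Qed.

Lemma dotp_eq0 n (u : 'rV[R]_n) : (dotp u u == 0) = (u == 0).
Proof.
apply/eqP/eqP => [|->]; last by rewrite dotpE big1// => i _; rewrite mxE mul0r.
rewrite dotpE => /eqP; rewrite psumr_eq0 => [/allP H|i _]; last by rewrite -expr2 sqr_ge0.
apply/rowP => i; have := H i (mem_index_enum _).
by rewrite -expr2 sqrf_eq0 mxE => /eqP.
Qed.

Lemma continuous_sumr (T : topologicalType) (I : Type) (s : seq I) (f : I -> T -> R) :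
  (forall i, continuous (f i)) -> continuous (fun x => \sum_(i <- s) f i x).
Proof.
move=> cf; elim: s => [|i s IH] x.
  by under eq_fun do rewrite big_nil; exact: cvg_cst.
by under eq_fun do rewrite big_cons; apply: cvgD; [exact: cf|exact: IH].
Qed.

Lemma continuous_addr (T : topologicalType) (f g : T -> R) :
  continuous f -> continuous g -> continuous (fun x => f x + g x).
Proof. by move=> cf cg x; apply: continuousD; [exact: cf|exact: cg]. Qed.

Lemma continuous_mulr (T : topologicalType) (f g : T -> R) :
  continuous f -> continuous g -> continuous (fun x => f x * g x).
Proof. by move=> cf cg x; apply: continuousM; [exact: cf|exact: cg]. Qed.

Lemma dotp_continuous n (u : 'rV[R]_n) (c : R) :
  continuous (fun x : 'rV[R]_n => dotp u x + c).
Proof.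
apply: continuous_addr; last exact: cst_continuous.
rewrite (_ : dotp u = fun x : 'rV[R]_n => \sum_i u ord0 i * x ord0 i).
  apply: continuous_sumr => i; apply: continuous_mulr; first exact: cst_continuous.
  exact: coordV_continuous.
by apply/funext => x; rewrite dotpE.
Qed.

Lemma sqdist_continuous n (p : 'rV[R]_n) :
  continuous (fun x : 'rV[R]_n => dotp (x - p) (x - p)).
Proof.
rewrite (_ : (fun x => _) = fun x : 'rV[R]_n =>
    \sum_i (x ord0 i + - p ord0 i) * (x ord0 i + - p ord0 i)).
  have cx i : continuous (fun x : 'rV[R]_n => x ord0 i + - p ord0 i).
    by apply: continuous_addr; [exact: coordV_continuous|exact: cst_continuous].
  by apply: continuous_sumr => i; apply: continuous_mulr.
by apply/funext => x; rewrite dotpE; apply: eq_bigr => i _; rewrite !mxE.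
Qed.

Definition convexV n (A : set 'rV[R]_n) := forall t x y,
  0 < t < 1 -> A x -> A y -> A ((1 - t) *: x + t *: y).

(* The nearest point c of C to p gives the normal u = c - p. *)
Lemma separation n (C : set 'rV[R]_n) (p : 'rV[R]_n) :
  compact C -> convexV C -> C !=set0 -> ~ C p ->
  exists u d, 0 < d /\ forall x, C x -> dotp u p + d <= dotp u x.
Proof.
move=> cC vC C0 Cp.
have cf : {within C, continuous (fun x => dotp (x - p) (x - p))}.
  by apply: continuous_subspaceT; exact: sqdist_continuous.
have [c] := EVT_min_rV C0 cC cf.
rewrite inE => Cc cmin.
exists (c - p), (dotp (c - p) (c - p)); split.
  rewrite lt_neqAle eq_sym dotp_ge0 andbT dotp_eq0 subr_eq0.
  by apply/eqP => cp; apply: Cp; rewrite -cp.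
move=> x Cx; rewrite -dotpDr [p + _]addrC subrK -subr_ge0 -dotpBr.
set u := c - p; set v := x - c.
(* First variation of the squared distance to [p] on the segment from [c] to [x], divided by [t]. *)
have H t : 0 < t < 1 -> 0 <= 2 * dotp u v + t * dotp v v.
  move=> t01; have /andP[t0 _] := t01.
  have := cmin ((1 - t) *: c + t *: x); rewrite inE => /(_ (vC _ _ _ t01 Cc Cx)).
  have -> : (1 - t) *: c + t *: x - p = u + t *: v.
    by rewrite /u /v scalerBl scale1r scalerBr addrAC -!addrA; congr (_ + _);
      rewrite addrC -addrA; congr (_ + _); rewrite addrC.
  rewrite -/u dotp_sqrDZ => H.
  have : 0 <= t * (2 * dotp u v + t * dotp v v) by move: H; lra.
  by rewrite pmulr_rge0.
rewrite leNgt; apply/negP => uv0.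
have vv0 := dotp_ge0 v.
(* So small that the quadratic term is at most -u.v and cannot compensate 2 u.v < 0; the [+ 1] keeps
   the denominator positive. *)
pose t := Num.min (1 / 2) (- dotp u v / (dotp v v + 1)).
have t01 : 0 < t < 1.
  rewrite /t lt_min gt_min; apply/andP; split; last by apply/orP; left; lra.
  by apply/andP; split; [lra|rewrite divr_gt0 ?oppr_gt0// ltr_wpDl].
have := H t t01.
have : t * dotp v v <= - dotp u v / (dotp v v + 1) * dotp v v.
  by rewrite ler_wpM2r// /t ge_min lexx orbT.
have : - dotp u v / (dotp v v + 1) * dotp v v <= - dotp u v.
  rewrite -mulrA; apply: ler_piMr; first by rewrite oppr_ge0 ltW.
  by rewrite mulrC ler_pdivrMr ?ltr_wpDl// mul1r lerDl.
lra.
Qed.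
End LinearForms.

(** * The centroid, and halfspaces bounded by a level set of an affine function at its mean *)

Section Grunbaum.
Context {R : realType}.
Local Notation mu := (@lebesgue_measure R).
Local Notation GR := (measurableTypeR R).
Local Notation borelV := (@borelV R).

Lemma closed_superlevel n (W : 'rV[R]_n -> R) (w : R) : continuous W ->
  closed [set x | w <= W x].
Proof.
move=> cW; rewrite (_ : [set x | _] = W @^-1` [set y | w <= y]); last by [].
by apply: closed_comp => [x _|]; [exact: cW|exact: closed_ge].
Qed.

(** Brunn-Minkowski makes the volume of the superlevel sets of [W] log-concave in the level, so
    [logconcave_tail] applies at every level below [w]. The closed set at level [w] is reached by
    continuity from above. *)
Lemma grunbaum n (C : set (borelV n)) (r w : R) (W : 'rV[R]_n -> R) :
  0 <= r -> measurable C -> C `<=` box n r -> convexV C -> continuous W ->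
  (forall t x y, 0 < t < 1 -> W ((1 - t) *: x + t *: y) = (1 - t) * W x + t * W y) ->
  (forall x, C x -> 0 <= W x) -> 0 < fine (vol n C) ->
  (\int[vol n]_(x in C) (W x)%:E = (w * fine (vol n C))%:E)%E ->
  fine (vol n C) * expR (- 1) <= fine (vol n (C `&` [set x | w <= W x])).
Proof.
move=> r0 mC Cr vC cW aW W0 V0 IW.
have mW : measurable_fun [set: borelV n] (W : borelV n -> GR).
  exact: continuous_measurable_funV.
have mS s : measurable (C `&` [set x | s < W x] : set (borelV n)).
  by apply: measurableI => //; exact: measurable_superlevel.
have finS s : vol n (C `&` [set x | s < W x]) \is a fin_num.
  by apply: (@vol_fin _ _ _ r) => // x [/Cr].
pose G s := fine (vol n (C `&` [set x | s < W x])).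
have finC : vol n C \is a fin_num by apply: (@vol_fin _ _ _ r).
have GV s : 0 <= G s <= fine (vol n C).
  rewrite fine_ge0//= fine_le//; apply: le_measure; rewrite ?inE//.
have Gneg s : s < 0 -> G s = fine (vol n C).
  move=> s0; rewrite /G; congr (fine (vol n _)); apply/seteqP; split => [x []//|x Cx].
  by split => //=; apply: lt_le_trans (W0 _ Cx).
have Gdec s s' : s <= s' -> G s' <= G s.
  move=> ss'; rewrite fine_le//; apply: le_measure; rewrite ?inE//.
  by apply: setIS => x; exact: le_lt_trans.
have Glc t s s' : 0 < t < 1 -> G s `^ (1 - t) * G s' `^ t <= G ((1 - t) * s + t * s').
  move=> t01; have /andP[t0 t1] := t01.
  apply: (@brunn_minkowski _ _ _ r) => //; try by move=> x [/Cr].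
  move=> x y [Cx Wx] [Cy Wy]; split; first exact: vC.
  rewrite /= aW// ltrD// ltr_pM2l// subr_gt0//.
have Gint : (\int[mu]_(s in `[0%R, +oo[) (G s)%:E = (w * fine (vol n C))%:E)%E.
  rewrite -IW [RHS]integral_mkcond.
  pose f := (fun x : borelV n => W x * \1_C x : R).
  have -> : (\int[vol n]_x ((fun x => (W x)%:E) \_ C) x = \int[vol n]_x (f x)%:E)%E.
    apply: eq_integral => x _; rewrite patchE /f indicE.
    by case: (x \in C); rewrite ?mulr1 ?mulr0.
  rewrite layer_cake; first last.
  - move=> x; rewrite /f indicE; have [/set_mem Cx|_] := boolP (x \in C).
      by rewrite mulr1 W0.
    by rewrite mulr0.
  - by apply: measurable_funM => //; exact: measurable_indic.
  apply: eq_integral => s; rewrite inE/= in_itv/= andbT => s0.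
  rewrite /G fineK//; congr (vol n _); apply/seteqP; split => x /=; rewrite /f indicE.
    by move=> [Cx sW]; rewrite mem_set// mulr1.
  have [/set_mem Cx|_] := boolP (x \in C); first by rewrite mulr1.
  by rewrite mulr0 ltNge s0.
have H s : s < w -> fine (vol n C) * expR (- 1) <= G s.
  exact: (@logconcave_tail R G (fine (vol n C)) w).
(* The levels lie strictly below [w], and these sets decrease to the closed superlevel set at
   [w]. *)
pose F m : set (borelV n) := C `&` [set x | w - m.+1%:R^-1 < W x].
have capF : \bigcap_m F m = C `&` [set x | w <= W x].
  apply/seteqP; split => [x Fx|x [Cx wx] m _].
    split; first by have [] := Fx 0%N I.
    rewrite /= leNgt; apply/negP => Ww.
    have /ltr_add_invr[m Hm] := Ww.
    by have [_ /=] := Fx m I; rewrite ltNge => /negP; apply; rewrite ltW// ltrBrDr.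
  split => //=; apply: lt_le_trans wx; rewrite ltrBlDr ltrDl invr_gt0//.
have mcap : measurable (\bigcap_m F m) by apply: bigcapT_measurable => m; exact: mS.
have cvF : vol n \o F @ \oo --> vol n (\bigcap_m F m).
  apply: nonincreasing_cvg_mu => //.
  - by rewrite ltey_eq finS.
  - by move=> m; exact: mS.
  - apply/nonincreasing_seqP => m; apply/subsetPset; apply: setIS => x /=.
    apply: le_lt_trans; rewrite lerD2l lerN2 lef_pV2 ?posrE// ler_nat//.
rewrite -lee_fin fineK; last by rewrite -capF; apply: (@vol_fin _ _ _ r) => // x /(_ 0%N I)[/Cr].
rewrite -capF -(cvg_lim _ cvF)//; apply: lime_ge; first by apply/cvg_ex; eexists; exact: cvF.
apply: nearW => m /=; rewrite -(fineK (finS _)) lee_fin; apply: H.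
by rewrite ltrBlDr ltrDl.
Qed.

(** The point of coordinate means satisfies the integral formula by linearity. It lies in [C], since
    otherwise separation would give an affine function that is nonnegative on [C] but has a negative
    integral. *)
Lemma centroid n (C : set (borelV n)) : compact (C : set 'rV[R]_n) -> convexV C ->
  0 < fine (vol n C) ->
  exists p : 'rV[R]_n, C p /\ forall (u : 'rV[R]_n) c,
    (\int[vol n]_(x in C) (dotp u x + c)%:E = ((dotp u p + c) * fine (vol n C))%:E)%E.
Proof.
move=> cC vC V0; have [r Cr] := compact_boundedV cC.
have mC : measurable C by exact: compact_measurableV.
have finC : vol n C \is a fin_num by apply: (@vol_fin _ _ _ r).
set V := fine (vol n C) in V0 *.
have icoord i : (vol n).-integrable C (EFin \o (fun x : borelV n => x ord0 i)).
  apply: measurable_bounded_integrable => //.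
  - by rewrite ltey_eq finC.
  - by apply: measurable_funTS; apply: continuous_measurable_funV; exact: coordV_continuous.
  - exists r; split; first exact: num_real.
    by move=> M rM x /Cr /(_ i) H; apply: (le_trans H); exact: ltW.
pose p : 'rV[R]_n := \row_i (fine (\int[vol n]_(x in C) (x ord0 i)%:E)%E / V).
have Hp u c : (\int[vol n]_(x in C) (dotp u x + c)%:E = ((dotp u p + c) * V)%:E)%E.
  transitivity (\int[vol n]_(x in C)
      ((\sum_i ((u ord0 i)%:E * (x ord0 i)%:E)) + c%:E))%E.
    by apply: eq_integral => x _; rewrite dotpE EFinD -sumEFin.
  have iZ i : (vol n).-integrable C (fun x : borelV n => (u ord0 i)%:E * (x ord0 i)%:E)%E.
    by apply: integrableZl => //; exact: icoord.
  rewrite integralD//=; first last.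
  - apply: (@measurable_bounded_integrable _ _ _ _ (fun _ : borelV n => c)) => //.
      by rewrite ltey_eq finC.
    exists `|c|; split; first exact: num_real.
    by move=> M cM x _; exact: ltW.
  - exact: integrable_sum.
  have -> : (\int[vol n]_(x in C) c%:E = (c * V)%:E)%E.
    by rewrite integral_cst// EFinM /V fineK.
  rewrite integral_sum// mulrDl EFinD; congr (_ + _)%E.
  rewrite dotpE mulr_suml -sumEFin; apply: eq_bigr => i _.
  have -> : (u ord0 i * p ord0 i * V = u ord0 i * fine (\int[vol n]_(x in C) (x ord0 i)%:E)%E)%R.
    by rewrite mxE -mulrA divfK// gt_eqF.
  rewrite EFinM fineK; first exact: (integralZl mC (icoord i)).
  exact: integrable_fin_num (icoord i).
exists p; split => //; apply: contrapT => Cp.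
have C0 : C !=set0.
  by apply/set0P/eqP => C0; move: V0; rewrite /V C0 measure0 ltxx.
have [u [d [d0 H]]] := separation cC vC C0 Cp.
have := Hp u (- (dotp u p + d)).
have -> : (dotp u p - (dotp u p + d)) * V = - (d * V) by ring.
move=> E; have : (0 <= (- (d * V))%:E :> \bar R)%E.
  by rewrite -E; apply: integral_ge0 => x Cx; rewrite lee_fin subr_ge0 H.
by rewrite lee_fin oppr_ge0 leNgt mulr_gt0.
Qed.
End Grunbaum.

(** * Slices at integer heights *)

Section SumIntegral.
Context {R : realType}.
Local Notation mu := (@lebesgue_measure R).
Local Notation GR := (measurableTypeR R).
Variables (g : R -> R) (M : R) (k : nat).
Hypotheses (k0 : (0 < k)%N) (mg : measurable_fun [set: GR] (g : GR -> R))
  (gM : forall x, 0 <= g x <= M)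
  (gq : forall x y z : R, x <= y <= z -> Num.min (g x) (g z) <= g y)
  (gl : forall x : R, x < 0 -> g x = 0) (gr : forall x : R, k%:R < x -> g x = 0).

Let g0 x : 0 <= g x. Proof. by case/andP: (gM x). Qed.
Let g1 x : g x <= M. Proof. by case/andP: (gM x). Qed.
Let M0 : 0 <= M. Proof. exact: le_trans (g0 0) (g1 0). Qed.

(** The mode is the supremum of the points after which [g] still takes a larger value; 0 is added to
    make that set nonempty and the mode nonnegative. Monotonicity is claimed strictly on either side
    only, because [g] may jump at the mode. *)
Lemma quasiconcave_mode : exists m : R, [/\ 0 <= m <= k%:R,
  (forall x y, x <= y -> y < m -> g x <= g y) &
  (forall x y, m < x -> x <= y -> g y <= g x)].
Proof.
pose S := [set x : R | x = 0 \/ exists y, x < y /\ g x < g y].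
have Sk : ubound S k%:R.
  move=> x [->//|[y [xy gxy]]]; rewrite leNgt; apply/negP => kx.
  by move: gxy; rewrite (gr (lt_trans kx xy)) ltNge g0.
have supS : has_sup S by split; [exists 0; left|exists k%:R].
have le0 : 0 <= sup S by apply: ub_le_sup supS.2 _ _; left.
exists (sup S); split.
- by rewrite le0; apply: ge_sup; [exact: supS.1|exact: Sk].
- move=> x y xy ym; rewrite leNgt; apply/negP => gyx.
  have e0 : 0 < sup S - y by rewrite subr_gt0.
  have [z Sz] := sup_adherent e0 supS; rewrite subKr => yz.
  case: Sz => [z0|[y' [zy' gzy']]].
    have x0 : x < 0 by rewrite -z0; exact: le_lt_trans xy yz.
    by move: gyx; rewrite [g x]gl// ltNge g0.
  have H1 : Num.min (g x) (g y') <= g y by apply: gq; rewrite xy ltW// (lt_trans yz).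
  have H2 : Num.min (g y) (g y') <= g z by apply: gq; rewrite !ltW.
  move: H1; rewrite ge_min => /orP[|gy'y]; first by rewrite leNgt gyx.
  by move: H2; rewrite min_r// leNgt gzy'.
- move=> x y mx; rewrite le_eqVlt => /predU1P[->//|xy].
  rewrite leNgt; apply/negP => gxy.
  have : x <= sup S by apply: ub_le_sup supS.2 _ _; right; exists y.
  by rewrite leNgt mx.
Qed.

Lemma sum_nat_eq_le1 n j : \sum_(z < n) ((z : nat) == j)%:R <= 1 :> R.
Proof.
elim: n j => [|n IH] j; first by rewrite big_ord0.
rewrite big_ord_recl; case: j => [|j] /=.
  by rewrite big1 ?addr0.
rewrite add0r; apply: le_trans (IH j); rewrite le_eqVlt; apply/orP; left; apply/eqP.
by apply: eq_bigr => z _; rewrite /bump /= add1n eqSS.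
Qed.

(** On each interval [z, z+1] away from the mode, [g] is at most its value at the endpoint nearer to
    the mode, and each integer is charged at most once. At most two closed intervals contain the
    mode, and each costs [M]. *)
Lemma integral_le_sum :
  (\int[mu]_x (g x)%:E <= (\sum_(z < k.+1) g z%:R + 2 * M)%:E)%E.
Proof.
have [m [/andP[m0 mk] gL gR]] := quasiconcave_mode.
pose b (z : nat) := (z.+1%:R < m)%R%:R * g z.+1%:R + (m < z%:R)%R%:R * g z%:R
  + (z%:R <= m <= z.+1%:R)%R%:R * M.
have b0 z : 0 <= b z by rewrite !addr_ge0// ?mulr_ge0.
pose I (z : nat) : set GR := `[z%:R, z.+1%:R]%classic.
have mI z : measurable (I z) by exact: measurable_itv.
apply: (@le_trans _ _ (\int[mu]_x (\sum_(z < k) ((b z)%:E * (\1_(I z) x)%:E)))%E).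
  apply: ge0_le_integral => //.
  - by move=> x _; rewrite lee_fin.
  - exact/measurable_EFinP.
  - apply: emeasurable_sum => z _; apply: emeasurable_funM => //.
    by apply/measurable_EFinP; exact: measurable_indic.
  move=> x _; rewrite [leRHS](_ : _ = (\sum_(z < k) b z * \1_(I z) x)%:E); last first.
    by rewrite -sumEFin; apply: eq_bigr => z _; rewrite EFinM.
  rewrite lee_fin.
  have s0 z : 0 <= b z * \1_(I z) x by rewrite mulr_ge0.
  have [x0|x0] := ltP x 0; first by rewrite gl// sumr_ge0.
  have [xk|xk] := ltP k%:R x; first by rewrite gr// sumr_ge0.
  have [z zk zx] : exists2 z, (z < k)%N & z%:R <= x <= z.+1%:R.
    have [tk|tk] := ltnP (Num.truncn x) k.
      exists (Num.truncn x) => //.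
      by have /andP[-> /ltW ->] := truncn_itv x0.
    (* Only [x = k] is left; it belongs to the last closed interval. *)
    exists k.-1; rewrite ?prednK// xk andbT.
    have : k%:R <= x by apply: le_trans (_ : (Num.truncn x)%:R <= x); rewrite ?ler_nat// truncn_le.
    by apply: le_trans; rewrite ler_nat leq_pred.
  rewrite (bigD1 (Ordinal zk))//= -[leLHS]addr0 lerD ?sumr_ge0//.
  have /andP[zx1 zx2] := zx.
  rewrite indicE mem_set ?mulr1; last by rewrite /I/= in_itv/=.
  rewrite /b; have [z1m|mz1] := ltP z.+1%:R m.
    have -> : (m < z%:R) = false.
      by apply/negbTE; rewrite -leNgt; apply: le_trans (ltW z1m); rewrite ler_nat.
    rewrite mul1r mul0r addr0 (le_trans (gL _ _ zx2 z1m))// lerDl mulr_ge0//.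
  have [mz|zm] := ltP m z%:R; last by rewrite mul1r !mul0r !add0r.
  by rewrite mul1r !mul0r add0r addr0 gR.
rewrite ge0_integral_sum//; first last.
- by move=> z x _; rewrite -EFinM lee_fin mulr_ge0.
- by move=> z; apply: emeasurable_funM => //; apply/measurable_EFinP; exact: measurable_indic.
have muI z : mu (I z) = 1%:E.
  rewrite -[LHS]/(mu (`[z%:R, z.+1%:R]%classic : set R)) lebesgue_measure_itv/=.
  rewrite lte_fin ltr_nat ltnSn.
  by rewrite -EFinB -natr1 addrC addKr.
under eq_bigr => z _.
  rewrite ge0_integralZl//; first last.
  - by rewrite lee_fin.
  - by apply/measurable_EFinP; exact: measurable_indic.
  rewrite integral_indic// setIT [X in (_ * X)%E](muI z) mule1; over.
rewrite sumEFin lee_fin /b !big_split/=.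
have S1 : \sum_(z < k) (z.+1%:R < m)%R%:R * g z.+1%:R <= \sum_(z < k.+1) (z%:R < m)%R%:R * g z%:R.
  by rewrite [leRHS]big_ord_recl/= -[leLHS]add0r lerD ?mulr_ge0.
have S2 : \sum_(z < k) (m < z%:R)%R%:R * g z%:R <= \sum_(z < k.+1) (m < z%:R)%R%:R * g z%:R.
  by rewrite [leRHS]big_ord_recr/= -[leLHS]addr0 lerD ?mulr_ge0.
have S12 : \sum_(z < k.+1) (z%:R < m)%R%:R * g z%:R + \sum_(z < k.+1) (m < z%:R)%R%:R * g z%:R
    <= \sum_(z < k.+1) g z%:R.
  rewrite -big_split/=; apply: ler_sum => z _; rewrite -mulrDl ler_piMl//.
  by case: ltgtP => _; rewrite ?addr0 ?add0r.
have S3 : \sum_(z < k) (z%:R <= m <= z.+1%:R)%R%:R * M <= 2 * M.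
  rewrite -mulr_suml ler_wpM2r//.
  (* The second index occurs when [m] is an integer, which is then shared by two intervals. *)
  apply: (@le_trans _ _ (\sum_(z < k) (((z : nat) == Num.truncn m)%:R +
    ((z : nat) == (Num.truncn m).-1)%:R))).
    apply: ler_sum => z _.
    case: (boolP (_ <= _ <= _)) => [/andP[zm mz]|_]; last by rewrite addr_ge0.
    have H1 : (z <= Num.truncn m)%N by rewrite truncn_ge_nat.
    have H2 : (Num.truncn m <= z.+1)%N.
      by rewrite -(ler_nat R) (le_trans _ mz)// truncn_le.
    have [->|zm'] := eqVneq (z : nat) (Num.truncn m); first by rewrite lerDl.
    have -> : (z : nat) = (Num.truncn m).-1.
      have H3 : (z < Num.truncn m)%N by rewrite ltn_neqAle zm'.
      by apply/eqP; rewrite -eqSS prednK ?(leq_trans _ H3)// eqn_leq H3 H2.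
    by rewrite eqxx lerDr.
  by rewrite big_split/= -[2]/(1 + 1) lerD//; exact: sum_nat_eq_le1.
move: S1 S2 S12 S3; lra.
Qed.

(** Dual charging: on an interval away from the mode, [g] is at least its value at the endpoint
    farther from the mode. The integers left uncharged lie within distance 1 of the mode, so there
    are at most three. *)
Lemma sum_le_integral :
  ((\sum_(z < k.+1) g z%:R)%:E <= \int[mu]_x (g x)%:E + (3 * M)%:E)%E.
Proof.
have [m [/andP[m0 mk] gL gR]] := quasiconcave_mode.
pose a (z : nat) := (z.+1%:R < m)%R%:R * g z%:R + (m < z%:R)%R%:R * g z.+1%:R.
have a0 z : 0 <= a z by rewrite !addr_ge0// ?mulr_ge0.
(* Half-open here: a lower bound of the integral needs disjoint intervals, while the upper bound
   only needed a cover. *)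
pose I (z : nat) : set GR := `[z%:R, z.+1%:R[%classic.
have mI z : measurable (I z) by exact: measurable_itv.
have muI z : mu (I z) = 1%:E.
  rewrite -[LHS]/(mu (`[z%:R, z.+1%:R[%classic : set R)) lebesgue_measure_itv/=.
  rewrite lte_fin ltr_nat ltnSn.
  by rewrite -EFinB -natr1 addrC addKr.
have H : ((\sum_(z < k) a z)%:E <= \int[mu]_x (g x)%:E)%E.
  have -> : ((\sum_(z < k) a z)%:E =
      \int[mu]_x (\sum_(z < k) ((a z)%:E * (\1_(I z) x)%:E)))%E.
    rewrite ge0_integral_sum//; first last.
    - by move=> z x _; rewrite -EFinM lee_fin mulr_ge0.
    - by move=> z; apply: emeasurable_funM => //; apply/measurable_EFinP; exact: measurable_indic.
    rewrite -sumEFin; apply: eq_bigr => z _.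
    rewrite ge0_integralZl//; first last.
    - by rewrite lee_fin.
    - by apply/measurable_EFinP; exact: measurable_indic.
    by rewrite integral_indic// setIT [X in (_ * X)%E](muI z) mule1.
  apply: ge0_le_integral => //.
  - by move=> x _; apply: sume_ge0 => z _; rewrite -EFinM lee_fin mulr_ge0.
  - apply: emeasurable_sum => z _; apply: emeasurable_funM => //.
    by apply/measurable_EFinP; exact: measurable_indic.
  - exact/measurable_EFinP.
  move=> x _; rewrite [leLHS](_ : _ = (\sum_(z < k) a z * \1_(I z) x)%:E); last first.
    by rewrite -sumEFin; apply: eq_bigr => z _; rewrite EFinM.
  rewrite lee_fin.
  have [[z zx]|nz] := pselect (exists z : 'I_k, I z x); last first.
    rewrite big1// => z _; rewrite indicE memNset ?mulr0// => zx; apply: nz; by exists z.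
  rewrite (bigD1 z)//= [X in _ + X]big1 ?addr0.
    rewrite indicE mem_set// mulr1 /a.
    move: zx; rewrite /I/= in_itv/= => /andP[zx xz].
    have [zm|mz] := ltP z.+1%:R m.
      have -> : (m < z%:R) = false.
        by apply/negbTE; rewrite -leNgt; apply: le_trans (ltW zm); rewrite ler_nat.
      by rewrite mul1r mul0r addr0 gL// (lt_trans xz).
    rewrite mul0r add0r; case: ltP => [mz'|_]; last by rewrite mul0r.
    by rewrite mul1r gR ?ltW// (lt_le_trans mz').
  move=> i iz; rewrite indicE memNset ?mulr0//.
  move: zx; rewrite /I/= !in_itv/= => /andP[zx xz] /andP[ix xi].
  have /(le_lt_trans) : z%:R <= x by []. move/(_ _ xi); rewrite ltr_nat ltnS => zi.
  have /(le_lt_trans) : i%:R <= x by []. move/(_ _ xz); rewrite ltr_nat ltnS => iz'.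
  by move/eqP: iz; apply; apply/val_inj/eqP; rewrite /= eqn_leq iz' zi.
apply: (@le_trans _ _ ((\sum_(z < k) a z)%:E + (3 * M)%:E)%E); last exact: leeD2r.
rewrite -EFinD lee_fin.
(* Left of the mode [z] is charged to [z, z+1], right of it to [z-1, z]; hence the index shift in
   the second sum. *)
apply: (@le_trans _ _ (\sum_(z < k.+1) ((z.+1%:R < m)%R%:R * g z%:R + (m + 1 < z%:R)%R%:R * g z%:R
   + (m - 1 <= z%:R <= m + 1)%R%:R * M))).
  apply: ler_sum => z _.
  have [zm|mz] := ltP z.+1%:R m; first by rewrite mul1r -addrA lerDl addr_ge0// mulr_ge0.
  have [mz1|mz1] := ltP (m + 1) z%:R; first by rewrite mul0r mul1r add0r lerDl mulr_ge0.
  have -> : m - 1 <= z%:R by rewrite lerBlDr natr1.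
  by rewrite !mul0r !add0r mul1r.
rewrite !big_split/= lerD//.
  rewrite lerD//.
    rewrite big_ord_recr/= (_ : (k.+1%:R < m) = false) ?mul0r ?addr0//.
    by apply/negbTE; rewrite -leNgt (le_trans mk)// ler_nat.
  rewrite big_ord_recl/= (_ : (m + 1 < 0) = false) ?mul0r ?add0r; last first.
    by apply/negbTE; rewrite -leNgt addr_ge0.
  by apply: ler_sum => z _; rewrite /bump /= add1n -natr1 ltrD2r.
rewrite -mulr_suml ler_wpM2r//.
set j := Num.truncn m.
apply: (@le_trans _ _ (\sum_(z < k.+1) (((z : nat) == j)%:R + ((z : nat) == j.-1)%:R
    + ((z : nat) == j.+1)%:R))).
  apply: ler_sum => z _; case: (boolP (_ <= _ <= _)) => [/andP[zm mz]|_]; last by rewrite !addr_ge0.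
  have jm : j%:R <= m by rewrite truncn_le.
  have mj : m < j.+1%:R by exact: truncnS_gt.
  have H1 : (z < j.+2)%N.
    by rewrite -(ltr_nat R) (le_lt_trans mz)// -natr1 ltrD2r.
  have H2 : (j <= z.+1)%N.
    by rewrite -(ler_nat R) (le_trans jm)// -natr1 -lerBlDr.
  have [->|zj] := eqVneq (z : nat) j; first by rewrite -addrA lerDl addr_ge0.
  have [->|zj1] := eqVneq (z : nat) j.+1; first by rewrite lerDr addr_ge0.
  have H3 : (z < j)%N by rewrite ltn_neqAle zj -ltnS ltn_neqAle zj1.
  have -> : (z : nat) = j.-1.
    by apply/eqP; rewrite -eqSS prednK ?(leq_trans _ H3)// eqn_leq H3 H2.
  by rewrite eqxx add0r lerDl.
have -> : 3 = 1 + 1 + 1 :> R by lra.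
by rewrite !big_split/= !lerD//; exact: sum_nat_eq_le1.
Qed.
End SumIntegral.

(** * The centerpoint inequality for sums of slice volumes *)

Section SlicesCenterpoint.
Context {R : realType}.
Local Notation mu := (@lebesgue_measure R).
Local Notation GR := (measurableTypeR R).
Local Notation borelV := (@borelV R).

Lemma vol_homothety_le n (a : R) (b : 'rV[R]_n) (A B : set (borelV n)) : 0 < a ->
  measurable A -> measurable B -> (forall x : 'rV[R]_n, A x -> B (a *: x + b)) ->
  ((a ^+ n)%:E * vol n A <= vol n B)%E.
Proof.
move=> a0 mA mB AB; pose P := (fun x : 'rV[R]_n => a *: x + b) @^-1` B : set (borelV n).
have an0 : 0 < a ^+ n by rewrite exprn_gt0.
have -> : vol n B = ((a ^+ n)%:E * vol n P)%E.
  by rewrite vol_affine// muleA -EFinM exprVn divff ?mul1e// gt_eqF.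
apply: lee_wpmul2l; first by rewrite lee_fin ltW.
by apply: le_measure; rewrite ?inE//; exact: measurable_affineV.
Qed.

Lemma convexV_le n (A : set 'rV[R]_n) t x y : convexV A -> 0 <= t < 1 ->
  A x -> A y -> A ((1 - t) *: x + t *: y).
Proof.
move=> vA /andP[]; rewrite le_eqVlt => /predU1P[<- _ Ax _|t0 t1].
  by rewrite subr0 scale1r scale0r addr0.
by apply: vA; rewrite t0.
Qed.

Lemma slice_convex n (C : set (borelV n.+1)) (t x y : R) (v w : 'rV[R]_n) : convexV C ->
  0 <= t < 1 -> slice C x v -> slice C y w ->
  slice C ((1 - t) * x + t * y) ((1 - t) *: v + t *: w).
Proof.
move=> vC t01 Cv Cw; rewrite /slice /= -consvD -!consvZ.
exact: convexV_le.
Qed.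

Lemma bernoulli_ineq (n : nat) (x : R) : -1 <= x -> 1 + n%:R * x <= (1 + x) ^+ n.
Proof.
move=> x1; elim: n => [|n IH]; first by rewrite expr0; lra.
rewrite exprS.
have : (1 + x) * (1 + n%:R * x) <= (1 + x) * (1 + x) ^+ n by rewrite ler_wpM2l//; lra.
apply: le_trans; rewrite -natr1.
have : 0 <= x ^+ 2 * n%:R by rewrite mulr_ge0// sqr_ge0.
lra.
Qed.

Variables (d k : nat) (C : set (borelV d.+1)).
Hypotheses (d0 : (0 < d)%N) (k0 : (0 < k)%N)
  (cC : compact (C : set 'rV[R]_d.+1)) (vC : convexV C) (V0 : 0 < fine (vol d.+1 C))
  (Cl : exists2 q : 'rV[R]_d.+1, C q & q ord0 ord0 = 0)
  (Cr : exists2 q : 'rV[R]_d.+1, C q & q ord0 ord0 = k%:R)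
  (C0k : forall x : 'rV[R]_d.+1, C x -> 0 <= x ord0 ord0 <= k%:R).

Let V := fine (vol d.+1 C).
Let f (A : set (borelV d.+1)) (x : R) : R := fine (vol d (slice A x)).

Let mC : measurable C. Proof. exact: compact_measurableV. Qed.

Lemma slice_out (x : R) : ~ 0 <= x <= k%:R -> slice C x = set0.
Proof.
move=> xk; apply/seteqP; split => // v /C0k; rewrite consv0 /=; exact: xk.
Qed.

(* Every slice C_x is shrunk towards the two end slices by the factor
   1 - s >= 1 - 1/(2d); this gives slices of at least half the volume over an
   interval of length k/(2d). *)
Lemma slice_vol_le (x : R) : f C x <= 4 * d%:R / k%:R * V.
Proof.
have [r Cbox] := compact_boundedV cC.
have kR : 0 < k%:R :> R by rewrite ltr0n.
have dR : 1 <= d%:R :> R by rewrite ler1n.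
have [xk|xk] := boolP (0 <= x <= k%:R); last first.
  rewrite /f slice_out; last exact/negP.
  rewrite measure0 /=; apply: mulr_ge0; last exact: ltW.
  by apply: divr_ge0; [lra|exact: ltW].
have /andP[x0 xk'] := xk.
have finS y : vol d (slice C y) \is a fin_num.
  by apply: (@vol_fin _ _ _ r); [exact: measurable_slice|exact: slice_box].
have fS y : vol d (slice C y) = (f C y)%:E by rewrite /f (fineK (finS _)).
have shrink q s : C q -> 0 <= s -> s * d%:R <= 1 / 2 ->
    f C x / 2 <= f C ((1 - s) * x + s * q ord0 ord0).
  move=> Cq s0 sd.
  have s1 : s <= 1 / 2 by apply: le_trans sd; rewrite ler_peMr.
  have s01 : 0 <= s < 1 by rewrite s0/=; lra.
  have H : ((((1 - s) ^+ d)%:E * vol d (slice C x)) <=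
      vol d (slice C ((1 - s) * x + s * q ord0 ord0)%R))%E.
    apply: (@vol_homothety_le _ _ (s *: tailv q)); [lra|exact: measurable_slice..|].
    move=> v Cv; apply: (slice_convex vC s01 Cv).
    by rewrite /slice /= consvK.
  move: H; rewrite !fS -EFinM lee_fin; apply: le_trans.
  rewrite mulrC ler_wpM2r ?fine_ge0//.
  have s1' : -1 <= - s by lra.
  by apply: le_trans (bernoulli_ineq d s1'); lra.
have [q0 Cq0 q00] := Cl; have [q1 Cq1 q1k] := Cr.
(* The largest [s] allowed by [shrink], where Bernoulli gives (1-s)^d >= 1 - s d >= 1/2; [a] and [b]
   are the heights reached from [x] with this [s] towards 0 and [k]. *)
pose l := 1 / (2 * d%:R) : R.
have l0 : 0 < l by rewrite /l divr_gt0// mulr_gt0//; lra.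
have ld : l * d%:R = 1 / 2 by rewrite /l; field; lra.
pose a := (1 - l) * x; pose b := x + l * (k%:R - x).
have ab : b - a = l * k%:R by rewrite /a /b; ring.
have half y : a <= y <= b -> f C x / 2 <= f C y.
  move=> /andP[ay yb].
  have [yx|xy] := leP y x.
    have [x00|x00] := eqVneq x 0.
      have -> : y = x by apply/eqP; rewrite eq_le yx x00; move: ay; rewrite /a x00 mulr0.
      have : 0 <= f C x by exact: fine_ge0.
      lra.
    have {}x00 : 0 < x by rewrite lt_neqAle eq_sym x00.
    have := @shrink q0 (1 - y / x) Cq0; rewrite q00 mulr0 addr0 subKr divfK ?gt_eqF//; apply.
      by rewrite subr_ge0 ler_pdivrMr// mul1r.
    apply: (@le_trans _ _ (l * d%:R)); last by rewrite ld.
    rewrite ler_wpM2r// lerBlDr addrC -lerBlDr ler_pdivlMr//.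
  have x1k : 0 < k%:R - x.
    rewrite subr_gt0 lt_neqAle xk' andbT; apply/eqP => xkE.
    by move: yb; rewrite /b -xkE subrr mulr0 addr0 leNgt xy.
  have := @shrink q1 ((y - x) / (k%:R - x)) Cq1; rewrite q1k.
  have -> : (1 - (y - x) / (k%:R - x)) * x + (y - x) / (k%:R - x) * k%:R = y.
    by field; lra.
  apply; first by rewrite divr_ge0 ?ltW// subr_gt0.
  apply: (@le_trans _ _ (l * d%:R)); last by rewrite ld.
  rewrite ler_wpM2r// ler_pdivrMr//; move: yb; rewrite /b; lra.
have : ((f C x / 2 * (l * k%:R))%:E <= V%:E)%E.
  rewrite /V fineK; last exact: (@vol_fin _ _ _ r).
  rewrite vol_slice.
  have -> : ((f C x / 2 * (l * k%:R))%:E =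
      \int[mu]_y ((f C x / 2)%:E * (\1_(`[a, b]%classic : set R) y)%:E))%E.
    rewrite ge0_integralZl//; first last.
    - by rewrite lee_fin divr_ge0 ?fine_ge0.
    - by apply/measurable_EFinP; exact: measurable_indic.
    rewrite integral_indic// setIT EFinM; congr (_ * _)%E.
    rewrite -[RHS]/(mu (`[a, b]%classic : set R)) lebesgue_measure_itv/= lte_fin.
    by rewrite -subr_gt0 ab mulr_gt0// -EFinB ab.
  apply: ge0_le_integral => //.
  - by move=> y _; rewrite -EFinM lee_fin mulr_ge0 ?divr_ge0 ?fine_ge0.
  - by apply: emeasurable_funM => //; apply/measurable_EFinP; exact: measurable_indic.
  - exact: measurable_fun_slice.
  move=> y _; rewrite fS -EFinM lee_fin indicE.
  have [yab|_] := boolP (y \in _); last by rewrite mulr0 fine_ge0.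
  by rewrite mulr1 half//; move: yab; rewrite inE/= in_itv/=.
have lk0 : 0 < l * k%:R by exact: mulr_gt0.
rewrite lee_fin -ler_pdivlMr// => H.
have E : 4 * d%:R / k%:R * V = 2 * (V / (l * k%:R)).
  by rewrite /l; field; rewrite !gt_eqF//; lra.
rewrite E; lra.
Qed.

(** Slice volumes of [A] are quasi-concave by Brunn-Minkowski and inherit the bound on the slices of
    [C]. It serves for [C] itself and for its intersection with a halfspace. *)
Lemma slice_sum_integral (A : set (borelV d.+1)) : measurable A -> A `<=` C -> convexV A ->
  fine (vol d.+1 A) - 2 * (4 * d%:R / k%:R * V) <= \sum_(z < k.+1) f A z%:R
    <= fine (vol d.+1 A) + 3 * (4 * d%:R / k%:R * V).
Proof.
move=> mA AC vA; set M := 4 * d%:R / k%:R * V.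
have [r Cbox] := compact_boundedV cC.
have r0 : 0 <= r.
  have [q Cq _] := Cl; exact: le_trans (normr_ge0 _) (Cbox _ Cq ord0).
have Abox : A `<=` box d.+1 r by exact: subset_trans Cbox.
have mS x : measurable (slice A x) by exact: measurable_slice.
have bS x : slice A x `<=` box d r by exact: slice_box.
have finS x : vol d (slice A x) \is a fin_num by exact: vol_fin (bS x).
have fE x : (f A x)%:E = vol d (slice A x) by rewrite /f (fineK (finS _)).
have volE : vol d.+1 A = (\int[mu]_x (f A x)%:E)%E.
  by rewrite vol_slice; apply: eq_integral => x _; rewrite fE.
have mf : measurable_fun [set: GR] (f A : GR -> R).
  apply/measurable_EFinP; rewrite (_ : _ \o _ = fun x => vol d (slice A x)).
    exact: measurable_fun_slice.
  by apply/funext => x /=; rewrite fE.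
have fM x : 0 <= f A x <= M.
  rewrite fine_ge0//=; apply: le_trans (slice_vol_le x); rewrite fine_le//.
    by apply: (@vol_fin _ _ _ r); [exact: measurable_slice|exact: slice_box].
  by apply: le_measure; rewrite ?inE//; [exact: measurable_slice|move=> v; exact: AC].
have fq (x y z : R) : x <= y <= z -> Num.min (f A x) (f A z) <= f A y.
  move=> /andP[xy yz].
  have [->|xy'] := eqVneq y x; first by rewrite ge_min lexx.
  have [->|yz'] := eqVneq y z; first by rewrite ge_min lexx orbT.
  have {}xy : x < y by rewrite lt_neqAle eq_sym xy'.
  have {}yz : y < z by rewrite lt_neqAle yz'.
  pose t := (y - x) / (z - x).
  have t01 : 0 < t < 1.
    rewrite /t; apply/andP; split; first by rewrite divr_gt0//; lra.
    by rewrite ltr_pdivrMr ?mul1r//; lra.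
  have /andP[t0 t1] := t01.
  have E : (1 - t) * x + t * z = y by rewrite /t; field; lra.
  have : f A x `^ (1 - t) * f A z `^ t <= f A y.
    apply: (@brunn_minkowski _ _ _ r) => // v w Av Aw; rewrite -E.
    by apply: slice_convex => //; rewrite ltW.
  apply: le_trans.
  set m := Num.min _ _.
  have m0 : 0 <= m by rewrite le_min !fine_ge0.
  rewrite -[leLHS](powRr1 m0) -{1}(subrK t 1) powRD ?subrK ?oner_eq0//.
  by apply: ler_pM; rewrite ?powR_ge0// ge0_ler_powR ?nnegrE ?fine_ge0// /m ?ge_min ?lexx ?orbT//;
    lra.
have fout (x : R) : ~ 0 <= x <= k%:R -> f A x = 0.
  move=> /slice_out E; rewrite /f (_ : slice A x = set0) ?measure0//.
  by apply/seteqP; split => // v /AC; rewrite -[C _]/(slice C x v) E.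
have fl (x : R) : x < 0 -> f A x = 0.
  by move=> x0; apply: fout; rewrite [0 <= x]leNgt x0.
have fr (x : R) : k%:R < x -> f A x = 0.
  by move=> x0; apply: fout; rewrite [x <= _]leNgt x0 andbF.
have := integral_le_sum k0 mf fM fq fl fr.
have := sum_le_integral mf fM fq fl fr.
rewrite -!volE -[vol d.+1 A](fineK (vol_fin mA Abox)) -!EFinD !lee_fin.
by move=> H1 H2; rewrite H1 andbT lerBlDr.
Qed.

(** The farther end is at distance at least k/2, and rounding the height towards it moves [p] by
    less than one unit, so the ratio is at most 2/k. *)
Lemma integral_shift (p : 'rV[R]_d.+1) : C p -> (2 < k)%N ->
  exists q : 'rV[R]_d.+1, exists s, [/\ C q, 0 <= s <= 2 / k%:R &
    exists j : nat, ((1 - s) *: p + s *: q) ord0 ord0 = j%:R].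
Proof.
move=> Cp k2; have kR : 0 < k%:R :> R by rewrite ltr0n.
have /andP[] := C0k Cp; set x := p ord0 ord0 => x0 xk.
have coordE q s : ((1 - s) *: p + s *: q) ord0 ord0 = (1 - s) * x + s * q ord0 ord0.
  by rewrite !mxE.
have [xh|xh] := leP x (k%:R / 2); last first.
  have [q Cq qE] := Cl; have /andP[jx xj] := truncn_itv x0.
  have xpos : 0 < x by lra.
  exists q, ((x - (Num.truncn x)%:R) / x); split => //.
    rewrite divr_ge0 ?subr_ge0//= ler_pdivrMr//.
    have : (1 : R) <= 2 / k%:R * x by rewrite mulrAC ler_pdivlMr//; lra.
    apply: le_trans; move: xj; rewrite -natr1; lra.
  by exists (Num.truncn x); rewrite coordE qE; field; lra.
have [q Cq qE] := Cr.
have y0 : 0 <= k%:R - x by lra.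
have /andP[jx xj] := truncn_itv y0.
have ypos : 0 < k%:R - x by lra.
exists q, ((k%:R - x - (Num.truncn (k%:R - x))%:R) / (k%:R - x)); split => //.
  rewrite divr_ge0 ?subr_ge0//= ler_pdivrMr//.
  have : (1 : R) <= 2 / k%:R * (k%:R - x) by rewrite mulrAC ler_pdivlMr//; lra.
  apply: le_trans; move: xj; rewrite -natr1; lra.
exists (k - Num.truncn (k%:R - x))%N; rewrite coordE qE natrB.
  by field; lra.
rewrite -(ler_nat R) (le_trans jx)//; lra.
Qed.

(** With h = d/k, the sum over [C] lies between V(1 - 8h) and V(1 + 12h), and the sum over the
    halfspace part is at least V((1 - 4h)/e - 8h) >= V(1/e - 12h). It remains to replace [V] by the
    sum over [C]. *)
Theorem slices_centerpoint : 24 * d%:R < k%:R :> R ->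
  0 < \sum_(z < k.+1) f C z%:R /\
  exists xbar : 'rV[R]_d.+1, [/\ C xbar, (exists j : nat, xbar ord0 ord0 = j%:R) &
    forall u : 'rV[R]_d.+1,
    (expR (- 1) - 24 * (d%:R / k%:R)) * \sum_(z < k.+1) f C z%:R
      <= \sum_(z < k.+1) f (C `&` [set x | dotp u xbar <= dotp u x]) z%:R].
Proof.
move=> dk; have kR : 0 < k%:R :> R by rewrite ltr0n.
have dR : 1 <= d%:R :> R by rewrite ler1n.
set h := d%:R / k%:R.
have h0 : 0 < h by rewrite divr_gt0//; lra.
have h24 : 24 * h < 1 by rewrite /h mulrA ltr_pdivrMr// mul1r.
have [r Cbox] := compact_boundedV cC.
have r0 : 0 <= r.
  have [q Cq _] := Cl; exact: le_trans (normr_ge0 _) (Cbox _ Cq ord0).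
have finC : vol d.+1 C \is a fin_num by exact: vol_fin Cbox.
have ME : 4 * d%:R / k%:R * V = 4 * h * V by rewrite /h !mulrA.
have hV : 0 < h * V by rewrite mulr_gt0.
have hV24 : 24 * h * V < V by rewrite gtr_pMl.
have /andP[S1 S2] := slice_sum_integral mC (fun _ => id) vC.
rewrite ME -/V in S1 S2.
split; first by lra.
have [p [Cp pE]] := centroid cC vC V0.
have k2 : (2 < k)%N by rewrite -(ltr_nat R); lra.
have [q [s [Cq /andP[s0 s2] [j jE]]]] := integral_shift Cp k2.
have s1 : s < 1.
  by apply: (le_lt_trans s2); rewrite ltr_pdivrMr// mul1r; lra.
exists ((1 - s) *: p + s *: q); split; [by apply: convexV_le => //; rewrite s0|by exists j|].
move=> u; set xbar := (1 - s) *: p + s *: q.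
set A := C `&` [set x | dotp u xbar <= dotp u x].
have dcont : continuous (dotp u : 'rV[R]_d.+1 -> R).
  rewrite (_ : dotp u = fun x => dotp u x + 0); first exact: dotp_continuous.
  by apply/funext => x; rewrite addr0.
have mHs (w : R) : measurable (C `&` [set x | w <= dotp u x] : set (borelV d.+1)).
  apply: measurableI => //; apply: closed_measurableV; exact: closed_superlevel.
have mA : measurable A by exact: mHs.
have vA : convexV A.
  move=> t x y t01 [Cx ux] [Cy uy]; split; first exact: vC.
  have /andP[t0 t1] := t01.
  have H1 : (1 - t) * dotp u xbar <= (1 - t) * dotp u x by rewrite ler_wpM2l// subr_ge0 ltW.
  have H2 : t * dotp u xbar <= t * dotp u y by rewrite ler_wpM2l// ltW.
  rewrite /= (dotpDr u ((1 - t) *: x) (t *: y)) !(dotpZr u x, dotpZr u y).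
  by rewrite (le_trans _ (lerD H1 H2))// -mulrDl subrK mul1r.
have /andP[A1 _] := slice_sum_integral mA (@subIsetl _ _ _) vA.
rewrite ME in A1.
(* Gruenbaum's inequality was proved for functions nonnegative on the body; adding a constant
   changes no halfspace. *)
have [c cE] : exists c, forall x, C x -> 0 <= dotp u x + c.
  have [] := @EVT_min_rV R d.+1 (dotp u) C; [by exists p|exact: cC| |].
    exact: continuous_subspaceT.
  move=> x0 _ Hx0; exists (- dotp u x0) => x Cx; rewrite subr_ge0; apply: Hx0.
  by rewrite inE.
have G : V * expR (- 1) <= fine (vol d.+1 (C `&` [set x | dotp u p <= dotp u x])).
  have -> : [set x | dotp u p <= dotp u x] = [set x | dotp u p + c <= dotp u x + c].
    by apply/seteqP; split => x /=; rewrite lerD2r.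
  apply: (@grunbaum _ _ _ r _ (fun x => dotp u x + c)) => //.
  - exact: dotp_continuous.
  - by move=> t x y _; rewrite dotpDr !dotpZr; ring.
have finH (w : R) : vol d.+1 (C `&` [set x | w <= dotp u x]) \is a fin_num.
  by apply: (@vol_fin _ _ _ r) => // x [/Cbox].
have HA : (1 - s) ^+ d.+1 * fine (vol d.+1 (C `&` [set x | dotp u p <= dotp u x]))
    <= fine (vol d.+1 A).
  rewrite -lee_fin EFinM (fineK (finH (dotp u p))) (fineK (finH (dotp u xbar))).
  apply: (@vol_homothety_le _ _ (s *: q)) => //; first by rewrite subr_gt0.
  move=> x [Cx px]; split; first by apply: convexV_le => //; rewrite s0.
  by rewrite /xbar /= !dotpDr !dotpZr lerD2r ler_pM2l ?subr_gt0.
(* Bernoulli with d + 1 <= 2d and s <= 2/k. *)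
have B : 1 - 4 * h <= (1 - s) ^+ d.+1.
  have s1' : -1 <= - s by lra.
  apply: le_trans (bernoulli_ineq d.+1 s1'); rewrite mulrN lerD2l lerN2.
  apply: (@le_trans _ _ (2 * d%:R * (2 / k%:R))).
    apply: ler_pM => //; rewrite -natr1; lra.
  by rewrite le_eqVlt; apply/orP; left; apply/eqP; rewrite /h; field; rewrite gt_eqF.
have e0 : 0 < expR (- 1) :> R by exact: expR_gt0.
have e1 : expR (- 1) <= 1 :> R by rewrite -[leRHS]expR0 ler_expR; lra.
have HA2 : (1 - 4 * h) * (V * expR (- 1)) <= fine (vol d.+1 A).
  apply: le_trans HA; apply: ler_pM => //; first by lra.
  by rewrite mulr_ge0// ltW.
have T1 : V * (expR (- 1) - 12 * h) <= \sum_(z < k.+1) f A z%:R.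
  have : h * V * expR (- 1) <= h * V by rewrite ler_piMr// ltW.
  move: HA2 A1; lra.
apply: le_trans T1.
(* The sign of the factor decides which bound on the sum over [C] applies: the upper one if it is
   positive, the lower one if it is not; the latter is called for only when 1/e - 12h is negative as
   well. *)
have [c0|c0] := leP (expR (- 1) - 24 * h) 0; last first.
  apply: (@le_trans _ _ ((expR (- 1) - 24 * h) * (V + 3 * (4 * h * V)))).
    by rewrite ler_pM2l.
  have H1 : h * V * expR (- 1) <= h * V by rewrite ler_piMr// ltW.
  have H2 : 0 <= h * h * V by rewrite !mulr_ge0// ltW.
  lra.
have [c1|c1] := leP 0 (expR (- 1) - 12 * h).
  apply: (@le_trans _ _ 0); last by rewrite mulr_ge0// ltW.
  by rewrite mulr_le0_ge0//; lra.
apply: (@le_trans _ _ ((expR (- 1) - 24 * h) * (V - 2 * (4 * h * V)))).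
  by rewrite ler_wnM2l.
have H1 : V * (expR (- 1) - 24 * h) * (1 - 8 * h) <= V * (expR (- 1) - 12 * h).
  rewrite -mulrA ler_pM2l//.
  have H3 : h * expR (- 1) >= 0 by rewrite mulr_ge0// ltW.
  have H4 : h * (24 * h) <= h * 1 by rewrite ler_pM2l// ltW.
  lra.
move: H1; lra.
Qed.
End SlicesCenterpoint.

(** * Hausdorff measure *)

Section Hausdorff.
Context {R : realType}.
Implicit Types (p : nat) (r delta : R).

Lemma eucl_distxx p (x : 'rV[R]_p) : eucl_dist x x = 0.
Proof. by rewrite /eucl_dist subrr dotpE big1 ?sqrtr0// => i _; rewrite mxE mul0r. Qed.

Lemma coord_le_eucl_dist p (x y : 'rV[R]_p) i :
  `|x ord0 i - y ord0 i| <= eucl_dist x y.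
Proof.
rewrite -sqrtr_sqr /eucl_dist ler_wsqrtr// dotpE (bigD1 i)//= !mxE -expr2 lerDl.
by rewrite sumr_ge0// => j _; rewrite -expr2 sqr_ge0.
Qed.

Lemma eucl_dist_le_sum p (x y : 'rV[R]_p) :
  eucl_dist x y <= \sum_i `|x ord0 i - y ord0 i|.
Proof.
have s0 (s : seq 'I_p) : 0 <= \sum_(i <- s) `|x ord0 i - y ord0 i|.
  by rewrite sumr_ge0.
rewrite -[leRHS]ger0_norm// -sqrtr_sqr ler_wsqrtr// dotpE.
elim: (index_enum _) => [|i s IH]; first by rewrite !big_nil expr0n.
rewrite !big_cons sqrrD -addrA lerD//.
  by rewrite !mxE -expr2 -normrX ger0_norm// sqr_ge0.
by rewrite -[leLHS]add0r lerD// mulrn_wge0// mulr_ge0.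
Qed.

Lemma diam_le p (E : set 'rV[R]_p) (D : R) :
  (diam E <= D%:E)%E <-> forall x y, E x -> E y -> eucl_dist x y <= D.
Proof.
split=> [H x y Ex Ey|H].
  rewrite -lee_fin; apply: le_trans H; apply: ereal_sup_ubound.
  by exists x => //; exists y.
by apply: ge_ereal_sup => _ [x Ex [y Ey <-]]; rewrite lee_fin; exact: H.
Qed.

Lemma diam_ge0 p (E : set 'rV[R]_p) : E !=set0 -> (0 <= diam E)%E.
Proof.
move=> [x Ex]; apply: ereal_sup_ubound; exists x => //; exists x => //.
by rewrite eucl_distxx.
Qed.

Lemma diam_set0 p : diam (@set0 'rV[R]_p) = -oo%E.
Proof.
rewrite /diam (_ : [set _ | x in _ & y in _] = set0) ?ereal_sup0//.
by apply/seteqP; split => // e [x []].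
Qed.

Lemma diam_real p (E : set 'rV[R]_p) delta : E !=set0 -> (diam E <= delta%:E)%E ->
  exists2 D : R, diam E = D%:E & 0 <= D <= delta.
Proof.
move=> /diam_ge0; case: (diam E) => [D| |]//.
by rewrite !lee_fin => D0 Dd; exists D => //; rewrite D0.
Qed.

Lemma Gamma_ge0 (s : R) : 0 <= Gamma s.
Proof.
by rewrite /Gamma; apply: Rintegral_ge0 => x _; rewrite mulr_ge0 ?powR_ge0 ?expR_ge0.
Qed.

Definition gauge_cst r : R := ball_volume r / 2 `^ r.

Lemma gauge_cst_ge0 r : 0 <= gauge_cst r.
Proof. by rewrite /gauge_cst divr_ge0 ?powR_ge0// divr_ge0 ?powR_ge0// Gamma_ge0. Qed.

Lemma hausdorff_gauge0 p r : hausdorff_gauge r (@set0 'rV[R]_p) = 0%E.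
Proof. by rewrite /hausdorff_gauge eqxx. Qed.

Lemma hausdorff_gaugeE p r (E : set 'rV[R]_p) (D : R) : E !=set0 -> diam E = D%:E ->
  hausdorff_gauge r E = (gauge_cst r * D `^ r)%:E.
Proof.
by move=> /set0P/negbTE E0 ED; rewrite /hausdorff_gauge E0 ED poweR_EFin -EFinM.
Qed.

Lemma hausdorff_gauge_ge0 p r (E : set 'rV[R]_p) : (0 <= hausdorff_gauge r E)%E.
Proof.
rewrite /hausdorff_gauge; case: ifP => // _.
by rewrite mule_ge0 ?poweR_ge0// lee_fin gauge_cst_ge0.
Qed.

(* Content as the library's outer extension of a set function defined on all
   subsets: admissibility of a cover is encoded by the value +oo. *)
Definition discreteV p := g_sigma_algebraType (@setT (set 'rV[R]_p)).

Definition small_gauge p r delta (E : set (discreteV p)) : \bar R :=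
  if (diam (E : set 'rV[R]_p) <= delta%:E)%E then hausdorff_gauge r E else +oo%E.

Lemma small_gauge0 p r delta : small_gauge r delta (@set0 (discreteV p)) = 0%E.
Proof. by rewrite /small_gauge diam_set0 leNye hausdorff_gauge0. Qed.

Lemma small_gauge_ge0 p r delta (E : set (discreteV p)) : (0 <= small_gauge r delta E)%E.
Proof. by rewrite /small_gauge; case: ifP => // _; exact: hausdorff_gauge_ge0. Qed.

Lemma hausdorff_contentE p r delta (A : set 'rV[R]_p) :
  hausdorff_content r delta A = mu_ext (@small_gauge p r delta) A.
Proof.
apply/eqP; rewrite eq_le; apply/andP; split; apply: le_ereal_inf_tmp.
  move=> _ [F [_ AF] <-].
  have [Fd|] := pselect (forall i, (diam (F i : set 'rV[R]_p) <= delta%:E)%E).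
    apply: ereal_inf_lbound; exists F => //.
    by apply: eq_eseriesr => i _; rewrite /small_gauge Fd.
  move=> /existsNP[i /negP/negbTE Fi].
  rewrite (@eseries_pinfty _ _ xpredT i) ?leey//; last by rewrite /small_gauge Fi.
  by move=> n _; rewrite -ltNye (lt_le_trans _ (small_gauge_ge0 _ _ _)).
move=> _ [F [AF Fd] <-]; apply: ereal_inf_lbound; exists F.
  by split => // i; apply: sub_sigma_algebra.
by apply: eq_eseriesr => i _; rewrite /small_gauge Fd.
Qed.

Lemma hausdorff_content_ge0 p r delta (A : set 'rV[R]_p) :
  (0 <= hausdorff_content r delta A)%E.
Proof. by rewrite hausdorff_contentE mu_ext_ge0// => ?; exact: small_gauge_ge0. Qed.

Lemma hausdorff_content_le p r delta (A B : set 'rV[R]_p) : A `<=` B ->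
  (hausdorff_content r delta A <= hausdorff_content r delta B)%E.
Proof. by move=> AB; rewrite !hausdorff_contentE; exact: le_mu_ext. Qed.

Lemma hausdorff_content_anti p r (d1 d2 : R) (A : set 'rV[R]_p) : d1 <= d2 ->
  (hausdorff_content r d2 A <= hausdorff_content r d1 A)%E.
Proof.
move=> d12; apply: ereal_inf_le_tmp => _ [F [AF Fd] <-]; exists F => //; split => // i.
by apply: le_trans (Fd i) _; rewrite lee_fin.
Qed.

Lemma hausdorff_content0 p r delta : hausdorff_content r delta (@set0 'rV[R]_p) = 0%E.
Proof.
rewrite hausdorff_contentE mu_ext0//; first exact: small_gauge0.
by move=> ?; exact: small_gauge_ge0.
Qed.

Lemma hausdorff_content_sigma_subadditive p r delta :
  sigma_subadditive (@hausdorff_content R p r delta).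
Proof.
move=> F; rewrite hausdorff_contentE.
apply: (le_trans (mu_ext_sigma_subadditive (@small_gauge_ge0 p r delta) F)).
by apply: lee_nneseries => i *; rewrite -hausdorff_contentE// hausdorff_content_ge0.
Qed.

HB.instance Definition _ p r delta := isOuterMeasure.Build R 'rV[R]_p
  (@hausdorff_content R p r delta)
  (hausdorff_content0 p r delta) (@hausdorff_content_ge0 p r delta)
  (@hausdorff_content_le p r delta) (@hausdorff_content_sigma_subadditive p r delta).

Lemma hausdorff_content_le_measure p r delta (A : set 'rV[R]_p) : 0 < delta ->
  (hausdorff_content r delta A <= hausdorff_measure r A)%E.
Proof. by move=> d0; apply: ereal_sup_ubound; exists delta. Qed.

Lemma hausdorff_measure_ge0 p r (A : set 'rV[R]_p) : (0 <= hausdorff_measure r A)%E.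
Proof.
apply: le_trans (hausdorff_content_le_measure r A (@ltr01 R)).
exact: hausdorff_content_ge0.
Qed.

Lemma hausdorff_measure_le p r (A B : set 'rV[R]_p) : A `<=` B ->
  (hausdorff_measure r A <= hausdorff_measure r B)%E.
Proof.
move=> AB; apply: ge_ereal_sup => _ [delta d0 <-].
apply: le_trans (hausdorff_content_le_measure r B d0).
exact: hausdorff_content_le.
Qed.

Lemma hausdorff_measure0 p r : hausdorff_measure r (@set0 'rV[R]_p) = 0%E.
Proof.
apply/eqP; rewrite eq_le hausdorff_measure_ge0 andbT.
by apply: ge_ereal_sup => _ [delta d0 <-]; rewrite hausdorff_content0.
Qed.

Lemma hausdorff_measure_sigma_subadditive p r :
  sigma_subadditive (@hausdorff_measure R p r).
Proof.
move=> F; apply: ge_ereal_sup => _ [delta d0 <-].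
apply: le_trans (hausdorff_content_sigma_subadditive r delta F) _.
apply: lee_nneseries => i *; first exact: hausdorff_content_ge0.
exact: hausdorff_content_le_measure.
Qed.

HB.instance Definition _ p r := isOuterMeasure.Build R 'rV[R]_p
  (@hausdorff_measure R p r)
  (hausdorff_measure0 p r) (@hausdorff_measure_ge0 p r)
  (@hausdorff_measure_le p r) (@hausdorff_measure_sigma_subadditive p r).

Lemma hausdorff_content_le_gauge p r delta (A : set 'rV[R]_p) :
  (diam A <= delta%:E)%E -> (hausdorff_content r delta A <= hausdorff_gauge r A)%E.
Proof.
move=> Ad; apply: ereal_inf_lbound.
exists (fun i => if i == 0%N then A else set0).
  split => [x Ax|i]; first by exists 0%N.
  by case: ifP => // _; rewrite diam_set0 leNye.
rewrite nneseries_recl//; last by move=> *; exact: hausdorff_gauge_ge0.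
rewrite eqxx eseries0 ?adde0// => i i0 _.
by rewrite gtn_eqF// hausdorff_gauge0.
Qed.

(** A cover at scale [delta / L] is mapped to one at scale [delta]. Scaling, translation and the
    comparison of a layer with its projection all go through this lemma. *)
Lemma hausdorff_lipschitz p m (f : 'rV[R]_p -> 'rV[R]_m) (A : set 'rV[R]_p) (L r : R) :
  0 < L -> 0 <= r -> (forall x y, eucl_dist (f x) (f y) <= L * eucl_dist x y) ->
  (hausdorff_measure r (f @` A) <= (L `^ r)%:E * hausdorff_measure r A)%E.
Proof.
move=> L0 r0 Lf; apply: ge_ereal_sup => _ [delta d0 <-].
have dL : 0 < delta / L by rewrite divr_gt0.
have Lr0 : 0 < L `^ r by rewrite powR_gt0.
apply: (@le_trans _ _ ((L `^ r)%:E * hausdorff_content r (delta / L) A)%E); last first.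
  by rewrite lee_pmul2l// hausdorff_content_le_measure.
rewrite -lee_pdivrMl//; apply: le_ereal_inf_tmp => _ [F [AF Fd] <-].
rewrite lee_pdivrMl//.
have dimg i : (diam (f @` F i) <= delta%:E)%E.
  apply/diam_le => _ _ [x Fx <-] [y Fy <-]; apply: le_trans (Lf x y) _.
  by rewrite mulrC -ler_pdivlMr//; exact: (diam_le (F i) _).1 (Fd i) _ _ Fx Fy.
apply: (@le_trans _ _ (\sum_(0 <= i <oo) hausdorff_gauge r (f @` F i))%E).
  apply: ereal_inf_lbound; exists (fun i => f @` F i) => //; split => //.
  by move=> _ [x /AF[i _ Fx] <-]; exists i => //; exists x.
rewrite -nneseriesZl; last by move=> *; exact: hausdorff_gauge_ge0.
apply: lee_nneseries => i *; first exact: hausdorff_gauge_ge0.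
have [->|/set0P F0] := eqVneq (F i) set0; first by rewrite image_set0 !hausdorff_gauge0 mule0.
have [D DE /andP[D0 _]] := diam_real F0 (Fd i).
have F0' : f @` F i !=set0 by case: F0 => x Fx; exists (f x), x.
have [D' DE' /andP[D'0 _]] := diam_real F0' (dimg i).
rewrite (hausdorff_gaugeE _ F0 DE) (hausdorff_gaugeE _ F0' DE') -EFinM lee_fin.
rewrite mulrCA ler_wpM2l ?gauge_cst_ge0// -powRM ?(ltW L0)//.
have DD : D' <= L * D.
  rewrite -lee_fin -DE'; apply/diam_le => _ _ [x Fx <-] [y Fy <-].
  apply: le_trans (Lf x y) _; rewrite ler_pM2l//.
  by apply: (diam_le (F i) D).1 => //; rewrite DE.
by apply: ge0_ler_powR; rewrite ?nnegrE// mulr_ge0// ltW.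
Qed.

(** A set of diameter below 1 cannot meet both [A] and [B], so every cover splits into a cover of
    each. *)
Lemma hausdorff_content_separated p r delta (A B : set 'rV[R]_p) :
  delta < 1 -> (forall x y, A x -> B y -> 1 <= eucl_dist x y) ->
  (hausdorff_content r delta A + hausdorff_content r delta B
    <= hausdorff_content r delta (A `|` B))%E.
Proof.
move=> d1 sep; apply: le_ereal_inf_tmp => _ [F [AF Fd] <-].
pose FA (X : set 'rV[R]_p) i := if `[< F i `&` X !=set0 >] then F i else set0.
have cover X : X `<=` A `|` B -> (hausdorff_content r delta X <=
    \sum_(0 <= i <oo) hausdorff_gauge r (FA X i))%E.
  move=> XAB; apply: ereal_inf_lbound; exists (FA X) => //; split => [x Xx|i].
    have [i _ Fx] := AF _ (XAB _ Xx); exists i => //.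
    by rewrite /FA asboolT//; exists x.
  by rewrite /FA; case: ifP => // _; rewrite diam_set0 leNye.
apply: (@le_trans _ _ (\sum_(0 <= i <oo) hausdorff_gauge r (FA A i) +
    \sum_(0 <= i <oo) hausdorff_gauge r (FA B i))%E).
  by apply: leeD; apply: cover => x; [left|right].
rewrite -nneseriesD; [|by move=> *; exact: hausdorff_gauge_ge0..].
apply: lee_nneseries => i *; first by rewrite adde_ge0 ?hausdorff_gauge_ge0.
rewrite /FA; case: asboolP => [[x [Fx Ax]]|_]; last first.
  rewrite hausdorff_gauge0 add0e; case: ifP => // _.
  by rewrite hausdorff_gauge0 hausdorff_gauge_ge0.
case: asboolP => [[y [Fy By]]|_]; last by rewrite hausdorff_gauge0 adde0.
have := le_lt_trans (le_trans (sep _ _ Ax By) ((diam_le (F i) delta).1 (Fd i) _ _ Fx Fy)) d1.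
by rewrite ltxx.
Qed.

Lemma hausdorff_measure_separated p r (A B : set 'rV[R]_p) :
  (forall x y, A x -> B y -> 1 <= eucl_dist x y) ->
  (hausdorff_measure r A + hausdorff_measure r B <= hausdorff_measure r (A `|` B))%E.
Proof.
move=> sep; have [->|HB] := eqVneq (hausdorff_measure r (A `|` B)) +oo%E.
  by rewrite leey.
have HABf : hausdorff_measure r (A `|` B) \is a fin_num.
  by rewrite ge0_fin_numE ?hausdorff_measure_ge0// ltey.
have HAf : hausdorff_measure r A \is a fin_num.
  rewrite ge0_fin_numE ?hausdorff_measure_ge0//.
  by apply: le_lt_trans (hausdorff_measure_le r (@subsetUl _ A B)) _; rewrite ltey.
rewrite -leeBrDl//; apply: ge_ereal_sup => _ [d2 d20 <-].
rewrite leeBrDl// -leeBrDr; last first.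
  rewrite ge0_fin_numE ?hausdorff_content_ge0//.
  apply: le_lt_trans (hausdorff_content_le_measure r B d20) _.
  by apply: le_lt_trans (hausdorff_measure_le r (@subsetUr _ A B)) _; rewrite ltey.
apply: ge_ereal_sup => _ [d1 d10 <-].
have Bf : hausdorff_content r d2 B \is a fin_num.
  rewrite ge0_fin_numE ?hausdorff_content_ge0//.
  apply: le_lt_trans (hausdorff_content_le_measure r B d20) _.
  by apply: le_lt_trans (hausdorff_measure_le r (@subsetUr _ A B)) _; rewrite ltey.
rewrite leeBrDr//.
(* The two suprema are approached at unrelated scales; a common smaller scale below 1 only increases
   both contents. *)
pose delta := Num.min (Num.min d1 d2) (1 / 2).
have delta0 : 0 < delta by rewrite !lt_min d10 d20/=; lra.
apply: le_trans (hausdorff_content_le_measure r (A `|` B) delta0).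
have delta1 : delta < 1 by rewrite gt_min; apply/orP; right; lra.
apply: le_trans (hausdorff_content_separated r delta1 sep).
by apply: leeD; apply: hausdorff_content_anti; rewrite !ge_min lexx ?orbT.
Qed.

(* The constant has gauge_cst r' + 1 instead of gauge_cst r' to make it positive. *)
Lemma hausdorff_content_dim p (r r' delta : R) (A : set 'rV[R]_p) :
  0 < delta -> 0 <= r -> r < r' -> 0 < gauge_cst r ->
  (hausdorff_content r' delta A <=
   ((gauge_cst r' + 1) / gauge_cst r * delta `^ (r' - r))%:E *
   hausdorff_content r delta A)%E.
Proof.
move=> d0 r0 rr' k0; set K := _ * delta `^ (r' - r).
have k'0 := gauge_cst_ge0 r'.
have K0 : 0 < K by rewrite mulr_gt0 ?powR_gt0// divr_gt0//; lra.
rewrite -lee_pdivrMl//; apply: le_ereal_inf_tmp => _ [F [AF Fd] <-].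
rewrite lee_pdivrMl//.
apply: (@le_trans _ _ (\sum_(0 <= i <oo) hausdorff_gauge r' (F i))%E).
  by apply: ereal_inf_lbound; exists F.
rewrite -nneseriesZl; last by move=> *; exact: hausdorff_gauge_ge0.
apply: lee_nneseries => i *; first exact: hausdorff_gauge_ge0.
have [->|/set0P F0] := eqVneq (F i) set0; first by rewrite !hausdorff_gauge0 mule0.
have [D DE /andP[D0 Dd]] := diam_real F0 (Fd i).
rewrite !(hausdorff_gaugeE _ F0 DE) -EFinM lee_fin /K.
have -> : (gauge_cst r' + 1) / gauge_cst r * delta `^ (r' - r) * (gauge_cst r * D `^ r) =
   (gauge_cst r' + 1) * (D `^ r * delta `^ (r' - r)) by field; rewrite gt_eqF.
have -> : D `^ r' = D `^ r * D `^ (r' - r).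
  by rewrite -powRD ?subrKC//; apply/implyP => /eqP; lra.
apply: ler_pM => //; first by rewrite mulr_ge0 ?powR_ge0.
  by rewrite lerDl.
rewrite ler_wpM2l ?powR_ge0//; apply: ge0_ler_powR; rewrite ?nnegrE//; [lra|exact: ltW].
Qed.
End Hausdorff.

(** * Outer measures proportional to volume on cubes are so on compact sets *)

Section CubeUniqueness.
Context {R : realType}.
Local Notation borelV := (@borelV R).
Implicit Types (d N : nat).

Definition cube d (x : 'rV[R]_d) (s : R) : set (borelV d) :=
  [set y | forall i, x ord0 i <= y ord0 i < x ord0 i + s].

Lemma cubeE d (x : 'rV[R]_d) s :
  cube x s = [set y | forall i, `[x ord0 i, x ord0 i + s[%classic (y ord0 i)].
Proof. by apply/seteqP; split => y H i; have := H i; rewrite /= in_itv. Qed.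

Lemma measurable_cube d (x : 'rV[R]_d) s : measurable (cube x s).
Proof.
rewrite cubeE.
apply: (@measurable_rect R d (fun i => `[x ord0 i, x ord0 i + s[%classic)) => i.
exact: measurable_itv.
Qed.

Lemma vol_cube d (x : 'rV[R]_d) s : 0 < s -> vol d (cube x s) = (s ^+ d)%:E.
Proof.
move=> s0; rewrite cubeE.
apply: (@vol_rect _ _ (fun i => `[x ord0 i, x ord0 i + s[%classic)) => i.
  exact: measurable_itv.
rewrite -[LHS]/(lebesgue_measure (`[x ord0 i, x ord0 i + s[%classic : set R)).
by rewrite lebesgue_measure_itv/= lte_fin ltrDl s0 -EFinB addrC addKr.
Qed.

Definition dyadic_index d N (x : 'rV[R]_d) : {ffun 'I_d -> int} :=
  [ffun i => Num.floor (2 ^+ N * x ord0 i)].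

Definition dyadic_cell d N (c : {ffun 'I_d -> int}) : set (borelV d) :=
  [set x | dyadic_index N x = c].

Lemma dyadic_cellE d N (c : {ffun 'I_d -> int}) :
  dyadic_cell N c = cube (\row_i ((c i)%:~R / 2 ^+ N)) (2 ^- N).
Proof.
have p0 : 0 < 2 ^+ N :> R by rewrite exprn_gt0.
have E (x : 'rV[R]_d) i : (dyadic_index N x i == c i) =
    ((c i)%:~R / 2 ^+ N <= x ord0 i < (c i)%:~R / 2 ^+ N + 2 ^- N).
  have -> : (c i)%:~R / 2 ^+ N + 2 ^- N = ((c i)%:~R + 1) / 2 ^+ N :> R by rewrite mulrDl mul1r.
  by rewrite ffunE floor_eq intrD ler_pdivrMr// ltr_pdivlMr// [x ord0 i * _]mulrC.
apply/seteqP; split => x /=.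
  by move=> xc i; rewrite mxE -E xc.
by move=> H; apply/ffunP => i; apply/eqP; rewrite E; have := H i; rewrite mxE.
Qed.

(** Nesting of dyadic cells: the floor of 2b determines the floor of b. *)
Lemma dyadic_index_leS d N (x y : 'rV[R]_d) :
  dyadic_index N.+1 x = dyadic_index N.+1 y -> dyadic_index N x = dyadic_index N y.
Proof.
move=> /ffunP H; apply/ffunP => i; rewrite !ffunE; have := H i; rewrite !ffunE exprS -!mulrA.
move: (2 ^+ N * x ord0 i) (2 ^+ N * y ord0 i) => a b /eqP.
rewrite floor_eq => /andP[H1 H2]; apply/eqP; rewrite floor_eq.
have := floor_itv b; have := floor_itv (2 * b); rewrite !intrD.
set n := Num.floor b; set m := Num.floor (2 * b) => /andP[H3 H4] /andP[H5 H6].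
rewrite intrD in H2.
have H7 : (n * 2)%:~R <= 2 * b by rewrite intrM; lra.
have H8 : 2 * b < (n * 2 + 2)%:~R by rewrite intrD intrM; lra.
have H9 : n * 2 <= m by rewrite floor_ge_int.
have H10 : m < n * 2 + 2 by rewrite floor_lt_int.
have H11 : (n * 2)%:~R <= m%:~R :> R by rewrite ler_int.
have H12 : m + 1 <= n * 2 + 2 by rewrite lezD1.
have H13 : (m + 1)%:~R <= (n * 2 + 2)%:~R :> R by rewrite ler_int.
rewrite !intrD !intrM in H11 H13; apply/andP; split; lra.
Qed.

Lemma dyadic_index_le d N M (x y : 'rV[R]_d) : (M <= N)%N ->
  dyadic_index N x = dyadic_index N y -> dyadic_index M x = dyadic_index M y.
Proof.
elim: N => [|N IH]; first by rewrite leqn0 => /eqP ->.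
by rewrite leq_eqVlt ltnS => /predU1P[->//|MN /dyadic_index_leS]; exact: IH.
Qed.

(** Weaker than open: it also holds for a half-open cube with integral corners minus a compact set,
    which is needed for the lower bound. *)
Definition dyadic_open d (U : set (borelV d)) :=
  forall x, U x -> exists N, dyadic_cell N (dyadic_index N x) `<=` U.

Lemma dyadic_index_close d N (x y : 'rV[R]_d) i :
  dyadic_index N x = dyadic_index N y -> `|x ord0 i - y ord0 i| < 2 ^- N.
Proof.
move=> E; have : dyadic_cell N (dyadic_index N y) x by [].
have : dyadic_cell N (dyadic_index N y) y by [].
rewrite dyadic_cellE => /(_ i) /andP[H1 H2] /(_ i) /andP[H3 H4].
rewrite ltr_norml; apply/andP; split; lra.
Qed.

Lemma pow2_inv_small (e : R) : 0 < e -> exists N, 2 ^- N < e.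
Proof.
move=> e0; have [N] := ltr_add_invr e0; rewrite add0r => NE; exists N.
apply: le_lt_trans NE; rewrite lef_pV2 ?posrE ?exprn_gt0//.
by rewrite -natrX ler_nat ltn_expl.
Qed.

Lemma open_dyadic_open d (U : set 'rV[R]_d) : open U -> dyadic_open (U : set (borelV d)).
Proof.
move=> oU x Ux; have : nbhs (x : 'rV[R]_d) U by exact: open_nbhs_nbhs.
move=> /nbhs_ballP[e /= e0 eU]; have [N Ne] := pow2_inv_small e0.
exists N => y /= Ey; apply: eU; apply/ballVP => // i.
by apply: lt_trans Ne; apply: dyadic_index_close.
Qed.

(** Either empty or a maximal dyadic cell inside [U]; by nesting, the nonempty ones partition a
    [dyadic_open] set. *)
Definition max_cell d (U : set (borelV d)) N c : set (borelV d) :=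
  [set x | [/\ dyadic_index N x = c, dyadic_cell N c `<=` U &
    forall M, (M < N)%N -> ~ dyadic_cell M (dyadic_index M x) `<=` U]].

Lemma max_cellP d (U : set (borelV d)) N c :
  max_cell U N c = set0 \/ max_cell U N c = dyadic_cell N c.
Proof.
have [->|/set0P[x [xc cU H]]] := eqVneq (max_cell U N c) set0; [by left|right].
apply/seteqP; split => [y []//|y yc]; split => // M MN.
rewrite (_ : dyadic_index M y = dyadic_index M x); first exact: H.
by apply: (dyadic_index_le (ltnW MN)); rewrite xc yc.
Qed.

Variables (d : nat) (phi : {outer_measure set 'rV[R]_d -> \bar R}) (kappa : R).
Hypotheses (kappa0 : 0 < kappa)
  (phi_cube : forall x s, 0 < s -> phi (cube x s) = (kappa * s ^+ d)%:E).

(** On the countable partition of [U] into maximal cells, [phi] is subadditive, volume is additive,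
    and they are proportional on each cell. *)
Lemma phi_dyadic_open (U : set (borelV d)) : dyadic_open U ->
  measurable U /\ (phi U <= kappa%:E * vol d U)%E.
Proof.
move=> dU; pose T : countType := (nat * {ffun 'I_d -> int})%type.
pose F n : set (borelV d) :=
  if (pickle_inv n : option T) is Some i then max_cell U i.1 i.2 else set0.
have mF n : measurable (F n).
  rewrite /F; case: pickle_inv => [[N c]|//] /=.
  by have [->//|->] := max_cellP U N c; rewrite dyadic_cellE; exact: measurable_cube.
have UF : U = \bigcup_n F n.
  apply/seteqP; split => [x Ux|x [n _]]; last first.
    by rewrite /F; case: pickle_inv => [[N c] [xc cU _]|//]; exact: cU.
  have exN : exists N, `[< dyadic_cell N (dyadic_index N x) `<=` U >].
    by have [N NU] := dU x Ux; exists N; exact/asboolP.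
  case: (ex_minnP exN) => N /asboolP NU Nmin.
  exists (pickle ((N, dyadic_index N x) : T)) => //; rewrite /F pickleK_inv/=.
  by split => // M MN /asboolP/Nmin; rewrite leqNgt MN.
have tF : trivIset setT F.
  apply/trivIsetP => n m _ _ nm; apply/seteqP; split => // x [].
  rewrite /F; have := pickle_invK (T := T) n; case: pickle_inv => [[N c] /= En|//].
  have := pickle_invK (T := T) m; case: pickle_inv => [[N' c'] /= Em|//].
  move=> [xc cU H] [xc' cU' H'].
  have NN' : N = N'.
    have [NN'|NN'|//] := ltngtP N N'.
      by have := H' _ NN'; rewrite xc.
    by have := H _ NN'; rewrite xc'.
  move/eqP: nm; apply; rewrite -En -Em; congr (pickle (_ : T)).
  by rewrite -xc -xc' NN'.
have mU : measurable U by rewrite UF; exact: bigcupT_measurable.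
split => //.
have -> : vol d U = (\sum_(0 <= n <oo) vol d (F n))%E.
  by rewrite {1}UF measure_semi_bigcup//; rewrite -UF.
rewrite {1}UF; apply: (le_trans (outer_measure_sigma_subadditive phi F)).
rewrite -nneseriesZl//; apply: lee_nneseries => n *; first exact: outer_measure_ge0.
rewrite /F; case: pickle_inv => [[N c]|] /=; last by rewrite outer_measure0 measure0 mule0.
have [->|->] := max_cellP U N c; first by rewrite outer_measure0 measure0 mule0.
have p0 : 0 < 2 ^- N :> R by rewrite invr_gt0 exprn_gt0.
by rewrite dyadic_cellE phi_cube// vol_cube.
Qed.

(** The open 1/(m+1)-neighbourhoods of [K] decrease to [K] and have finite volume. *)
Lemma phi_compact_le (K : set 'rV[R]_d) : compact K -> (phi K <= kappa%:E * vol d K)%E.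
Proof.
move=> cK; have clK : closed K by apply: compact_closed => //; exact: norm_hausdorff.
have [r Kr] := compact_boundedV cK.
pose U m : set 'rV[R]_d := \bigcup_(y in K) ball y m.+1%:R^-1.
have m0 m : 0 < m.+1%:R^-1 :> R by rewrite invr_gt0.
have oU m : open (U m) by apply: bigcup_open => y _; exact: ball_open.
have mU m : measurable (U m : set (borelV d)) by exact: open_measurableV.
have KU m : K `<=` U m by move=> y Ky; exists y => //; exact: ballxx.
have capU : \bigcap_m U m = K.
  apply/seteqP; split => [x Ux|x Kx m _]; last exact: KU.
  apply: clK => B /nbhs_ballP[e /= e0 eB].
  have [m] := ltr_add_invr e0; rewrite add0r => me.
  have [y Ky /ball_sym xy] := Ux m I; exists y; split => //.
  by apply: eB; apply: le_ball xy; exact: ltW.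
have cv : (vol d \o U) m @[m --> \oo] --> vol d (\bigcap_m (U m : set (borelV d))).
  apply: nonincreasing_cvg_mu => //.
  - apply: (@vol_lty _ _ _ (r + 1)) => // x [y Ky /ballVP -/(_ (m0 0%N)) xy] i.
    have := Kr _ Ky i; have := xy i; rewrite invr1.
    have := ler_distD 0 (x ord0 i) 0; move=> _ H1 H2.
    have : `|x ord0 i| <= `|x ord0 i - y ord0 i| + `|y ord0 i|.
      by rewrite -{1}(subrK (y ord0 i) (x ord0 i)) ler_normD.
    by rewrite distrC; lra.
  - by apply: bigcapT_measurable.
  - apply/nonincreasing_seqP => m; apply/subsetPset => x [y Ky xy]; exists y => //.
    by apply: le_ball xy; rewrite lef_pV2 ?posrE// ler_nat.
rewrite -lee_pdivrMl// -{2}capU -(cvg_lim _ cv)//.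
apply: lime_ge; first by apply/cvg_ex; eexists; exact: cv.
apply: nearW => m /=; rewrite lee_pdivrMl//.
have [_ H] := phi_dyadic_open (open_dyadic_open (oU m)).
by apply: le_trans H; exact: le_outer_measure (KU m).
Qed.

(** The lower bound comes from the complement in a large cube [Q]: [phi] is exact on [Q],
    subadditive, and bounded above on what [K] leaves of [Q]. *)
Theorem phi_compact (K : set 'rV[R]_d) : compact K -> phi K = (kappa%:E * vol d K)%E.
Proof.
move=> cK; apply/eqP; rewrite eq_le phi_compact_le//=.
have clK : closed K by apply: compact_closed => //; exact: norm_hausdorff.
have [r Kr] := compact_boundedV cK.
pose L : nat := (Num.truncn `|r|).+1.
have rL : r < L%:R by apply: le_lt_trans (ler_norm _) _; exact: truncnS_gt.
have L0 : 0 < 2 * L%:R :> R by rewrite mulr_gt0// ltr0n.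
pose Q := cube (const_mx (- L%:R) : 'rV[R]_d) (2 * L%:R).
have KQ : K `<=` Q.
  move=> x /Kr H i; have := H i; rewrite mxE ler_norml => /andP[]; lra.
have mK : measurable (K : set (borelV d)) by exact: compact_measurableV.
have mQ : measurable Q by exact: measurable_cube.
(* The corners of [Q] are integral, so a cell of any level that meets [Q] stays inside it. *)
have dW : dyadic_open (Q `\` K).
  move=> x [Qx Kx].
  have [N HN] := open_dyadic_open (closed_openC clK) Kx.
  exists N => y Ey; split; last exact: HN.
  have E0 : dyadic_index 0 y = dyadic_index 0 x by exact: (dyadic_index_le (leq0n N)).
  move=> i; have := Qx i; rewrite !mxE.
  have /ffunP/(_ i) := E0; rewrite !ffunE expr0 !mul1r => /eqP.
  rewrite floor_eq => /andP[H1 H2] /andP[H3 H4].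
  have -> : - L%:R + 2 * L%:R = L%:R :> R by ring.
  have H5 : - L%:Z <= Num.floor (x ord0 i) by rewrite floor_ge_int// intrN.
  have H6 : Num.floor (x ord0 i) < L%:Z 
    by rewrite floor_lt_int//; move: H4; rewrite -[L%:Z%:~R]/(L%:R : R); lra.
  have H7 : (- L%:Z)%:~R <= (Num.floor (x ord0 i))%:~R :> R by rewrite ler_int.
  have H8 : (Num.floor (x ord0 i) + 1)%:~R <= L%:Z%:~R :> R by rewrite ler_int lezD1.
  rewrite intrN in H7; apply/andP; split; [exact: le_trans H7 H1|exact: lt_le_trans H2 H8].
have [mW W] := phi_dyadic_open dW.
have QE : phi Q = (kappa%:E * vol d Q)%E by rewrite phi_cube// vol_cube.
have finQ : vol d Q \is a fin_num by rewrite vol_cube.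
have finK : vol d K \is a fin_num by exact: vol_fin Kr.
have volW : vol d (Q `\` K) = (vol d Q - vol d K)%E.
  rewrite measureD//; first by rewrite setIidr.
  by rewrite ltey_eq finQ.
have : (phi Q <= phi K + kappa%:E * vol d (Q `\` K))%E.
  apply: le_trans (leeD (lexx _) W).
  by rewrite -[X in phi X](setDUK KQ); exact: outer_measureU2.
have fphi : phi K \is a fin_num.
  rewrite ge0_fin_numE ?outer_measure_ge0//.
  apply: le_lt_trans (phi_compact_le cK) _.
  by rewrite -(fineK finK) -EFinM ltry.
rewrite QE volW -(fineK finQ) -(fineK finK) -(fineK fphi) -EFinB -!EFinM -EFinD !lee_fin.
lra.
Qed.
End CubeUniqueness.

(** * Positivity of the gauge constants *)

Section GammaPositive.
Context {R : realType}.
Local Notation mu := (@lebesgue_measure R).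
Local Notation GR := (measurableTypeR R).

(* [fine] sends an infinite integral to 0, so finiteness has to be proved too. *)
Lemma Gamma_gt0 (s : R) : 1 <= s -> 0 < Gamma s.
Proof.
move=> s1; pose a := s - 1; have a0 : 0 <= a by rewrite subr_ge0.
pose b := a + 1; have b0 : 0 < b by rewrite /b; lra.
pose f (t : R) := t `^ a * expR (- t).
pose D : set GR := `]0, +oo[%classic.
have mD : measurable D by exact: measurable_itv.
have f0 t : 0 <= f t by rewrite mulr_ge0 ?powR_ge0 ?expR_ge0.
have mf : measurable_fun D (fun t : GR => (f t)%:E).
  apply/measurable_EFinP; apply: measurable_funTS; apply: measurable_funM.
    exact: measurable_powR.
  by apply: measurableT_comp => //; exact: measurable_funN.
(* From ln t <= t/(2b) + ln (2b) and a <= b one gets t^a exp(-t) <= c exp(-t/2); [b] is [a + 1] so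
   that the division is safe when [a = 0]. *)
pose c := expR (a * ln (2 * b)) : R.
have h0 : 0 < 1 / 2 :> R by lra.
have up t : 0 < t -> f t <= c * 2 * exponential_pdf (1 / 2) t.
  move=> t0; rewrite (exponential_pdfE _ (ltW t0)) /f /powR gt_eqF// -expRD /c.
  have -> : expR (a * ln (2 * b)) * 2 * (1 / 2 * expR (- (1 / 2) * t)) =
    expR (a * ln (2 * b) + - (1 / 2) * t) by rewrite expRD; field.
  rewrite ler_expR.
  have b20 : 0 < 2 * b by lra.
  have tE : t = t / (2 * b) * (2 * b) by field; lra.
  have tb : 0 < t / (2 * b) by rewrite divr_gt0//; lra.
  have : ln t <= t / (2 * b) + ln (2 * b).
    have -> : ln t = ln (t / (2 * b)) + ln (2 * b) by rewrite -lnM ?posrE// -tE.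
    by rewrite lerD2r ltW// ln_sublinear.
  have H2 : a * (t / (2 * b)) <= t / 2.
    have -> : t / 2 = b * (t / (2 * b)) by field; lra.
    by apply: ler_wpM2r; [exact: ltW|rewrite /b lerDl].
  move=> H1; have H3 : a * ln t <= a * (t / (2 * b) + ln (2 * b)) by rewrite ler_wpM2l.
  lra.
have c0 : 0 <= c * 2 by rewrite mulr_ge0// expR_ge0.
have fin : (\int[mu]_(t in D) (f t)%:E < +oo)%E.
  apply: (@le_lt_trans _ _ ((c * 2)%:E * \int[mu]_t (exponential_pdf (1 / 2) t)%:E)%E); last first.
    by rewrite integral_exponential_pdf// mule1 ltry.
  rewrite -ge0_integralZl//; first last.
  - by move=> x _; rewrite lee_fin exponential_pdf_ge0// ltW.
  - by apply/measurable_EFinP; exact: measurable_exponential_pdf.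
  rewrite [leLHS]integral_mkcond. apply: ge0_le_integral => //.
  - by move=> x _; rewrite patchE; case: ifP => // _; rewrite lee_fin.
  - exact: (measurable_restrictT _ mD).1 mf.
  - apply: emeasurable_funM => //; apply/measurable_EFinP.
    exact: measurable_exponential_pdf.
  move=> x _; rewrite patchE -EFinM; case: ifPn => [|_].
    by rewrite inE/D/= in_itv/= andbT lee_fin; exact: up.
  by rewrite lee_fin mulr_ge0// exponential_pdf_ge0// ltW.
(* On [1, 2] the integrand is at least exp(-2). *)
have lo : ((expR (- 2))%:E <= \int[mu]_(t in D) (f t)%:E)%E.
  have -> : ((expR (- 2))%:E = \int[mu]_(t in (`[1%R, 2%R]%classic : set GR)) (expR (- 2))%:E)%E.
    rewrite integral_cst// -[LHS]mule1; congr (_ * _)%E.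
    rewrite -[RHS]/(mu (`[1%R, 2%R]%classic : set R)).
    rewrite lebesgue_measure_itv/= lte_fin ltr1n.
    by rewrite -EFinB; congr EFin; ring.
  apply: (@le_trans _ _ (\int[mu]_(t in (`[1%R, 2%R]%classic : set GR)) (f t)%:E)%E).
    apply: ge0_le_integral => //.
    - apply: measurable_funS mf => // x /=; rewrite /D/= !in_itv/= andbT => /andP[x1 _].
      exact: lt_le_trans x1.
    move=> x /=; rewrite in_itv/= => /andP[x1 x2]; rewrite lee_fin /f.
    rewrite -[leLHS]mul1r; apply: ler_pM => //; last by rewrite ler_expR lerN2.
    by rewrite -[leLHS](powRr0 x) ler_powR.
  apply: ge0_subset_integral => //.
  - by move=> x _; rewrite lee_fin.
  - move=> x /=; rewrite /D/= !in_itv/= andbT => /andP[x1 _].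
    exact: lt_le_trans x1.
rewrite /Gamma /Rintegral; apply: fine_gt0; rewrite fin andbT.
by apply: lt_le_trans lo; rewrite lte_fin expR_gt0.
Qed.

Lemma gauge_cst_gt0 (r : R) : 0 <= r -> 0 < gauge_cst r.
Proof.
move=> r0; rewrite divr_gt0 ?powR_gt0// divr_gt0 ?powR_gt0 ?pi_gt0//.
by rewrite Gamma_gt0//; lra.
Qed.
End GammaPositive.

(** * Hausdorff measure of cubes, layers and integer slices; Hausdorff dimension *)

Section HausdorffVolume.
Context {R : realType}.
Local Notation borelV := (@borelV R).
Implicit Types d N : nat.

Lemma eucl_dist_affine d (a : R) (b x y : 'rV[R]_d) : 0 <= a ->
  eucl_dist (a *: x + b) (a *: y + b) = a * eucl_dist x y.
Proof.
move=> a0; rewrite /eucl_dist.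
have -> : a *: x + b - (a *: y + b) = a *: (x - y).
  by rewrite opprD addrACA subrr addr0 -scalerBr.
by rewrite dotpZl dotpZr mulrA -expr2 sqrtrM ?sqr_ge0// sqrtr_sqr ger0_norm.
Qed.

Lemma hausdorff_affine_le d (a r : R) (b : 'rV[R]_d) (A : set 'rV[R]_d) : 0 < a -> 0 <= r ->
  (hausdorff_measure r ((fun x : 'rV[R]_d => (a *: x + b)%R) @` A)
    <= (a `^ r)%:E * hausdorff_measure r A)%E.
Proof.
by move=> a0 r0; apply: hausdorff_lipschitz => // x y; rewrite eucl_dist_affine// ltW.
Qed.

Lemma cube_affine d (x : 'rV[R]_d) s : 0 < s ->
  cube x s = (fun y : 'rV[R]_d => s *: y + x) @` cube 0 1.
Proof.
move=> s0; apply/seteqP; split => [y H|_ [y H <-] i]; last first.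
  have := H i; rewrite !mxE add0r => /andP[y0 y1].
  apply/andP; split; first by rewrite lerDr mulr_ge0// ltW.
  by rewrite addrC ltrD2l -[ltRHS]mulr1 ltr_pM2l.
exists (s^-1 *: (y - x)); last by rewrite scalerA divff ?gt_eqF// scale1r subrK.
move=> i; have := H i; rewrite !mxE add0r => /andP[y0 y1].
rewrite mulrC; apply/andP; split; first by rewrite divr_ge0 ?subr_ge0// ltW.
by rewrite ltr_pdivrMr// mul1r; lra.
Qed.

(** The Lipschitz bound for the similarity gives one inequality, that for its inverse the other. *)
Lemma hausdorff_cube d (r : R) (x : 'rV[R]_d) s : 0 < s -> 0 <= r ->
  hausdorff_measure r (cube x s) = ((s `^ r)%:E * hausdorff_measure r (@cube R d 0 1))%E.
Proof.
move=> s0 r0; rewrite (cube_affine x s0).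
apply/eqP; rewrite eq_le hausdorff_affine_le//=.
set Q := cube 0 1; set Q' := _ @` Q.
have sr0 : 0 < s `^ r by rewrite powR_gt0.
have QQ : Q = (fun y : 'rV[R]_d => s^-1 *: y + (- (s^-1 *: x))) @` Q'.
  apply/seteqP; split => [y Qy|_ [_ [y Qy <-] <-]].
    exists (s *: y + x); first by exists y.
    by rewrite scalerDr scalerA mulVf ?gt_eqF// scale1r addrK.
  by rewrite scalerDr scalerA mulVf ?gt_eqF// scale1r addrK.
have : (hausdorff_measure r Q <= ((s^-1) `^ r)%:E * hausdorff_measure r Q')%E.
  by rewrite {1}QQ; apply: hausdorff_affine_le; rewrite ?invr_gt0.
have -> : (s^-1) `^ r = (s `^ r)^-1.
  apply: (mulIf (lt0r_neq0 sr0)); rewrite mulVf ?gt_eqF//.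
  by rewrite -powRM ?invr_ge0 ?ltW// mulVf ?gt_eqF// powR1.
by rewrite -lee_pdivlMl ?invr_gt0// invrK.
Qed.

Lemma outer_measure_fin_subadditive (T I : Type) (phi : {outer_measure set T -> \bar R})
    (s : seq I) (A : I -> set T) :
  (phi (\big[setU/set0]_(i <- s) A i) <= \sum_(i <- s) phi (A i))%E.
Proof.
elim: s => [|i s IH]; first by rewrite !big_nil outer_measure0.
by rewrite !big_cons; apply: le_trans (outer_measureU2 _ _ _) _; exact: leeD.
Qed.

Lemma diam_cube d (x : 'rV[R]_d) s : 0 <= s -> (diam (cube x s) <= (d%:R * s)%:E)%E.
Proof.
move=> s0; apply/diam_le => y z Hy Hz; apply: le_trans (eucl_dist_le_sum y z) _.
apply: (@le_trans _ _ (\sum_(i < d) s)).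
  apply: ler_sum => i _; have /andP[y1 y2] := Hy i; have /andP[z1 z2] := Hz i.
  rewrite ler_norml; apply/andP; split; lra.
by rewrite sumr_const card_ord mulr_natl.
Qed.

(* Covering by N^d grid cubes of diameter at most d/N. *)
Lemma hausdorff_unit_cube_lty d :
  (hausdorff_measure d%:R (@cube R d 0 1) < +oo)%E.
Proof.
apply: (@le_lt_trans _ _ (gauge_cst (d%:R : R) * d%:R ^+ d)%:E); last exact: ltry.
apply: ge_ereal_sup => _ [delta d0 <-].
have [N0] : exists N, d%:R / N.+1%:R <= delta.
  have := @truncnS_gt R (d%:R / delta); set N := Num.truncn _ => H.
  exists N; rewrite ler_pdivrMr// mulrC -ler_pdivrMr//; exact: ltW.
set N := N0.+1 => Nd.
have N0R : 0 < N%:R :> R by rewrite ltr0n.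
pose A (c : {ffun 'I_d -> 'I_N}) : set 'rV[R]_d :=
  cube (\row_i ((c i)%:R / N%:R)) (N%:R^-1).
have cov : @cube R d 0 1 `<=` \big[setU/set0]_(c : {ffun 'I_d -> 'I_N}) A c.
  move=> x Hx; pose c : {ffun 'I_d -> 'I_N} := [ffun i => inord (Num.truncn (N%:R * x ord0 i))].
  rewrite -bigcup_seq; exists c => /=; first by rewrite mem_index_enum.
  move=> i; rewrite !mxE ffunE.
  have := Hx i; rewrite !mxE add0r => /andP[x0 x1].
  have Nx0 : 0 <= N%:R * x ord0 i by rewrite mulr_ge0.
  have /andP[t0 t1] := truncn_itv Nx0.
  rewrite inordK; last first.
    rewrite -(ltr_nat R); apply: le_lt_trans t0 _.
    by rewrite -[ltRHS]mulr1 ltr_pM2l.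
  have -> : forall n : nat, n%:R / N%:R + N%:R^-1 = n.+1%:R / N%:R :> R.
    by move=> n; rewrite -natr1 mulrDl mul1r.
  by rewrite ler_pdivrMr// ltr_pdivlMr// [x ord0 i * _]mulrC t0 t1.
have ds0 : 0 <= N%:R^-1 :> R by rewrite invr_ge0 ltW.
have gA c : (hausdorff_content d%:R delta (A c) <=
    (gauge_cst (d%:R : R) * (d%:R / N%:R) ^+ d)%:E)%E.
  have dA := @diam_cube d (\row_i ((c i)%:R / N%:R)) _ ds0.
  have dA' : (diam (A c) <= delta%:E)%E by apply: le_trans dA _; rewrite lee_fin.
  apply: le_trans (hausdorff_content_le_gauge _ dA') _.
  have [->|/set0P A0] := eqVneq (A c) set0.
    by rewrite hausdorff_gauge0 lee_fin mulr_ge0 ?gauge_cst_ge0 ?exprn_ge0 ?divr_ge0.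
  have [D DE /andP[D0 Dd]] := diam_real A0 dA.
  rewrite (hausdorff_gaugeE _ A0 DE) lee_fin ler_wpM2l ?gauge_cst_ge0//.
  by rewrite powR_mulrn// lerXn2r// nnegrE// (le_trans D0).
apply: le_trans (hausdorff_content_le _ _ cov) _.
apply: le_trans (outer_measure_fin_subadditive (@hausdorff_content R d d%:R delta) _ _) _.
apply: (@le_trans _ _ (\sum_(c : {ffun 'I_d -> 'I_N})
  (gauge_cst (d%:R : R) * (d%:R / N%:R) ^+ d)%:E)%E).
  by apply: lee_sum => c _; exact: gA.
rewrite sumEFin lee_fin sumr_const card_ffun !card_ord.
rewrite -[_ *+ (N ^ d)%N]mulr_natr natrX expr_div_n.
by rewrite le_eqVlt; apply/orP; left; apply/eqP; field; rewrite expf_neq0// gt_eqF.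
Qed.

(** Volume bounds the content from below: a set of diameter D lies in a box of side 2D, so any cover
    of the cube has total volume at least 1. *)
Lemma hausdorff_unit_cube_gt0 d : (0 < d)%N ->
  (0 < hausdorff_measure d%:R (@cube R d 0 1))%E.
Proof.
move=> d0; have g0 : 0 < gauge_cst (d%:R : R) by exact: gauge_cst_gt0.
apply: lt_le_trans (hausdorff_content_le_measure d%:R (cube 0 1) (@ltr01 R)).
(* The ratio of the box volume (2D)^d to the gauge of a set of diameter D. *)
pose K : R := 2 ^+ d / gauge_cst d%:R.
have K0 : 0 < K by rewrite divr_gt0// exprn_gt0.
apply: (@lt_le_trans _ _ (K^-1)%:E); first by rewrite lte_fin invr_gt0.
apply: le_ereal_inf_tmp => _ [F [QF Fd] <-].
rewrite -[leLHS]mule1 lee_pdivrMl// -nneseriesZl; last first.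
  by move=> *; exact: hausdorff_gauge_ge0.
have v1 : vol d (@cube R d 0 1) = 1%E by rewrite vol_cube// expr1n.
have HB i : exists B : set (borelV d), [/\ measurable B, F i `<=` B &
    (vol d B <= K%:E * hausdorff_gauge d%:R (F i))%E].
  have [F0|/set0P F0] := eqVneq (F i) set0.
    by exists set0; rewrite F0 measure0 hausdorff_gauge0 mule0; split.
  have [D DE /andP[D0 _]] := diam_real F0 (Fd i).
  have [x Fx] := F0.
  exists [set y : 'rV[R]_d | forall j, `[x ord0 j - D, x ord0 j + D]%classic (y ord0 j)]; split.
  - apply: (@measurable_rect R d (fun j => `[x ord0 j - D, x ord0 j + D]%classic)) => j.
    exact: measurable_itv.
  - move=> y Fy j /=; rewrite in_itv/= -ler_distl.
    apply: le_trans (coord_le_eucl_dist y x j) _.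
    by apply: (diam_le (F i) D).1 => //; rewrite DE.
  - rewrite (@vol_rect R d (fun j => `[x ord0 j - D, x ord0 j + D]%classic) (2 * D)); first last.
    + move=> j; rewrite -[LHS]/(lebesgue_measure (`[x ord0 j - D, x ord0 j + D]%classic : set R)).
      rewrite lebesgue_measure_itv/= lte_fin; case: ltP => H.
        by rewrite -EFinB; congr EFin; ring.
      by have -> : D = 0 by [lra]; rewrite mulr0.
    + by move=> j; exact: measurable_itv.
    rewrite (hausdorff_gaugeE _ F0 DE) -EFinM lee_fin powR_mulrn// exprMn /K.
    by rewrite le_eqVlt; apply/orP; left; apply/eqP; field; rewrite gt_eqF.
have [B HB'] := choice HB.
rewrite -v1; apply: le_trans (_ : _ <= \sum_(0 <= i <oo) vol d (B i))%E _.
  apply: measure_sigma_subadditive => //.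
  - by move=> i; have [] := HB' i.
  - exact: measurable_cube.
  - by move=> x /QF[i _ Fx]; exists i => //; have [_ + _] := HB' i; apply.
by apply: lee_nneseries => i *; have [_ _] := HB' i.
Qed.

Theorem hausdorff_compact d : (0 < d)%N -> exists2 kappa : R, 0 < kappa &
  forall K : set 'rV[R]_d, compact K ->
    hausdorff_measure d%:R K = (kappa%:E * vol d K)%E.
Proof.
move=> d0; have H0 := hausdorff_unit_cube_gt0 d0; have Hy := hausdorff_unit_cube_lty d.
have Hfin : hausdorff_measure d%:R (@cube R d 0 1) \is a fin_num.
  by rewrite ge0_fin_numE// ltW.
exists (fine (hausdorff_measure d%:R (@cube R d 0 1))); first by rewrite fine_gt0// H0.
apply: phi_compact; first by rewrite fine_gt0// H0.
move=> x s s0; rewrite [LHS]hausdorff_cube// EFinM fineK// muleC powR_mulrn//.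
exact: ltW.
Qed.

Lemma eucl_dist_consv d z (v w : 'rV[R]_d) :
  eucl_dist (consv (z, v)) (consv (z, w)) = eucl_dist v w.
Proof.
rewrite /eucl_dist !dotpE big_ord_recl !mxE unlift_none/= subrr mul0r add0r.
by congr Num.sqrt; apply: eq_bigr => i _; rewrite !mxE liftK.
Qed.

Lemma eucl_dist_tailv d (x y : 'rV[R]_d.+1) :
  eucl_dist (tailv x) (tailv y) <= eucl_dist x y.
Proof.
rewrite /eucl_dist ler_wsqrtr// !dotpE big_ord_recl -[leLHS]add0r lerD//.
  by rewrite -expr2 sqr_ge0.
by rewrite le_eqVlt; apply/orP; left; apply/eqP; apply: eq_bigr => i _; rewrite !mxE.
Qed.

(** Both the embedding at height [z] and its left inverse [tailv] are 1-Lipschitz. *)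
Lemma hausdorff_layer d (r z : R) (A : set 'rV[R]_d) : 0 <= r ->
  hausdorff_measure r ((fun v : 'rV[R]_d => consv (z, v)) @` A) = hausdorff_measure r A.
Proof.
move=> r0; have p1 : (1 `^ r)%:E = 1%E :> \bar R by rewrite powR1.
apply/eqP; rewrite eq_le; apply/andP; split.
  rewrite -[leRHS]mul1e -p1; apply: hausdorff_lipschitz => // x y.
  by rewrite eucl_dist_consv mul1r.
set B := _ @` A.
have -> : A = @tailv R d @` B.
  apply/seteqP; split => [v Av|_ [_ [v Av <-] <-]]; last by rewrite tailvK.
  by exists (consv (z, v)); [exists v|rewrite tailvK].
rewrite -[leRHS]mul1e -p1; apply: hausdorff_lipschitz => // x y.
by rewrite mul1r eucl_dist_tailv.
Qed.

(** Layers at distinct integer heights are at distance at least 1, so the outer measure is additive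
    on them without any measurability argument. *)
Lemma hausdorff_integer_slices d (r : R) (k : nat) (A : set 'rV[R]_d.+1) : 0 <= r ->
  (forall x, A x -> 0 <= x ord0 ord0 <= k%:R) ->
  hausdorff_measure r (integer_slices A) =
  (\sum_(z < k.+1) hausdorff_measure r (slice A z%:R))%E.
Proof.
move=> r0 Ak.
pose U n : set 'rV[R]_d.+1 := [set x | A x /\ exists2 z, (z < n)%N & x ord0 ord0 = z%:R].
have -> : integer_slices A = U k.+1.
  apply/seteqP; split => [x [Ax /intrP[m mE]]|x [Ax [z _ xz]]]; last first.
    by split => //=; rewrite xz; exact: intr_nat.
  split => //; have := Ak _ Ax; rewrite mE.
  rewrite -[0 : R]/(0%:~R) ler_int => /andP[].
  case: m mE => // n nE _; rewrite -[k%:R]/(k%:Z%:~R : R) ler_int lez_nat => nk.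
  by exists n => //; rewrite nE.
elim: {Ak} k.+1 => [|n IH].
  rewrite big_ord0 (_ : U 0%N = set0) ?hausdorff_measure0//.
  by apply/seteqP; split => // x [_ []].
pose L : set 'rV[R]_d.+1 := (fun v : 'rV[R]_d => consv (n%:R, v)) @` slice A n%:R.
have -> : U n.+1 = U n `|` L.
  apply/seteqP; split => [x [Ax [z zn xz]]|x [[Ax [z zn xz]]|[v Av <-]]].
  - have [zn'|zn'] := ltnP z n; first by left; split => //; exists z.
    have {}zn : z = n by apply/eqP; rewrite eqn_leq zn'; rewrite ltnS in zn; rewrite zn.
    right; exists (tailv x); last by rewrite -zn -xz consvK.
    by rewrite /slice /= -zn -xz consvK.
  - by split => //; exists z => //; exact: ltnW.
  - by split => //; exists n => //; rewrite consv0.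
rewrite big_ord_recr/= -IH -(hausdorff_layer n%:R (slice A n%:R) r0).
apply/eqP; rewrite eq_le; apply/andP; split; first exact: outer_measureU2.
apply: hausdorff_measure_separated => x _ [_ [z zn xz]] [v Av <-].
apply: le_trans (coord_le_eucl_dist _ _ ord0); rewrite consv0 xz /= distrC.
rewrite -natrB ?(ltnW zn)// ger0_norm// ler1n subn_gt0//.
Qed.

(** Above [d] the content at scale delta is of order delta^(r-d) and tends to 0; below [d], a zero
    measure would force the [d]-dimensional one to vanish. *)
Lemma hausdorff_dim_eq p (d : nat) (A : set 'rV[R]_p) :
  (0 < hausdorff_measure (d%:R : R) A < +oo)%E -> hausdorff_dim A = d%:R.
Proof.
move=> /andP[H0 Hy]; set S := [set r : R | 0 <= r /\ hausdorff_measure r A = 0%E].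
have Hfin : hausdorff_measure (d%:R : R) A \is a fin_num by rewrite ge0_fin_numE// ltW.
have big (r : R) : d%:R < r -> S r.
  move=> dr; have r0 : 0 <= r by apply: le_trans (ltW dr).
  split => //; apply/eqP; rewrite eq_le hausdorff_measure_ge0 andbT.
  apply: ge_ereal_sup => _ [delta d0 <-]; apply/lee_addgt0Pr => e e0; rewrite add0e.
  set h := fine (hausdorff_measure (d%:R : R) A).
  have h0 : 0 < h by rewrite fine_gt0// H0.
  have g0 : 0 < gauge_cst (d%:R : R) by exact: gauge_cst_gt0.
  pose K := (gauge_cst r + 1) / gauge_cst d%:R.
  have K0 : 0 < K by rewrite divr_gt0//; have := gauge_cst_ge0 r; lra.
  pose rd := r - d%:R; have rd0 : 0 < rd by rewrite subr_gt0.
  (* Solves K delta'^(r-d) h <= e; passing to a smaller scale only increases the content to be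
     bounded. *)
  pose delta' := Num.min delta ((e / (K * h)) `^ (rd^-1)).
  have eKh : 0 < e / (K * h) by rewrite divr_gt0// mulr_gt0.
  have d'0 : 0 < delta' by rewrite lt_min d0 powR_gt0.
  have d'd : delta' <= delta by rewrite ge_min lexx.
  apply: le_trans (hausdorff_content_anti r A d'd) _.
  apply: le_trans (hausdorff_content_dim A d'0 _ dr g0) _ => //.
  apply: (@le_trans _ _ ((K * delta' `^ rd)%:E * hausdorff_measure (d%:R : R) A)%E).
    apply: lee_wpmul2l; last exact: hausdorff_content_le_measure.
    by rewrite lee_fin mulr_ge0 ?powR_ge0// ltW.
  rewrite -(fineK Hfin) -/h -EFinM lee_fin.
  have : delta' `^ rd <= e / (K * h).
    rewrite -[leRHS](powRr1 (ltW eKh)) -(mulVf (lt0r_neq0 rd0)) powRrM.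
    apply: ge0_ler_powR; [exact: ltW|by rewrite nnegrE ltW|by rewrite nnegrE powR_ge0|].
    by rewrite ge_min lexx orbT.
  have Kh0 : 0 < K * h by exact: mulr_gt0.
  rewrite ler_pdivlMr// => H.
  by have -> : K * delta' `^ rd * h = delta' `^ rd * (K * h) by ring.
have small (r : R) : S r -> d%:R <= r.
  move=> [r0 Hr]; rewrite leNgt; apply/negP => rd.
  move: H0; rewrite ltNge => /negP; apply.
  apply: ge_ereal_sup => _ [delta d0 <-].
  apply: le_trans (hausdorff_content_dim A d0 r0 rd (gauge_cst_gt0 r0)) _.
  have -> : hausdorff_content r delta A = 0%E.
    apply/eqP; rewrite eq_le hausdorff_content_ge0 andbT -Hr.
    exact: hausdorff_content_le_measure.
  by rewrite mule0.
have hi : has_inf S.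
  by split; [exists (d%:R + 1); apply: big; lra|exists d%:R => r; exact: small].
apply/eqP; rewrite eq_le; apply/andP; split; last by apply: lb_le_inf; [exact: hi.1|].
apply/ler_addgt0Pr => e e0; apply: ge_inf; first exact: hi.2.
by apply: big; lra.
Qed.
End HausdorffVolume.

(** * From convex bodies to the statement, and the numerical estimates *)

Section ConvexBodySlices.
Context {R : realType}.
Local Notation borelV := (@borelV R).
Implicit Types d k : nat.

Lemma box_compact d (r : R) : compact (box d r : set 'rV[R]_d).
Proof.
rewrite (_ : box d r = [set v : 'rV[R]_d | forall i, `[- r, r]%classic (v ord0 i)]).
  by apply: (@rV_compact _ _ (fun=> `[- r, r]%classic)) => _; exact: segment_compact.
by apply/seteqP; split => v H i; have := H i; rewrite /= in_itv/= -ler_norml.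
Qed.

Lemma consv_continuous d (z : R) : continuous (fun v : 'rV[R]_d => consv (z, v) : 'rV[R]_d.+1).
Proof.
move=> v B /nbhs_ballP[e /= e0 eB]; apply/nbhs_ballP; exists e => //= w /ballVP -/(_ e0) vw.
apply: eB; apply/ballVP => //; apply/forall_ordS; split => [|j].
  by rewrite !consv0 /= subrr normr0.
by rewrite !consvS; exact: vw.
Qed.

Lemma slice_compact d (A : set 'rV[R]_d.+1) (z : R) : compact A ->
  compact (slice A z : set 'rV[R]_d).
Proof.
move=> cA; have [r Ar] := compact_boundedV cA.
have clA : closed A by apply: compact_closed => //; exact: norm_hausdorff.
apply: (subclosed_compact _ (@box_compact d r)); last exact: slice_box.
by apply: closed_comp => [v _|//]; exact: consv_continuous.
Qed.

Lemma convex_set_convexV d (C : set 'rV[R]_d) :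
  convex_set (C : set (convex_lmodType 'rV[R]_d)) -> convexV C.
Proof.
move=> vC t x y /andP[t0 t1] Cx Cy.
have t0' : 0 <= 1 - t by rewrite subr_ge0 ltW.
have t1' : 1 - t <= 1 by rewrite gerBl ltW.
have := vC x y (Itv01 t0' t1'); rewrite !inE => /(_ Cx Cy).
have E : t = 1 - (1 - t) by rewrite opprB addrC subrK.
by move=> H; rewrite {2}E; exact: H.
Qed.

Lemma interior_vol_gt0 d (C : set 'rV[R]_d) : compact C -> interior C !=set0 ->
  0 < fine (vol d C).
Proof.
move=> cC [x]; rewrite /interior /= => /nbhs_ballP[e /= e0 eC].
have [r Cr] := compact_boundedV cC.
have mC : measurable (C : set (borelV d)) by exact: compact_measurableV.
rewrite fine_gt0// (vol_lty mC Cr) andbT.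
apply: (@lt_le_trans _ _ (vol d (cube x e))).
  by rewrite vol_cube// lte_fin exprn_gt0.
apply: le_measure; rewrite ?inE//; first exact: measurable_cube.
move=> y H; apply: eC; apply/ballVP => // i.
have /andP[H1 H2] := H i; rewrite ltr_norml; apply/andP; split; lra.
Qed.

Lemma proj_first_itv d k (C : set 'rV[R]_d.+1) : proj_first C = `[0, k%:R]%classic ->
  [/\ exists2 q : 'rV[R]_d.+1, C q & q ord0 ord0 = 0,
      exists2 q : 'rV[R]_d.+1, C q & q ord0 ord0 = k%:R &
      forall x : 'rV[R]_d.+1, C x -> 0 <= x ord0 ord0 <= k%:R].
Proof.
move=> pC; split => [||x Cx].
- have : proj_first C 0 by rewrite pC /= in_itv/= lexx ler0n.
  by move=> [q Cq q0]; exists q.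
- have : proj_first C k%:R by rewrite pC /= in_itv/= lexx ler0n.
  by move=> [q Cq q0]; exists q.
- have : proj_first C (x ord0 ord0) by exists x.
  by rewrite pC /= in_itv.
Qed.

(** Reduces halfspaces containing a point to those with the point on their boundary. *)
Lemma halfspace_mem d (u y : 'rV[R]_d) x : halfspace u y x ->
  [set z | dotp u x <= dotp u z] `<=` halfspace u y.
Proof.
rewrite /halfspace /= !dotpBr !subr_ge0 => H z /=.
by rewrite dotpBr subr_ge0; exact: le_trans.
Qed.

(** Translation of [slices_centerpoint]: all the slices involved are compact, so the same factor
    [kappa] appears on both sides. The first conclusion is what identifies the Hausdorff dimension
    as [d]. *)
Lemma integer_slices_centerpoint d k (C : set 'rV[R]_d.+1) :
  (0 < d)%N -> (0 < k)%N -> convex_body C -> proj_first C = `[0, k%:R]%classic ->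
  24 * d%:R < k%:R :> R ->
  (0 < hausdorff_measure (d%:R : R) (integer_slices C) < +oo)%E /\
  exists xbar : 'rV[R]_d.+1, integer_slices C xbar /\
    forall u y : 'rV[R]_d.+1, halfspace u y xbar ->
    ((expR (- 1) - 24 * (d%:R / k%:R))%:E * hausdorff_measure d%:R (integer_slices C)
      <= hausdorff_measure d%:R (integer_slices C `&` halfspace u y))%E.
Proof.
move=> d0 k0 [cC /convex_set_convexV vC iC] /proj_first_itv[Cl Cr C0k] dk.
have V0 := interior_vol_gt0 cC iC.
have [kappa kappa0 Hk] := hausdorff_compact d0 (R := R).
have [r Cbox] := compact_boundedV cC.
have HS (A : set 'rV[R]_d.+1) : compact A -> A `<=` C ->
    hausdorff_measure d%:R (integer_slices A) =
    (kappa * \sum_(z < k.+1) fine (vol d (slice A z%:R)))%:E.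
  move=> cA AC; rewrite (@hausdorff_integer_slices _ _ _ k) => [|//|x /AC]; last exact: C0k.
  rewrite mulr_sumr -sumEFin; apply: eq_bigr => z _.
  have cS : compact (slice A z%:R : set 'rV[R]_d) by exact: slice_compact.
  rewrite Hk// EFinM fineK//; apply: (@vol_fin _ _ _ r).
    exact: compact_measurableV.
  by apply: slice_box; exact: subset_trans Cbox.
have [S0 [xbar [Cx [j jE] Hx]]] := slices_centerpoint d0 k0 cC vC V0 Cl Cr C0k dk.
split; first by rewrite HS// lte_fin mulr_gt0// ltry.
exists xbar; split; first by split => //=; rewrite jE; exact: intr_nat.
move=> u y xy; set A := C `&` [set x | dotp u xbar <= dotp u x].
have cA : compact A.
  have clu : closed [set x : 'rV[R]_d.+1 | dotp u xbar <= dotp u x].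
    apply: closed_superlevel; rewrite (_ : dotp u = fun x => dotp u x + 0).
      exact: dotp_continuous.
    by apply/funext => x; rewrite addr0.
  apply: (subclosed_compact _ cC) => [|x []//].
  by apply: closedI => //; apply: compact_closed => //; exact: norm_hausdorff.
apply: (@le_trans _ _ (hausdorff_measure d%:R (integer_slices A))).
  rewrite !HS//; last by move=> x [].
  rewrite -EFinM lee_fin mulrCA ler_pM2l//; exact: Hx.
apply: hausdorff_measure_le => x [[xC xu] xi]; split => //.
exact: halfspace_mem xy _ xu.
Qed.

(** Bernoulli gives (1 + 1/d)^d >= 2. *)
Lemma half_pow_le (d : nat) : (0 < d)%N ->
  2^-1 * (d%:R / (d%:R + 1)) ^+ d <= 1 / 4 :> R.
Proof.
move=> d0; have dR : 1 <= d%:R :> R by rewrite ler1n.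
have H : 2 <= ((d%:R + 1) / d%:R) ^+ d :> R.
  have d1 : -1 <= d%:R^-1 :> R by apply: (@le_trans _ _ 0); [lra|rewrite invr_ge0].
  have := bernoulli_ineq d d1; rewrite divff ?gt_eqF//; last by lra.
  have -> : 1 + d%:R^-1 = (d%:R + 1) / d%:R :> R by field; lra.
  lra.
have -> : (d%:R / (d%:R + 1)) ^+ d = (((d%:R + 1) / d%:R) ^+ d)^-1 :> R.
  by rewrite -exprVn invf_div.
have : (((d%:R + 1) / d%:R) ^+ d)^-1 <= 2^-1 :> R.
  by rewrite lef_pV2 ?posrE//; apply: lt_le_trans H.
lra.
Qed.

(** Fourth power of exp(-1/4) >= 1 - 1/4; this is enough to beat 1/4 with room to spare. *)
Lemma expRN1_ge : 81 / 256 <= expR (- 1) :> R.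
Proof.
have H : 3 / 4 <= expR (- (1 / 4)) :> R.
  by apply: le_trans (expR_ge1Dx _); lra.
have -> : - 1 = - (1 / 4) * 4 :> R by lra.
rewrite expRM_natr.
have -> : 81 / 256 = (3 / 4) ^+ 4 :> R by field.
by rewrite lerXn2r// nnegrE ?expR_ge0//; lra.
Qed.
End ConvexBodySlices.

Theorem theorem3p4 (R : realType) :
  (exists c : R, 0 < c /\
    forall (d k : nat) (C : set 'rV[R]_d.+1),
      (1 <= d)%N -> (1 <= k)%N ->
      convex_body C -> proj_first C = `[0, k%:R]%classic ->
      let S := integer_slices C in
      exists xbar : 'rV[R]_d.+1, S xbar /\
        forall u y : 'rV[R]_d.+1, u != 0 -> halfspace u y xbar ->
          (((expR 1)^-1 - c * (d%:R / k%:R))%:E * hausdorff_measure d%:R S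
            <= hausdorff_measure d%:R (S `&` halfspace u y))%E) /\
  (exists alpha : R, 0 < alpha /\
    forall (d k : nat) (C : set 'rV[R]_d.+1),
      (1 <= d)%N -> (1 <= k)%N ->
      convex_body C -> proj_first C = `[0, k%:R]%classic ->
      alpha * d%:R <= k%:R ->
      ((2^-1 * (d%:R / (d%:R + 1)) ^+ d)%:E
        <= oertel_radius (integer_slices C))%E).
Proof.
split.
  exists 24; split => // d k C d1 k1 bC pC S.
  rewrite -expRN.
  have kR : 0 < k%:R :> R by rewrite ltr0n.
  have [dk|dk] := ltP (24 * d%:R) (k%:R : R).
    have [_ [xbar [Sx H]]] := integer_slices_centerpoint d1 k1 bC pC dk.
    by exists xbar; split => // u y _; exact: H.
  (* When k <= 24 d the factor is nonpositive and any point of S serves; one at height 0 exists. *)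
  have [[q Cq q0] _ _] := proj_first_itv pC.
  exists q; split; first by split => //=; rewrite q0; exact: int_num0.
  move=> u y _ _; apply: (@le_trans _ _ 0%E); last exact: hausdorff_measure_ge0.
  apply: mule_le0_ge0; last exact: hausdorff_measure_ge0.
  rewrite lee_fin subr_le0; apply: (@le_trans _ _ 1).
    by rewrite -[leRHS]expR0 ler_expR; lra.
  by rewrite mulrA ler_pdivlMr// mul1r.
(* Chosen so that 81/256 - 24/400 is still at least 1/4. *)
exists 400; split => // d k C d1 k1 bC pC dk.
have dR : 1 <= d%:R :> R by rewrite ler1n.
have kR : 0 < k%:R :> R by rewrite ltr0n.
have dk24 : 24 * d%:R < k%:R :> R by lra.
have [HS [xbar [Sx H]]] := integer_slices_centerpoint d1 k1 bC pC dk24.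
have /andP[HS0 HSy] := HS.
rewrite /oertel_radius (hausdorff_dim_eq HS).
apply: le_ereal_sup_tmp; eexists; first by exists xbar.
apply: le_ereal_inf_tmp => _ [u _ <-].
have Hfin : hausdorff_measure (d%:R : R) (integer_slices C) \is a fin_num.
  by rewrite ge0_fin_numE// ltW.
have h0 : 0 < fine (hausdorff_measure (d%:R : R) (integer_slices C)) by rewrite fine_gt0// HS0.
rewrite -(fineK Hfin) inver gt_eqF// lee_pdivlMr// fineK//.
have ux : halfspace u xbar xbar.
  by rewrite /halfspace /= subrr dotpE big1// => i _; rewrite mxE mulr0.
rewrite setIC; apply: le_trans (H u xbar ux).
apply: lee_wpmul2r; first exact: hausdorff_measure_ge0.
rewrite lee_fin; apply: le_trans (@half_pow_le R _ d1) _.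
have hk : d%:R / k%:R <= 1 / 400 :> R by rewrite ler_pdivrMr//; lra.
have := @expRN1_ge R; lra.
Qed.
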